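(* Let $\mathcal{L}$ be a polar space. A function $f:\mathcal{L}\to\mathbf{R}\cup\{\infty\}$ is submodular if and only if its Lovász extension $\overline f:K(\mathcal{L})\to\mathbf{R}\cup\{\infty\}$ is convex.
   Context: $\mathcal{S}_2=\{-1,0,1\}$ is the poset with minimum $0$ and incomparable $-1,1$; $\mathcal{S}_2^n$ has the componentwise order. A polar space of rank $n$ is a meet-semilattice $\mathcal{L}$ that is a union of subsemilattices (polar frames) such that (P0) each polar frame is isomorphic to $\mathcal{S}_2^n$; (P1) any two chains lie in a common polar frame; (P2) if polar frames $\mathcal{F},\mathcal{F}'$ both contain chains $C,D$, there is an isomorphism $\mathcal{F}\to\mathcal{F}'$ fixing $C,D$ pointwise. It is a modular semilattice (meet-semilattice of finite rank with rank $r$, principal ideals modular lattices, $x\vee y\vee z$ exists whenever the pairwise joins exist), graded by $r$. Submodularity: for $p,q$ let $I(p,q)$ be the elements on shortest $p$–$q$ paths of the covering graph; $r(u;p,q)=(r(u\wedge p)-r(p\wedge q),r(u\wedge q)-r(p\wedge q))$; $\mathcal{E}(p,q)$ the $u\in I(p,q)$ with $r(u;p,q)$ a componentwise-maximal extreme point of the convex hull $\mathrm{Conv}I(p,q)$; $C(u;p,q)=\{w\in\mathbf{R}^2_{\ge0}:\langle w,r(u;p,q)\rangle=\max_{z\in\mathrm{Conv}I(p,q)}\langle w,z\rangle\}=\{(x,y)\ge0:y\cos\alpha\le x\sin\alpha,\ y\cos\beta\ge x\sin\beta\}$ ($0\le\beta\le\alpha\le\pi/2$), $[C]=\frac{\sin\alpha}{\sin\alpha+\cos\alpha}-\frac{\sin\beta}{\sin\beta+\cos\beta}$.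 $f$ is submodular if $f(p)+f(q)\ge f(p\wedge q)+\sum_{u\in\mathcal{E}(p,q)}[C(u;p,q)]f(u)$ for all $p,q$ (zero-coefficient terms omitted; $a+\infty=\infty$). Orthoscheme complex: $K(\mathcal{L})$ is the set of formal convex combinations $\sum\lambda_ip_i$ supported on chains; a chain $p_0\prec\dots\prec p_k$ gives a simplex mapped by $\varphi(\sum\lambda_ip_i)=\sum_{i\ge1}\lambda_i(e_1+\dots+e_{r(p_i)-r(p_0)})$ into Euclidean space, with distance $\|\varphi(x)-\varphi(y)\|_2$ inside the simplex; $K(\mathcal{L})$ carries the induced length metric (infimum over continuous paths of $\sup\sum d_{\sigma_i}(\gamma(t_i),\gamma(t_{i+1}))$ over partitions with pieces inside simplices), a geodesic metric. $\overline f(\sum\lambda_ip_i)=\sum\lambda_if(p_i)$. $F$ is convex if $F(\gamma(t))\le(1-t)F(\gamma(0))+tF(\gamma(1))$ for every geodesic $\gamma:[0,1]\to K(\mathcal{L})$ and $t\in[0,1]$. *)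

(* Defs.v *)
From Stdlib Require Import Reals List Arith ClassicalEpsilon.
From Coquelicot Require Import Coquelicot.
Import ListNotations.
Open Scope R_scope.

Inductive ER : Type := fin : R -> ER | pinf : ER.

Definition eadd (a b : ER) : ER :=
  match a, b with fin x, fin y => fin (x + y) | _, _ => pinf end.

(* scaling by a real coefficient c >= 0; convention 0 * ∞ = 0 *)
Definition escale (c : R) (a : ER) : ER :=
  match a with
  | fin x => fin (c * x)
  | pinf => if Req_EM_T c 0 then fin 0 else pinf
  end.

Definition ele (a b : ER) : Prop :=
  match a, b with
  | fin x, fin y => x <= y
  | _, pinf => True
  | pinf, fin _ => False
  end.

Definition sumL {A : Type} (l : list A) (g : A -> R) : R :=
  fold_right (fun a acc => g a + acc) 0 l.

Definition esumL {A : Type} (l : list A) (g : A -> ER) : ER :=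
  fold_right (fun a acc => eadd (g a) acc) (fin 0) l.

Section Order.
Context {L : Type} (le : L -> L -> Prop).

Definition lt (x y : L) : Prop := le x y /\ x <> y.

Definition is_partial_order : Prop :=
  (forall x, le x x) /\
  (forall x y, le x y -> le y x -> x = y) /\
  (forall x y z, le x y -> le y z -> le x z).

Definition is_meet (meet : L -> L -> L) : Prop :=
  forall x y, le (meet x y) x /\ le (meet x y) y /\
    (forall z, le z x -> le z y -> le z (meet x y)).

Definition is_chain (C : L -> Prop) : Prop :=
  forall a b, C a -> C b -> le a b \/ le b a.

Definition chain_to (p : L) (k : nat) : Prop :=
  exists s : nat -> L, (forall i, (i < k)%nat -> lt (s i) (s (S i))) /\ s k = p.

Definition rank (p : L) : nat :=
  epsilon (inhabits 0%nat)
    (fun k => chain_to p k /\ forall m, chain_to p m -> (m <= k)%nat).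

Definition covers (x y : L) : Prop :=
  lt x y /\ ~ (exists z, lt x z /\ lt z y).

Definition adj (x y : L) : Prop := covers x y \/ covers y x.

Fixpoint is_walk (x : L) (w : list L) : Prop :=
  match w with [] => True | y :: w' => adj x y /\ is_walk y w' end.

(* walk p = x_0, x_1, ..., x_k = q encoded as p :: w with last = q;
   its length is  length w *)
Definition walk_pq (p q : L) (w : list L) : Prop :=
  is_walk p w /\ last (p :: w) p = q.

Definition shortest_walk (p q : L) (w : list L) : Prop :=
  walk_pq p q w /\ forall w', walk_pq p q w' -> (length w <= length w')%nat.

Definition Ipq (p q u : L) : Prop :=
  exists w, shortest_walk p q w /\ In u (p :: w).

End Order.

Inductive S2 : Type := S2m | S2z | S2p.   (* -1, 0, 1 *)

Definition s2le (a b : S2) : Prop := a = b \/ a = S2z.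

(* elements of S_2^n : functions nat -> S2 vanishing (= 0) from n on *)
Definition s2vec (n : nat) (v : nat -> S2) : Prop :=
  forall i, (n <= i)%nat -> v i = S2z.

Definition s2nle (n : nat) (v w : nat -> S2) : Prop :=
  forall i, (i < n)%nat -> s2le (v i) (w i).

Section Polar.
Context {L : Type} (le : L -> L -> Prop) (meet : L -> L -> L).

Definition iso_to_S2n (n : nat) (F : L -> Prop) : Prop :=
  exists phi : L -> (nat -> S2),
    (forall x, F x -> s2vec n (phi x)) /\
    (forall v, s2vec n v -> exists x, F x /\ forall i, phi x i = v i) /\
    (forall x y, F x -> F y -> (le x y <-> s2nle n (phi x) (phi y))).

Definition iso_between (F F' : L -> Prop) (psi : L -> L) : Prop :=
  (forall x, F x -> F' (psi x)) /\
  (forall y, F' y -> exists x, F x /\ psi x = y) /\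
  (forall x y, F x -> F y -> (le x y <-> le (psi x) (psi y))).

Definition is_subsemilattice (F : L -> Prop) : Prop :=
  forall x y, F x -> F y -> F (meet x y).

Definition subset (A B : L -> Prop) : Prop := forall x, A x -> B x.

Definition is_polar_space (n : nat) (Frames : (L -> Prop) -> Prop) : Prop :=
  is_partial_order le /\ is_meet le meet /\
  (forall x, exists F, Frames F /\ F x) /\
  (forall F, Frames F -> is_subsemilattice F) /\
  (forall F, Frames F -> iso_to_S2n n F) /\
  (forall C D, is_chain le C -> is_chain le D ->
     exists F, Frames F /\ subset C F /\ subset D F) /\
  (forall C D F F', is_chain le C -> is_chain le D -> Frames F -> Frames F' ->
     subset C F -> subset D F -> subset C F' -> subset D F' ->
     exists psi, iso_between F F' psi /\
       (forall x, C x -> psi x = x) /\ (forall x, D x -> psi x = x)).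

Definition rvec (p q u : L) : R * R :=
  (INR (rank le (meet u p)) - INR (rank le (meet p q)),
   INR (rank le (meet u q)) - INR (rank le (meet p q))).

Definition padd (a b : R * R) : R * R := (fst a + fst b, snd a + snd b).
Definition pscale (c : R) (a : R * R) : R * R := (c * fst a, c * snd a).
Definition pdot (a b : R * R) : R := fst a * fst b + snd a * snd b.

Definition in_hull (P : R * R -> Prop) (z : R * R) : Prop :=
  exists l : list (R * (R * R)),
    (forall c pt, In (c, pt) l -> 0 <= c /\ P pt) /\
    sumL l fst = 1 /\
    z = fold_right (fun cp acc => padd (pscale (fst cp) (snd cp)) acc) (0, 0) l.

Definition is_extreme (S : R * R -> Prop) (z : R * R) : Prop :=
  S z /\ forall a b t, S a -> S b -> 0 < t < 1 ->
    z = padd (pscale (1 - t) a) (pscale t b) -> a = b.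

Definition is_cw_maximal (S : R * R -> Prop) (z : R * R) : Prop :=
  S z /\ forall z', S z' -> fst z <= fst z' -> snd z <= snd z' -> z' = z.

Definition ConvI (p q : L) : R * R -> Prop :=
  in_hull (fun z => exists u, Ipq le p q u /\ z = rvec p q u).

Definition Epq (p q u : L) : Prop :=
  Ipq le p q u /\ is_extreme (ConvI p q) (rvec p q u) /\
  is_cw_maximal (ConvI p q) (rvec p q u).

(* C(u;p,q) : w >= 0 with <w, r(u;p,q)> = max over Conv I(p,q) of <w,z>
   (r(u;p,q) belongs to Conv I(p,q), so this says it attains the max) *)
Definition Cone (p q u : L) (w : R * R) : Prop :=
  0 <= fst w /\ 0 <= snd w /\
  forall z, ConvI p q z -> pdot w z <= pdot w (rvec p q u).

Definition cone_angles (C : R * R -> Prop) (ab : R * R) : Prop :=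
  let a := fst ab in let b := snd ab in
  0 <= b /\ b <= a /\ a <= PI / 2 /\
  forall x y, C (x, y) <->
    (0 <= x /\ 0 <= y /\ y * cos a <= x * sin a /\ y * cos b >= x * sin b).

Definition cone_coef (C : R * R -> Prop) : R :=
  let ab := epsilon (inhabits (0, 0)) (cone_angles C) in
  let a := fst ab in let b := snd ab in
  sin a / (sin a + cos a) - sin b / (sin b + cos b).

Definition coefE (p q u : L) : R := cone_coef (Cone p q u).

(* f(p)+f(q) >= f(p∧q) + sum_{u in E(p,q)} [C(u;p,q)] f(u),
   zero-coefficient terms omitted; the sum ranges over an enumeration
   (duplicate-free list) of the finite set E(p,q). *)
Definition submodular (f : L -> ER) : Prop :=
  forall p q (l : list L), NoDup l -> (forall u, In u l <-> Epq p q u) ->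
    ele (eadd (f (meet p q))
              (esumL l (fun u => if Req_EM_T (coefE p q u) 0 then fin 0
                                 else escale (coefE p q u) (f u))))
        (eadd (f p) (f q)).

Definition is_point (x : L -> R) : Prop :=
  (forall p, 0 <= x p) /\
  exists s : list L, NoDup s /\ (forall p, x p <> 0 <-> In p s) /\
    (forall a b, In a s -> In b s -> le a b \/ le b a) /\ sumL s x = 1.

Fixpoint incr_from (a : L) (s : list L) : Prop :=
  match s with [] => True | b :: s' => lt le a b /\ incr_from b s' end.

Definition is_simplex (sg : list L) : Prop :=
  match sg with [] => False | a :: s => incr_from a s end.

Definition in_simplex (sg : list L) (x : L -> R) : Prop :=
  is_point x /\ forall p, x p <> 0 -> In p sg.

(* phi(sum lambda_i p_i) = sum_{i>=1} lambda_i (e_1 + ... + e_{r(p_i)-r(p_0)}),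
   j-th coordinate (j >= 1) *)
Definition phi_coord (sg : list L) (x : L -> R) (j : nat) : R :=
  match sg with
  | [] => 0
  | p0 :: s =>
      sumL s (fun p => if Nat.leb j (rank le p - rank le p0) then x p else 0)
  end.

Definition dsig (sg : list L) (x y : L -> R) : R :=
  match sg with
  | [] => 0
  | p0 :: s =>
      let N := (rank le (last s p0) - rank le p0)%nat in
      sqrt (sumL (seq 1 N)
              (fun j => (phi_coord sg x j - phi_coord sg y j) ^ 2))
  end.

Definition partition_ok (g : R -> (L -> R)) (m : nat) (tt : nat -> R)
    (sg : nat -> list L) : Prop :=
  (1 <= m)%nat /\ tt 0%nat = 0 /\ tt m = 1 /\
  forall i, (i < m)%nat ->
    tt i < tt (S i) /\ is_simplex (sg i) /\
    forall s, tt i <= s <= tt (S i) -> in_simplex (sg i) (g s).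

Definition piece_continuous (sg : list L) (g : R -> (L -> R)) (a b : R) : Prop :=
  forall t, a <= t <= b -> forall eps, 0 < eps -> exists delta, 0 < delta /\
    forall s, a <= s <= b -> Rabs (s - t) < delta -> dsig sg (g s) (g t) < eps.

Definition is_path (g : R -> (L -> R)) (x y : L -> R) : Prop :=
  g 0 = x /\ g 1 = y /\ (forall t, 0 <= t <= 1 -> is_point (g t)) /\
  exists m tt sg, partition_ok g m tt sg /\
    forall i, (i < m)%nat -> piece_continuous (sg i) g (tt i) (tt (S i)).

Definition path_length (g : R -> (L -> R)) : Rbar :=
  Lub_Rbar (fun l => exists m tt sg, partition_ok g m tt sg /\
    l = sumL (seq 0 m) (fun i => dsig (sg i) (g (tt i)) (g (tt (S i))))).

Definition Kdist (x y : L -> R) : Rbar :=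
  Glb_Rbar (fun l => exists g, is_path g x y /\ path_length g = Finite l).

Definition is_geodesic (g : R -> (L -> R)) : Prop :=
  (forall t, 0 <= t <= 1 -> is_point (g t)) /\
  forall s t, 0 <= s <= 1 -> 0 <= t <= 1 ->
    Kdist (g s) (g t) = Rbar_mult (Rabs (s - t)) (Kdist (g 0) (g 1)).

Definition Kconvex (F : (L -> R) -> ER) : Prop :=
  forall g, is_geodesic g -> forall t, 0 <= t <= 1 ->
    ele (F (g t)) (eadd (escale (1 - t) (F (g 0))) (escale t (F (g 1)))).

Definition supp (x : L -> R) : list L :=
  epsilon (inhabits []) (fun s => NoDup s /\ forall p, x p <> 0 <-> In p s).

Definition lovasz (f : L -> ER) (x : L -> R) : ER :=
  esumL (supp x) (fun p => escale (x p) (f p)).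

End Polar.

(* Main.v *)
(* A frame is a copy of [S_2^n], and its part of the complex is the cube [[-1,1]^n] with its
   Euclidean metric.  Retractions of the polar space onto a frame, centred at a maximal chain,
   do not increase distances, so the metric of the complex restricts to the Euclidean metric
   of each frame; a retraction centred at a point [m] of a segment shows that a geodesic with
   the same ends can only pass through [m].  Geodesics are therefore straight segments of
   frames, and everything happens inside one cube.
   For [p], [q] in a frame let [u1] be [p] with its zero coordinates filled in from [q], and
   [u2] be [q] filled in from [p].  Then [E(p,q) = {u1, u2}], and submodularity reads
   [f(p/\q) + f(u1)/2 + f(u2)/2 <= f(p) + f(q)].  If it holds, uncrossing shows that the
   Lovasz extension at [v] is the least mean of [f] over the measures on the frame with
   barycentre [v], which is convex in [v].  Conversely, convexity at midpoints of vertices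
   yields [f(p/\q) + f(w) <= f(p) + f(q)], where [w] is the join with conflicting coordinates
   set to zero; five instances of it combine to the inequality above. *)

Require Import Defs.
From Stdlib Require Import Reals List Arith Lia Lra Permutation.
From Stdlib Require Import Classical ClassicalEpsilon FunctionalExtensionality.
From Coquelicot Require Import Coquelicot.
Import ListNotations.
Open Scope R_scope.

(** * Finite sums and lists *)

(** A retraction has to be well defined although (P2) fixes only two chains at a time. One chain is
    spent on the flag, the other on the element to be mapped: its position relative to the flag is
    expressed through the order alone, so it is the same in every frame through both. The outcome is
    one map [h] to sign vectors that is a coordinate system on some frame through any given chain.
    This is enough, since ranks, covering pairs and simplices only involve chains. The same map also
    handles elements of [I(p,q)] outside the frame chosen for [p] and [q]. The least mean is a
    linear program, whose minimum is attained at one of finitely many vertices. Ties could leave a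
    cheapest measure off every chain, so the cost is perturbed by [eps * potential]. The perturbed
    minimizers all have the same barycentre and lie on chains, hence coincide, and [eps] can tend to
    0. Infinite values are removed from the program beforehand; uncrossing elements of finite value
    yields only elements of finite value. *)

Lemma sumL_ext {A} (l : list A) (f g : A -> R) :
  (forall a, In a l -> f a = g a) -> sumL l f = sumL l g.
Proof.
induction l as [|a l IH]; simpl; intros H; [reflexivity|].
rewrite H by auto. rewrite IH; auto.
Qed.

Lemma sumL_plus {A} (l : list A) (f g : A -> R) :
  sumL l (fun a => f a + g a) = sumL l f + sumL l g.
Proof. induction l as [|a l IH]; simpl; [|rewrite IH]; lra. Qed.

Lemma sumL_minus {A} (l : list A) (f g : A -> R) :
  sumL l (fun a => f a - g a) = sumL l f - sumL l g.
Proof. induction l as [|a l IH]; simpl; [|rewrite IH]; lra. Qed.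

Lemma sumL_scal {A} (l : list A) (c : R) (f : A -> R) :
  sumL l (fun a => c * f a) = c * sumL l f.
Proof. induction l as [|a l IH]; simpl; [|rewrite IH]; lra. Qed.

Lemma sumL_zero {A} (l : list A) (f : A -> R) :
  (forall a, In a l -> f a = 0) -> sumL l f = 0.
Proof.
induction l as [|a l IH]; simpl; intros H; [reflexivity|].
rewrite H by auto. rewrite IH; auto; lra.
Qed.

Lemma sumL_app {A} (l l' : list A) (f : A -> R) :
  sumL (l ++ l') f = sumL l f + sumL l' f.
Proof. induction l as [|a l IH]; simpl; [|rewrite IH]; lra. Qed.

Lemma sumL_le {A} (l : list A) (f g : A -> R) :
  (forall a, In a l -> f a <= g a) -> sumL l f <= sumL l g.
Proof.
induction l as [|a l IH]; simpl; intros H; [lra|].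
specialize (IH (fun b Hb => H b (or_intror Hb))). specialize (H a (or_introl eq_refl)). lra.
Qed.

Lemma sumL_nonneg {A} (l : list A) (f : A -> R) :
  (forall a, In a l -> 0 <= f a) -> 0 <= sumL l f.
Proof.
intros H. rewrite <- (sumL_zero l (fun _ => 0)) by auto. now apply sumL_le.
Qed.

Lemma sumL_nonneg_zero {A} (l : list A) (f : A -> R) :
  (forall a, In a l -> 0 <= f a) -> sumL l f <= 0 -> forall a, In a l -> f a = 0.
Proof.
induction l as [|b l IH]; simpl; intros H Hs a Ha; [tauto|].
assert (H0 := sumL_nonneg l f (fun c Hc => H c (or_intror Hc))).
assert (H1 := H b (or_introl eq_refl)).
destruct Ha as [<-|Ha]; [lra|]. apply IH; auto; lra.
Qed.

Lemma sumL_swap {A B} (l : list A) (l' : list B) (f : A -> B -> R) :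
  sumL l (fun a => sumL l' (fun b => f a b)) = sumL l' (fun b => sumL l (fun a => f a b)).
Proof.
induction l as [|a l IH]; simpl.
- symmetry. now apply sumL_zero.
- rewrite IH, <- sumL_plus. reflexivity.
Qed.

Lemma sumL_sqr {A} (l : list A) (f : A -> R) :
  (sumL l f) ^ 2 = sumL l (fun a => sumL l (fun b => f a * f b)).
Proof.
transitivity (sumL l (fun a => sumL l f * f a)).
- rewrite sumL_scal. ring.
- apply sumL_ext. intros a _. rewrite sumL_scal. ring.
Qed.

Lemma sumL_support {A} (s t : list A) (g : A -> R) : NoDup s -> NoDup t ->
  (forall a, g a <> 0 -> (In a s <-> In a t)) -> sumL s g = sumL t g.
Proof.
intros Hs. revert t. induction Hs as [|a s Ha Hs IH]; intros t Ht H; simpl.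
- symmetry. apply sumL_zero. intros a Ha. apply NNPP. intros Hg. now apply (H a Hg).
- destruct (Req_EM_T (g a) 0) as [Hg|Hg].
  + rewrite Hg, Rplus_0_l. apply IH; auto. intros b Hb. rewrite <- (H b Hb). simpl.
    split; auto. intros [<-|]; congruence.
  + assert (Hin : In a t) by (apply H; simpl; auto).
    destruct (in_split _ _ Hin) as (t1 & t2 & ->).
    rewrite (IH (t1 ++ t2)).
    * rewrite !sumL_app. simpl. lra.
    * now apply NoDup_remove_1 in Ht.
    * intros b Hb. apply NoDup_remove_2 in Ht. specialize (H b Hb). simpl in H.
      rewrite in_app_iff in *. simpl in H. split; intros Hb'.
      -- assert (b <> a) by congruence. destruct (proj1 H (or_intror Hb')) as [|[|]]; auto. congruence.
      -- assert (b <> a) by (intros ->; tauto).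
         destruct (proj2 H) as [|]; tauto || congruence.
Qed.

Definition eqdec {A : Type} (a b : A) : {a = b} + {a <> b} :=
  excluded_middle_informative (a = b).

(** As a function of [b] this is the point mass at [a], so [indic p] is the vertex [p] of the
    complex. *)
Definition indic {A : Type} (a b : A) : R := if eqdec a b then 1 else 0.

Lemma indic_same {A} (a : A) : indic a a = 1.
Proof. unfold indic. destruct (eqdec a a); congruence. Qed.

Lemma indic_diff {A} (a b : A) : a <> b -> indic a b = 0.
Proof. unfold indic. destruct (eqdec a b); congruence. Qed.

Lemma indic_nonneg {A} (a b : A) : 0 <= indic a b.
Proof. unfold indic. destruct (eqdec a b); lra. Qed.

Lemma indic_neq0 {A} (a b : A) : indic a b <> 0 -> a = b.
Proof. unfold indic. destruct (eqdec a b); congruence. Qed.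

Lemma sumL_indic {A} (l : list A) (a : A) (g : A -> R) : NoDup l -> In a l ->
  sumL l (fun b => indic a b * g b) = g a.
Proof.
intros Hl Ha. rewrite (sumL_support l [a]); auto.
- simpl. rewrite indic_same. lra.
- repeat constructor. simpl; auto.
- intros b Hb. assert (a = b) by (apply indic_neq0; intros E; rewrite E in Hb; lra).
  subst. simpl. tauto.
Qed.

Lemma classical_filter {A} (P : A -> Prop) (l : list A) :
  exists l', NoDup l' /\ forall a, In a l' <-> In a l /\ P a.
Proof.
exists (nodup eqdec (filter (fun a => if excluded_middle_informative (P a) then true else false) l)).
split; [apply NoDup_nodup|]. intros a. rewrite nodup_In, filter_In.
destruct (excluded_middle_informative (P a)); split; intuition congruence.
Qed.

Lemma list_argmin {A} (l : list A) (P : A -> Prop) (g : A -> R) :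
  (exists a, In a l /\ P a) ->
  exists a, In a l /\ P a /\ forall b, In b l -> P b -> g a <= g b.
Proof.
induction l as [|c l IH]; intros (a & Ha & HP); [now destruct Ha|].
destruct (classic (exists a, In a l /\ P a)) as [Hl|Hl].
- destruct (IH Hl) as (d & Hd & HPd & Hmin).
  destruct (classic (P c /\ g c <= g d)) as [[Hc Hcd]|Hc].
  + exists c. repeat split; simpl; auto. intros b [<-|Hb] HPb; [lra|].
    specialize (Hmin b Hb HPb). lra.
  + exists d. repeat split; simpl; auto. intros b [<-|Hb] HPb; [|auto].
    destruct (Rle_lt_dec (g d) (g c)); auto. exfalso. apply Hc. split; auto. lra.
- destruct Ha as [<-|Ha]; [|exfalso; eauto].
  exists c. repeat split; simpl; auto. intros b [<-|Hb] HPb; [lra|]. exfalso; eauto.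
Qed.

(** Insertion sort with classical comparisons. [R] is only a total preorder on [l]: it will compare
    coordinates by absolute value simultaneously at all points of a set. *)
Lemma total_sort {A} (R : A -> A -> Prop) (l : list A) :
  (forall x y z, R x y -> R y z -> R x z) ->
  (forall x y, In x l -> In y l -> R x y \/ R y x) ->
  exists l', Permutation l l' /\ ForallOrdPairs R l'.
Proof.
intros Htr. induction l as [|a l IH]; intros Htot.
- exists []. split; constructor.
- destruct IH as (l' & Hp & Ho); [intros; apply Htot; simpl; auto|].
  assert (Hin : forall x, In x l' -> In x l) by (intros x; apply Permutation_in; now symmetry).
  assert (Hins : exists l'', Permutation (a :: l') l'' /\ ForallOrdPairs R l'').
  { assert (Hta : forall x, In x l' -> R a x \/ R x a) by (intros x Hx; apply Htot; simpl; auto).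
    clear Hp Hin Htot. induction Ho as [|b l' Hb Ho IH].
    - exists [a]. split; auto. repeat constructor.
    - destruct (classic (R a b)) as [Hab|Hab].
      + exists (a :: b :: l'). split; auto. repeat (constructor; auto).
        eapply Forall_impl; [|exact Hb]. intros x. now apply Htr.
      + destruct IH as (l'' & Hp & Ho''); [intros; apply Hta; simpl; auto|].
        exists (b :: l''). split.
        * rewrite perm_swap. now constructor.
        * constructor; auto. apply Forall_forall. intros x Hx.
          apply (Permutation_in _ (Permutation_sym Hp)) in Hx. destruct Hx as [<-|Hx].
          -- destruct (Hta b); simpl; tauto.
          -- rewrite Forall_forall in Hb. auto. }
  destruct Hins as (l'' & Hp' & Ho'). exists l''. split; auto.
  rewrite <- Hp'. now constructor.
Qed.

Lemma ForallOrdPairs_nth {A} (R : A -> A -> Prop) (l : list A) (d : A) (i j : nat) :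
  ForallOrdPairs R l -> (i < j < length l)%nat -> R (nth i l d) (nth j l d).
Proof.
intros Ho. revert i j. induction Ho as [|a l Ha Ho IH]; simpl; intros i j Hij; [lia|].
destruct j as [|j]; [lia|]. destruct i as [|i].
- rewrite Forall_forall in Ha. apply Ha, nth_In. lia.
- apply IH. lia.
Qed.

Lemma sumL_telescope (w : nat -> R) (a m : nat) :
  sumL (seq a m) (fun k => w k - w (S k)) = w a - w (a + m)%nat.
Proof.
revert a. induction m as [|m IH]; intros a; simpl.
- rewrite Nat.add_0_r. lra.
- rewrite IH. replace (S a + m)%nat with (a + S m)%nat by lia. lra.
Qed.

Lemma sumL_ones_below (N a : nat) : (a <= N)%nat ->
  sumL (seq 1 N) (fun j => if Nat.leb j a then 1 else 0) = INR a.
Proof.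
intros Ha. replace N with (a + (N - a))%nat by lia. rewrite seq_app, sumL_app.
rewrite (sumL_ext (seq 1 a) _ (fun j => 1)).
- rewrite (sumL_zero (seq (1 + a) (N - a))).
  + rewrite Rplus_0_r. clear Ha. generalize 1%nat.
    induction a as [|a IH]; intros k; [reflexivity|].
    simpl seq. simpl sumL. rewrite IH, S_INR. lra.
  + intros j Hj. apply in_seq in Hj. destruct (Nat.leb_spec j a); lia || reflexivity.
- intros j Hj. apply in_seq in Hj. destruct (Nat.leb_spec j a); lia || reflexivity.
Qed.

Lemma sumL_cauchy {A} (l : list A) (a b : A -> R) :
  (sumL l (fun i => a i * b i)) ^ 2 <= sumL l (fun i => a i ^ 2) * sumL l (fun i => b i ^ 2).
Proof.
set (S := sumL l (fun i => a i * b i)). set (X := sumL l (fun i => a i ^ 2)).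
set (Y := sumL l (fun i => b i ^ 2)).
assert (HX : 0 <= X) by (apply sumL_nonneg; intros; apply pow2_ge_0).
assert (HY : 0 <= Y) by (apply sumL_nonneg; intros; apply pow2_ge_0).
(* [X * (X * Y - S ^ 2)] is the sum of the squares of [X * b i - S * a i]. When [X = 0] all [a i]
   vanish. *)
assert (H : 0 <= X * (X * Y - S ^ 2)).
{ assert (H : 0 <= sumL l (fun i => (X * b i - S * a i) ^ 2))
    by (apply sumL_nonneg; intros; apply pow2_ge_0).
  rewrite (sumL_ext _ _ (fun i => X ^ 2 * b i ^ 2 - (2 * X * S) * (a i * b i) + S ^ 2 * a i ^ 2)) in H
    by (intros; ring).
  rewrite sumL_plus, sumL_minus, !sumL_scal in H. fold S X Y in H. lra. }
destruct (Rle_lt_or_eq_dec 0 X HX) as [Hp|Hz].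
- nra.
- assert (S = 0).
  { apply sumL_zero. intros i Hi.
    assert (H0 := sumL_nonneg_zero l (fun i => a i ^ 2) (fun j _ => pow2_ge_0 (a j))).
    rewrite (Rsqr_0_uniq (a i)); [lra|]. unfold Rsqr. specialize (H0 ltac:(fold X; lra) i Hi). simpl in H0. lra. }
  rewrite H0. nra.
Qed.

(** * Euclidean distance *)

Definition edist2 (n : nat) (v w : nat -> R) : R :=
  sumL (seq 0 n) (fun i => (v i - w i) ^ 2).

Definition edist (n : nat) (v w : nat -> R) : R := sqrt (edist2 n v w).

Lemma edist2_nonneg n v w : 0 <= edist2 n v w.
Proof. apply sumL_nonneg. intros. apply pow2_ge_0. Qed.

Lemma edist_nonneg n v w : 0 <= edist n v w.
Proof. apply sqrt_pos. Qed.

Lemma edist_sqr n v w : edist n v w ^ 2 = edist2 n v w.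
Proof. apply pow2_sqrt, edist2_nonneg. Qed.

Lemma edist_ext n v w v' w' : (forall i, (i < n)%nat -> v i = v' i) ->
  (forall i, (i < n)%nat -> w i = w' i) -> edist n v w = edist n v' w'.
Proof.
intros Hv Hw. unfold edist, edist2. f_equal. apply sumL_ext. intros i Hi. apply in_seq in Hi.
rewrite Hv, Hw by lia. reflexivity.
Qed.

Lemma edist_triangle n u v w : edist n u w <= edist n u v + edist n v w.
Proof.
assert (H0 := edist_nonneg n u v). assert (H1 := edist_nonneg n v w).
apply Rsqr_incr_0_var; [|lra]. rewrite !Rsqr_pow2.
assert (Hc := sumL_cauchy (seq 0 n) (fun i => u i - v i) (fun i => v i - w i)).
cbv beta in Hc. fold (edist2 n u v) (edist2 n v w) in Hc. rewrite <- !edist_sqr in Hc.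
assert (E : edist2 n u w = edist2 n u v + edist2 n v w
  + 2 * sumL (seq 0 n) (fun i => (u i - v i) * (v i - w i))).
{ unfold edist2. rewrite <- sumL_scal, <- !sumL_plus. apply sumL_ext. intros; ring. }
rewrite edist_sqr, E, <- !edist_sqr.
set (s := sumL _ _) in *.
assert (s <= edist n u v * edist n v w); [|nra].
apply Rsqr_incr_0_var; [|nra]. unfold Rsqr. nra.
Qed.

Lemma edist_path_le n (v : nat -> nat -> R) m :
  edist n (v 0%nat) (v m) <= sumL (seq 0 m) (fun i => edist n (v i) (v (S i))).
Proof.
assert (H : forall a, edist n (v a) (v (a + m)%nat) <= sumL (seq a m) (fun i => edist n (v i) (v (S i)))).
2: exact (H 0%nat).
induction m as [|m IH]; intros a; simpl.
- rewrite Nat.add_0_r. unfold edist, edist2. rewrite sumL_zero; [rewrite sqrt_0; lra|].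
  intros; ring.
- replace (a + S m)%nat with (S a + m)%nat by lia.
  eapply Rle_trans; [apply (edist_triangle n _ (v (S a)))|]. specialize (IH (S a)). lra.
Qed.

Definition lerp (t : R) (v w : nat -> R) : nat -> R := fun i => (1 - t) * v i + t * w i.

Lemma edist_lerp n v w s t : edist n (lerp s v w) (lerp t v w) = Rabs (s - t) * edist n v w.
Proof.
unfold edist. rewrite <- sqrt_Rsqr_abs, <- sqrt_mult_alt by apply Rle_0_sqr. f_equal.
unfold edist2, lerp, Rsqr. rewrite <- sumL_scal. apply sumL_ext. intros; ring.
Qed.

(* Euclidean space is uniquely geodesic: for [a = u - v], [b = w - u] one has
   [|(1-t)a - tb|^2 = (1-t)|a|^2 + t|b|^2 - t(1-t)|a+b|^2]. *)
Lemma edist_between n (v w u : nat -> R) t : 0 <= t <= 1 ->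
  edist n v u <= t * edist n v w -> edist n u w <= (1 - t) * edist n v w ->
  forall i, (i < n)%nat -> u i = lerp t v w i.
Proof.
intros Ht H1 H2 i Hi.
assert (H1' : edist2 n v u <= t ^ 2 * edist2 n v w).
{ rewrite <- !edist_sqr. assert (H := edist_nonneg n v u). nra. }
assert (H2' : edist2 n u w <= (1 - t) ^ 2 * edist2 n v w).
{ rewrite <- !edist_sqr. assert (H := edist_nonneg n u w). nra. }
assert (E : sumL (seq 0 n) (fun i => (u i - lerp t v w i) ^ 2)
   = (1 - t) * edist2 n v u + t * edist2 n u w - t * (1 - t) * edist2 n v w).
{ unfold edist2, lerp. rewrite <- !sumL_scal, <- sumL_plus, <- sumL_minus.
  apply sumL_ext. intros; ring. }
assert (Hz := sumL_nonneg_zero (seq 0 n) _ (fun j _ => pow2_ge_0 (u j - lerp t v w j))).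
assert (Hle : sumL (seq 0 n) (fun i => (u i - lerp t v w i) ^ 2) <= 0).
{ rewrite E. assert (0 <= (1 - t) * (t ^ 2 * edist2 n v w - edist2 n v u)) by (apply Rmult_le_pos; lra).
  assert (0 <= t * ((1 - t) ^ 2 * edist2 n v w - edist2 n u w)) by (apply Rmult_le_pos; lra). nra. }
specialize (Hz Hle i ltac:(apply in_seq; lia)). cbv beta in Hz.
assert (u i - lerp t v w i = 0); [|lra]. apply Rsqr_0_uniq. unfold Rsqr. simpl in Hz. lra.
Qed.

(** * The semilattice of sign vectors *)

Definition sv (a : S2) : R := match a with S2m => -1 | S2z => 0 | S2p => 1 end.

Definition nz (a : S2) : bool := match a with S2z => false | _ => true end.

Definition nnz (n : nat) (v : nat -> S2) : nat :=
  length (filter (fun i => nz (v i)) (seq 0 n)).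

(** As a sum of squares the count can be compared term by term, which turns identities between ranks
    into finite checks at one coordinate. *)
Lemma nnz_INR n v : INR (nnz n v) = sumL (seq 0 n) (fun i => sv (v i) ^ 2).
Proof.
unfold nnz. induction (seq 0 n) as [|i l IH]; [reflexivity|].
unfold sumL. cbn [fold_right filter]. fold (sumL l (fun i => sv (v i) ^ 2)). rewrite <- IH.
destruct (v i); cbn [nz length]; rewrite ?S_INR; simpl; lra.
Qed.

Lemma nnz_ext n v w : (forall i, (i < n)%nat -> v i = w i) -> nnz n v = nnz n w.
Proof.
intros H. unfold nnz. f_equal. apply filter_ext_in. intros i Hi. apply in_seq in Hi.
now rewrite H by lia.
Qed.

Lemma S2_dec (a b : S2) : {a = b} + {a <> b}.
Proof. decide equality. Defined.

Definition S2meet (a b : S2) : S2 := if S2_dec a b then a else S2z.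

Lemma sumL_pos {A} (l : list A) (f : A -> R) a :
  (forall a, In a l -> 0 <= f a) -> In a l -> 0 < f a -> 0 < sumL l f.
Proof.
intros H Ha Hf. destruct (Rlt_or_le 0 (sumL l f)) as [|Hle]; auto.
assert (Hz := sumL_nonneg_zero l f H Hle a Ha). lra.
Qed.

Lemma nnz_lt n v w i : s2nle n v w -> (i < n)%nat -> v i <> w i -> (nnz n v < nnz n w)%nat.
Proof.
intros H Hi Hd. apply INR_lt. rewrite !nnz_INR. apply Rlt_0_minus. rewrite <- sumL_minus.
apply (sumL_pos _ _ i).
- intros j Hj. apply in_seq in Hj. destruct (H j ltac:(lia)) as [->| ->]; [lra|].
  destruct (w j); simpl; lra.
- apply in_seq; lia.
- destruct (H i Hi) as [E| E]; [congruence|]. rewrite E in *. destruct (w i); simpl; lra || congruence.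
Qed.

Lemma s2le_refl a : s2le a a.
Proof. now left. Qed.

Lemma s2le_antisym a b : s2le a b -> s2le b a -> a = b.
Proof. unfold s2le. intuition congruence. Qed.

(** Vectors are functions on all of [nat], so they are listed up to pointwise equality. This makes
    frames finite. *)
Lemma allvecs_ex n : exists l : list (nat -> S2), forall v, s2vec n v ->
  exists w, In w l /\ s2vec n w /\ forall i, w i = v i.
Proof.
induction n as [|n (l & Hl)].
- exists [fun _ => S2z]. intros v Hv. exists (fun _ => S2z). repeat split.
  + simpl; auto.
  + intros i. symmetry. apply Hv. lia.
- exists (flat_map (fun a => map (fun w i => if Nat.eqb i n then a else w i) l) [S2m; S2z; S2p]).
  intros v Hv. destruct (Hl (fun i => if Nat.eqb i n then S2z else v i)) as (w & Hw & Hwv & Hwe).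
  { intros i Hi. destruct (Nat.eqb_spec i n); auto. apply Hv. lia. }
  exists (fun i => if Nat.eqb i n then v n else w i). repeat split.
  + apply in_flat_map. exists (v n). split; [destruct (v n); simpl; auto|].
    apply in_map_iff. now exists w.
  + intros i Hi. destruct (Nat.eqb_spec i n); [lia|]. apply Hwv. lia.
  + intros i. destruct (Nat.eqb_spec i n) as [->|Hin]; auto. rewrite Hwe.
    destruct (Nat.eqb_spec i n); congruence.
Qed.

(** * Frames and rank *)

Section PolarSpace.
Context {L : Type} {le : L -> L -> Prop} {meet : L -> L -> L} {n : nat}
  {Frames : (L -> Prop) -> Prop} (HL : is_polar_space le meet n Frames).

Lemma le_refl x : le x x.
Proof. apply HL. Qed.

Lemma le_antisym x y : le x y -> le y x -> x = y.
Proof. apply HL. Qed.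

Lemma le_trans x y z : le x y -> le y z -> le x z.
Proof. apply HL. Qed.

Lemma meet_glb x y : le (meet x y) x /\ le (meet x y) y /\
  (forall z, le z x -> le z y -> le z (meet x y)).
Proof. destruct HL as (_ & H & _). apply H. Qed.

Lemma lt_trans x y z : lt le x y -> lt le y z -> lt le x z.
Proof.
intros [Hxy Nxy] [Hyz Nyz]. split; [eapply le_trans; eauto|].
intros ->. apply Nxy. now apply le_antisym.
Qed.

Lemma frames_meet F x y : Frames F -> F x -> F y -> F (meet x y).
Proof. intros HF. now apply HL. Qed.

Lemma frames_chains C D : is_chain le C -> is_chain le D ->
  exists F, Frames F /\ subset C F /\ subset D F.
Proof. apply HL. Qed.

Lemma frames_iso C D F F' : is_chain le C -> is_chain le D -> Frames F -> Frames F' ->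
  subset C F -> subset D F -> subset C F' -> subset D F' ->
  exists psi, iso_between le F F' psi /\
    (forall x, C x -> psi x = x) /\ (forall x, D x -> psi x = x).
Proof. apply HL. Qed.

Definition coord (F : L -> Prop) (phi : L -> nat -> S2) : Prop :=
  (forall x, F x -> s2vec n (phi x)) /\
  (forall v, s2vec n v -> exists x, F x /\ forall i, phi x i = v i) /\
  (forall x y, F x -> F y -> (le x y <-> s2nle n (phi x) (phi y))).

Lemma frames_coord F : Frames F -> exists phi, coord F phi.
Proof. intros HF. now apply HL. Qed.

Lemma chain_singleton p : is_chain le (fun x => x = p).
Proof. intros a b -> ->. left. apply le_refl. Qed.

Lemma chain_pair p q : le p q -> is_chain le (fun x => x = p \/ x = q).
Proof. intros H a b [->| ->] [->| ->]; auto using le_refl. Qed.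

Lemma frames_pair p q : exists F, Frames F /\ F p /\ F q.
Proof.
destruct (frames_chains _ _ (chain_singleton p) (chain_singleton q)) as (F & HF & H1 & H2).
exists F. auto.
Qed.

Section Frame.
Context {F : L -> Prop} {phi : L -> nat -> S2} (Hphi : coord F phi).

Lemma coord_le x y : F x -> F y -> (le x y <-> s2nle n (phi x) (phi y)).
Proof. apply Hphi. Qed.

Lemma coord_inj x y : F x -> F y -> (forall i, (i < n)%nat -> phi x i = phi y i) -> x = y.
Proof.
intros Hx Hy H. apply le_antisym; apply coord_le; auto; intros i Hi; left; [|symmetry]; auto.
Qed.

Lemma coord_out x i : F x -> (n <= i)%nat -> phi x i = S2z.
Proof. intros Hx. now apply Hphi. Qed.

Lemma coord_ex v : s2vec n v -> exists x, F x /\ forall i, phi x i = v i.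
Proof. apply Hphi. Qed.

Lemma coord_diff x y : F x -> F y -> x <> y -> exists i, (i < n)%nat /\ phi x i <> phi y i.
Proof.
intros Hx Hy Hd. apply NNPP. intros H. apply Hd, coord_inj; auto.
intros i Hi. apply NNPP. eauto.
Qed.

Lemma coord_lt_nnz x y : F x -> F y -> lt le x y -> (nnz n (phi x) < nnz n (phi y))%nat.
Proof.
intros Hx Hy [Hle Hd]. destruct (coord_diff x y Hx Hy Hd) as (i & Hi & Hxy).
apply (nnz_lt _ _ _ i); auto. now apply coord_le.
Qed.

Lemma coord_update x i a : F x -> (i < n)%nat ->
  exists y, F y /\ forall j, phi y j = if Nat.eqb j i then a else phi x j.
Proof.
intros Hx Hi. apply coord_ex. intros j Hj. destruct (Nat.eqb_spec j i); [lia|].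
now apply coord_out.
Qed.

Lemma nnz_drop x i y : (i < n)%nat -> phi x i <> S2z ->
  (forall j, phi y j = if Nat.eqb j i then S2z else phi x j) -> nnz n (phi x) = S (nnz n (phi y)).
Proof.
intros Hi Hx Hy. apply INR_eq. rewrite S_INR, !nnz_INR.
rewrite <- (sumL_indic (seq 0 n) i (fun _ => 1)) by (apply seq_NoDup || apply in_seq; lia).
rewrite <- sumL_plus. apply sumL_ext. intros j _. rewrite Hy. unfold indic.
destruct (eqdec i j) as [<-|Hij].
- rewrite Nat.eqb_refl. destruct (phi x i); simpl; try lra. now destruct Hx.
- destruct (Nat.eqb_spec j i); [congruence|]. simpl. lra.
Qed.

Lemma nnz_S_ex x k : nnz n (phi x) = S k -> exists i, (i < n)%nat /\ phi x i <> S2z.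
Proof.
intros H. apply NNPP. intros H0. assert (E : nnz n (phi x) = nnz n (fun _ => S2z)).
{ apply nnz_ext. intros i Hi. apply NNPP. eauto. }
assert (INR (nnz n (fun _ => S2z)) = 0).
{ rewrite nnz_INR. apply sumL_zero. intros; simpl; lra. }
rewrite <- E, H, S_INR in *. assert (Hk := pos_INR k). lra.
Qed.

Lemma frame_chain_to k : forall x, F x -> nnz n (phi x) = k ->
  exists s : nat -> L, (forall i, (i < k)%nat -> lt le (s i) (s (S i))) /\ s k = x /\
    forall i, (i <= k)%nat -> F (s i).
Proof.
induction k as [|k IH]; intros x Hx Hk.
- exists (fun _ => x). repeat split; auto; lia.
- destruct (nnz_S_ex x k Hk) as (i & Hi & Hxi).
  destruct (coord_update x i S2z Hx Hi) as (y & HFy & Hy).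
  assert (Hn := nnz_drop x i y Hi Hxi Hy).
  destruct (IH y HFy ltac:(lia)) as (s & Hs & Hsk & HF).
  exists (fun j => if Nat.leb j k then s j else x). repeat split.
  + destruct (Nat.leb_spec i0 k); [|lia]. destruct (Nat.leb_spec (S i0) k).
    * apply Hs; lia.
    * replace i0 with k by lia. rewrite Hsk. apply coord_le; auto. intros j Hj. rewrite Hy.
      destruct (Nat.eqb j i); [now right|now left].
  + destruct (Nat.leb_spec i0 k); [|lia]. destruct (Nat.leb_spec (S i0) k).
    * apply Hs; lia.
    * replace i0 with k by lia. rewrite Hsk. intros ->. lia.
  + destruct (Nat.leb_spec (S k) k); [lia|auto].
  + intros j Hj. destruct (Nat.leb_spec j k); auto.
Qed.

Lemma frame_chain_le k (s : nat -> L) : (forall i, (i < k)%nat -> lt le (s i) (s (S i))) ->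
  (forall i, (i <= k)%nat -> F (s i)) -> (k <= nnz n (phi (s k)))%nat.
Proof.
induction k as [|k IH]; intros Hs HF; [lia|].
assert (k <= nnz n (phi (s k)))%nat by (apply IH; auto).
assert (nnz n (phi (s k)) < nnz n (phi (s (S k))))%nat by (apply coord_lt_nnz; auto). lia.
Qed.

End Frame.

Lemma chain_to_le k (s : nat -> L) : (forall i, (i < k)%nat -> lt le (s i) (s (S i))) ->
  forall i j, (i <= j <= k)%nat -> le (s i) (s j).
Proof.
intros Hs i j Hij. replace j with (i + (j - i))%nat by lia.
assert (Hk : (i + (j - i) <= k)%nat) by lia. revert Hk. generalize (j - i)%nat as m.
induction m as [|m IH]; intros Hm.
- rewrite Nat.add_0_r. apply le_refl.
- eapply le_trans; [apply IH; lia|]. rewrite Nat.add_succ_r. apply Hs. lia.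
Qed.

(** A chain ending at [p] need not lie in [F]. (P1) puts it into a frame [G] through [p], and (P2)
    for [p] alone carries it into [F], where every step adds a nonzero coordinate. *)
Lemma rank_coord F phi p : Frames F -> coord F phi -> F p -> rank le p = nnz n (phi p).
Proof.
intros HF Hphi Hp.
assert (Hmax : forall m, chain_to le p m -> (m <= nnz n (phi p))%nat).
{ intros m (s & Hs & Hsm).
  assert (HC : is_chain le (fun x => exists i, (i <= m)%nat /\ x = s i)).
  { intros a b (i & Hi & ->) (j & Hj & ->).
    destruct (Nat.le_ge_cases i j); [left|right]; apply (chain_to_le m); auto. }
  destruct (frames_chains _ _ HC (chain_singleton p)) as (G & HG & HGs & HGp).
  destruct (frames_iso _ _ G F (chain_singleton p) (chain_singleton p) HG HF)
    as (psi & (HGF & Hsur & Hle) & Hfix & _); try (intros x ->; auto).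
  assert (HGi : forall i, (i <= m)%nat -> G (s i)) by (intros i Hi; apply HGs; eauto).
  replace p with (psi (s m)) by (rewrite Hsm; now apply Hfix).
  apply (frame_chain_le Hphi m (fun i => psi (s i))).
  - intros i Hi. destruct (Hs i Hi) as [H1 H2]. split.
    + rewrite <- Hle; auto; apply HGi; lia.
    + intros E. apply H2. apply le_antisym; auto. rewrite Hle by (apply HGi; lia).
      rewrite E. apply le_refl.
  - auto. }
unfold rank.
match goal with |- epsilon ?i ?P = _ => destruct (epsilon_spec i P) as [H1 H2] end.
- exists (nnz n (phi p)). split; auto.
  destruct (frame_chain_to Hphi _ p Hp eq_refl) as (s & Hs & Hsk & _). now exists s.
- apply Nat.le_antisymm; [now apply Hmax|]. apply H2.
  destruct (frame_chain_to Hphi _ p Hp eq_refl) as (s & Hs & Hsk & _). now exists s.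
Qed.

(** The meet is taken in all of [L], but frames are subsemilattices, so it lies in [F] and can be
    compared there with the element [z] whose coordinates are the meets. *)
Lemma meet_coord F phi x y : Frames F -> coord F phi -> F x -> F y ->
  forall i, (i < n)%nat -> phi (meet x y) i = S2meet (phi x i) (phi y i).
Proof.
intros HF Hphi Hx Hy. assert (Hm := frames_meet F x y HF Hx Hy).
destruct (meet_glb x y) as (Hmx & Hmy & Hglb).
destruct (coord_ex Hphi (fun i => S2meet (phi x i) (phi y i))) as (z & Hz & Hzi).
{ intros i Hi. rewrite (coord_out Hphi x), (coord_out Hphi y); auto. }
assert (Hzm : le z (meet x y)).
{ apply Hglb; apply (coord_le Hphi); auto; intros i Hi; rewrite Hzi; unfold S2meet, s2le;
    destruct (S2_dec (phi x i) (phi y i)); auto. }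
intros i Hi. apply s2le_antisym.
- apply (coord_le Hphi) in Hmx; auto. apply (coord_le Hphi) in Hmy; auto.
  destruct (Hmx i Hi) as [E|E]; [|rewrite E; now right].
  destruct (Hmy i Hi) as [E'|E']; [|rewrite E'; now right].
  unfold S2meet. rewrite <- E, <- E'.
  destruct (S2_dec _ _); [now left|congruence].
- rewrite <- Hzi. now apply (coord_le Hphi).
Qed.

Lemma rank_mono x y : le x y -> (rank le x <= rank le y)%nat.
Proof.
intros H. destruct (frames_pair x y) as (F & HF & Hx & Hy).
destruct (frames_coord F HF) as (phi & Hphi).
rewrite (rank_coord F phi x), (rank_coord F phi y) by auto.
destruct (classic (x = y)) as [->|Hd]; [lia|]. apply Nat.lt_le_incl, (coord_lt_nnz Hphi); auto.
now split.
Qed.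

Lemma rank_lt x y : lt le x y -> (rank le x < rank le y)%nat.
Proof.
intros H. destruct (frames_pair x y) as (F & HF & Hx & Hy).
destruct (frames_coord F HF) as (phi & Hphi).
rewrite (rank_coord F phi x), (rank_coord F phi y) by auto. now apply (coord_lt_nnz Hphi).
Qed.

(** * Flags and retractions *)

(** A maximal chain of the frame, given by an ordering [l] of the coordinates and a sign for each: a
    chamber of the hyperoctahedral arrangement. From [n] on [c] is constant, which lets the index
    range over all of [nat]. *)
Record flag (F : L -> Prop) (phi : L -> nat -> S2) (l : list nat) (eps : nat -> S2)
    (c : nat -> L) : Prop := {
  flag_nodup : NoDup l;
  flag_in : forall i, In i l <-> (i < n)%nat;
  flag_eps : forall i, eps i <> S2z;
  flag_mem : forall k, F (c k);
  flag_coord : forall k i, phi (c k) i = if in_dec Nat.eq_dec i (firstn k l) then eps i else S2z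
}.

Lemma flag_length F phi l eps c : flag F phi l eps c -> length l = n.
Proof.
intros H. transitivity (length (seq 0 n)); [|apply length_seq].
apply Permutation_length, NoDup_Permutation.
- apply H.
- apply seq_NoDup.
- intros i. rewrite in_seq, (flag_in _ _ _ _ _ H). lia.
Qed.

Lemma firstn_S_nth (l : list nat) k d : (k < length l)%nat ->
  firstn (S k) l = firstn k l ++ [nth k l d].
Proof.
revert k. induction l as [|a l IH]; simpl; intros k Hk; [lia|].
destruct k as [|k]; [reflexivity|].
change (a :: firstn (S k) l = a :: firstn k l ++ [nth k l d]). rewrite <- IH by lia. reflexivity.
Qed.

Lemma In_firstn_S (l : list nat) k d i : (k < length l)%nat ->
  (In i (firstn (S k) l) <-> In i (firstn k l) \/ i = nth k l d).
Proof. intros Hk. rewrite (firstn_S_nth l k d) by auto. rewrite in_app_iff. simpl. intuition. Qed.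

Lemma nth_notin_firstn (l : list nat) k d : NoDup l -> (k < length l)%nat ->
  ~ In (nth k l d) (firstn k l).
Proof.
intros Hl Hk Hin. rewrite <- (firstn_skipn (S k) l), (firstn_S_nth l k d), <- app_assoc in Hl by auto.
apply NoDup_remove_2 in Hl. apply Hl. apply in_or_app. now left.
Qed.

(** The coordinate that enters between [c k] and [c (S k)] has in [w] the sign of the flag. Only the
    order of [G] is mentioned, so isomorphisms that fix the flag preserve this. *)
Definition pos_at (c : nat -> L) (G : L -> Prop) (w : L) (k : nat) : Prop :=
  exists x, G x /\ le x w /\ le x (c (S k)) /\ ~ le x (c k).

(** The opposite sign, again through the order alone: opposite signs are exactly what prevents a
    common upper bound in a frame. *)
Definition neg_at (c : nat -> L) (G : L -> Prop) (w : L) (k : nat) : Prop :=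
  forall x, G x -> le x (c (S k)) -> ~ le x (c k) -> ~ exists z, G z /\ le w z /\ le x z.

Lemma iso_pos_neg c G G' psi w k : iso_between le G G' psi ->
  (forall k, G (c k)) -> (forall k, psi (c k) = c k) -> G w ->
  (pos_at c G w k <-> pos_at c G' (psi w) k) /\ (neg_at c G w k <-> neg_at c G' (psi w) k).
Proof.
intros (HG & Hsur & Hle) Hc Hfix Hw.
assert (Hlec : forall x j, G x -> (le x (c j) <-> le (psi x) (c j))).
{ intros x j Hx. rewrite <- (Hfix j) at 2. now apply Hle. }
split; split.
- intros (x & Hx & H1 & H2 & H3). exists (psi x).
  rewrite <- (Hlec x (S k)), <- (Hlec x k), <- Hle by auto. auto.
- intros (x' & Hx' & H1 & H2 & H3). destruct (Hsur x' Hx') as (x & Hx & <-).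
  exists x. rewrite (Hlec x (S k)), (Hlec x k), Hle by auto. auto.
- intros H y Hy. destruct (Hsur y Hy) as (x & Hx & <-). rewrite <- (Hlec x (S k)), <- (Hlec x k) by auto.
  intros H1 H2 (z' & Hz' & H3 & H4). destruct (Hsur z' Hz') as (z & Hz & <-).
  apply (H x Hx H1 H2). exists z. rewrite (Hle w z), (Hle x z) by auto. auto.
- intros H x Hx. rewrite (Hlec x (S k)), (Hlec x k) by auto.
  intros H1 H2 (z & Hz & H3 & H4).
  apply (H (psi x)); auto. exists (psi z). rewrite <- (Hle w z), <- (Hle x z) by auto. auto.
Qed.

(** * Existence of retractions centred at a flag *)

Section Retraction.
Context {F : L -> Prop} {phi : L -> nat -> S2} {l : list nat} {eps : nat -> S2} {c : nat -> L}
  (HF : Frames F) (Hphi : coord F phi) (Hc : flag F phi l eps c).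

Lemma flag_le i j : (i <= j)%nat -> le (c i) (c j).
Proof.
intros Hij. apply (coord_le Hphi); [apply Hc..|]. intros m Hm. rewrite !(flag_coord _ _ _ _ _ Hc).
destruct (in_dec _ _ (firstn i l)) as [Hin|]; [|now right].
destruct (in_dec _ _ (firstn j l)) as [|Hn]; [now left|]. exfalso. apply Hn.
replace (firstn i l) with (firstn i (firstn j l)) in Hin
  by (rewrite firstn_firstn; f_equal; lia).
rewrite <- (firstn_skipn i (firstn j l)). apply in_or_app. now left.
Qed.

Lemma flag_chain : is_chain le (fun x => exists k, x = c k).
Proof.
intros a b (i & ->) (j & ->). destruct (Nat.le_ge_cases i j); auto using flag_le.
Qed.

Lemma below_flag_coord x k : F x -> (k < n)%nat -> le x (c (S k)) -> ~ le x (c k) ->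
  phi x (nth k l 0%nat) = eps (nth k l 0%nat).
Proof.
intros Hx Hk H1 H2. assert (Hlen := flag_length _ _ _ _ _ Hc).
apply (coord_le Hphi) in H1; auto; [|apply Hc]. apply NNPP. intros H3. apply H2.
apply (coord_le Hphi); auto; [apply Hc|]. intros i Hi. specialize (H1 i Hi).
rewrite (flag_coord _ _ _ _ _ Hc) in H1 |- *.
destruct (in_dec Nat.eq_dec i (firstn k l)) as [Hin|Hin];
  destruct (in_dec Nat.eq_dec i (firstn (S k) l)) as [Hin'|Hin']; auto;
  rewrite (In_firstn_S l k 0%nat) in Hin' by lia; [tauto|].
destruct Hin' as [| ->]; [tauto|]. destruct H1 as [H1|H1]; [congruence|now right].
Qed.

Lemma flag_atom k : (k < n)%nat -> exists x, F x /\ le x (c (S k)) /\ ~ le x (c k) /\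
  forall j, j <> nth k l 0%nat -> phi x j = S2z.
Proof.
intros Hk. assert (Hlen := flag_length _ _ _ _ _ Hc). set (i := nth k l 0%nat).
assert (Hi : (i < n)%nat) by (apply (flag_in _ _ _ _ _ Hc), nth_In; lia).
destruct (coord_ex Hphi (fun j => if Nat.eqb j i then eps i else S2z)) as (x & Hx & Hxi).
{ intros j Hj. destruct (Nat.eqb_spec j i); [lia|auto]. }
exists x. split; [auto|]. repeat split.
- apply (coord_le Hphi); auto; [apply Hc|]. intros j Hj. rewrite Hxi, (flag_coord _ _ _ _ _ Hc).
  destruct (Nat.eqb_spec j i) as [->|]; [|now right].
  destruct (in_dec _ _ _) as [|Hn]; [now left|]. exfalso. apply Hn.
  apply (In_firstn_S l k 0%nat); [lia|]. now right.
- intros H. apply (coord_le Hphi) in H; auto; [|apply Hc]. specialize (H i Hi).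
  rewrite Hxi, (flag_coord _ _ _ _ _ Hc), Nat.eqb_refl in H.
  assert (He := flag_eps _ _ _ _ _ Hc i).
  destruct (in_dec _ _ _) as [Hin|].
  + revert Hin. apply nth_notin_firstn; [apply Hc|lia].
  + destruct H; auto.
- intros j Hj. rewrite Hxi. destruct (Nat.eqb_spec j i); [contradiction|auto].
Qed.

Lemma pos_at_coord w k : F w -> (k < n)%nat ->
  (pos_at c F w k <-> phi w (nth k l 0%nat) = eps (nth k l 0%nat)).
Proof.
intros Hw Hk. assert (Hlen := flag_length _ _ _ _ _ Hc). set (i := nth k l 0%nat).
assert (Hi : (i < n)%nat) by (apply (flag_in _ _ _ _ _ Hc), nth_In; lia).
assert (He := flag_eps _ _ _ _ _ Hc i). split.
- intros (x & Hx & H0 & H1 & H2). assert (E := below_flag_coord x k Hx Hk H1 H2). fold i in E.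
  apply (coord_le Hphi) in H0; auto. destruct (H0 i Hi); congruence.
- intros E. destruct (flag_atom k Hk) as (x & Hx & H1 & H2 & H3). exists x. repeat split; auto.
  apply (coord_le Hphi); auto. intros j Hj. destruct (Nat.eq_dec j i) as [->|Hji].
  + left. rewrite E. now apply below_flag_coord.
  + right. now apply H3.
Qed.

Lemma neg_at_coord w k : F w -> (k < n)%nat ->
  (neg_at c F w k <->
   phi w (nth k l 0%nat) <> S2z /\ phi w (nth k l 0%nat) <> eps (nth k l 0%nat)).
Proof.
intros Hw Hk. assert (Hlen := flag_length _ _ _ _ _ Hc). set (i := nth k l 0%nat).
assert (Hi : (i < n)%nat) by (apply (flag_in _ _ _ _ _ Hc), nth_In; lia).
assert (He := flag_eps _ _ _ _ _ Hc i). split.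
- intros H. destruct (flag_atom k Hk) as (x & Hx & H1 & H2 & H3).
  assert (E := below_flag_coord x k Hx Hk H1 H2). fold i in E.
  apply NNPP. intros Hn. apply (H x Hx H1 H2).
  destruct (coord_update Hphi w i (eps i) Hw Hi) as (z & Hz & Hzi).
  exists z. repeat split; auto; apply (coord_le Hphi); auto; intros j Hj; rewrite Hzi;
    destruct (Nat.eqb_spec j i) as [->|Hji].
  + destruct (S2_dec (phi w i) S2z) as [|Hz']; [now right|left].
    apply NNPP. tauto.
  + now left.
  + now left.
  + right. now apply H3.
- intros [H1 H2] x Hx H3 H4 (z & Hz & Hwz & Hxz).
  assert (E := below_flag_coord x k Hx Hk H3 H4). fold i in E.
  apply (coord_le Hphi) in Hwz; auto. apply (coord_le Hphi) in Hxz; auto.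
  destruct (Hwz i Hi); destruct (Hxz i Hi); congruence.
Qed.

(** (P2) for the flag and the chain consisting of [w] gives an isomorphism from [G] to [G'] fixing
    both. Hence the sign of [w] at each step of the flag is the same in [G] and [G'], and [psi],
    [psi'] transport it to [F], where these signs are the coordinates. *)
Lemma iso_coord_unique G G' psi psi' w : Frames G -> Frames G' ->
  iso_between le G F psi -> iso_between le G' F psi' ->
  (forall k, G (c k)) -> (forall k, G' (c k)) ->
  (forall k, psi (c k) = c k) -> (forall k, psi' (c k) = c k) -> G w -> G' w ->
  psi w = psi' w.
Proof.
intros HG HG' Hiso Hiso' Hcg Hcg' Hfix Hfix' Hw Hw'.
assert (Hlen := flag_length _ _ _ _ _ Hc).
assert (HC := flag_chain).
destruct (frames_iso _ _ G G' HC (chain_singleton w) HG HG') as (th & Hth & Hthc & Hthw).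
{ now intros x (k & ->). } { now intros x ->. } { now intros x (k & ->). } { now intros x ->. }
apply (coord_inj Hphi); [now apply Hiso|now apply Hiso'|]. intros i Hi.
apply (flag_in _ _ _ _ _ Hc) in Hi. destruct (In_nth l i 0%nat Hi) as (k & Hk & <-).
rewrite Hlen in Hk.
destruct (iso_pos_neg c G F psi w k) as [P1 N1]; auto.
destruct (iso_pos_neg c G' F psi' w k) as [P2 N2]; auto.
destruct (iso_pos_neg c G G' th w k) as [P3 N3]; auto.
{ intros j. apply Hthc. eauto. }
rewrite (Hthw w eq_refl) in P3, N3.
rewrite pos_at_coord in P1, P2 by (auto; apply Hiso || apply Hiso'; auto).
rewrite neg_at_coord in N1, N2 by (auto; apply Hiso || apply Hiso'; auto).
assert (P : phi (psi w) (nth k l 0%nat) = eps (nth k l 0%nat) <->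
  phi (psi' w) (nth k l 0%nat) = eps (nth k l 0%nat)) by tauto.
assert (N : (phi (psi w) (nth k l 0%nat) <> S2z /\ phi (psi w) (nth k l 0%nat) <> eps (nth k l 0%nat)) <->
  (phi (psi' w) (nth k l 0%nat) <> S2z /\ phi (psi' w) (nth k l 0%nat) <> eps (nth k l 0%nat))) by tauto.
assert (He := flag_eps _ _ _ _ _ Hc (nth k l 0%nat)). revert P N He. clear.
destruct (phi (psi w) _), (phi (psi' w) _), (eps _); intuition congruence.
Qed.

(* The map [h] is the retraction onto [F] centred at the flag [c], written in the
   coordinates of [F]: on each frame containing the flag it is an isomorphism fixing the flag. *)
Lemma retraction_ex : exists h : L -> nat -> S2,
  (forall x, F x -> h x = phi x) /\
  forall D, is_chain le D ->
    exists G, Frames G /\ (forall k, G (c k)) /\ subset D G /\ coord G h.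
Proof.
assert (HC := flag_chain).
assert (Hex : forall G, Frames G -> (forall k, G (c k)) ->
  exists psi, iso_between le G F psi /\ forall k, psi (c k) = c k).
{ intros G HG Hcg. destruct (frames_iso _ _ G F HC HC HG HF) as (psi & Hpsi & Hfix & _);
    try (intros x (k & ->); auto; apply Hc).
  exists psi. split; auto. intros k. apply Hfix. eauto. }
(* The value at [w] is computed in any frame through the flag and [w]. It depends neither on the
   frame nor on the isomorphism, so the pieces glue. *)
assert (Hw : forall w, exists v, forall G psi, Frames G -> iso_between le G F psi ->
  (forall k, G (c k)) -> (forall k, psi (c k) = c k) -> G w -> phi (psi w) = v).
{ intros w. destruct (frames_chains _ _ HC (chain_singleton w)) as (G & HG & Hcg & Hwg).
  destruct (Hex G HG) as (psi & Hpsi & Hfix); [intros k; apply Hcg; eauto|].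
  exists (phi (psi w)). intros G' psi' HG' Hpsi' Hcg' Hfix' Hw'. f_equal.
  apply (iso_coord_unique G' G); auto. intros k; apply Hcg; eauto. }
exists (fun w => proj1_sig (constructive_indefinite_description _ (Hw w))). split.
- intros x Hx. destruct (constructive_indefinite_description _ _) as (v & Hv). simpl.
  symmetry. apply (Hv F (fun x => x)); auto; [|apply Hc].
  repeat split; auto. intros y Hy. now exists y.
- intros D HD. destruct (frames_chains _ _ HC HD) as (G & HG & Hcg & HDG).
  assert (Hcg' : forall k, G (c k)) by (intros k; apply Hcg; eauto).
  destruct (Hex G HG Hcg') as (psi & Hpsi & Hfix).
  exists G. split; [auto|]. split; [auto|]. split; [auto|].
  assert (E : forall x, G x -> proj1_sig (constructive_indefinite_description _ (Hw x)) = phi (psi x)).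
  { intros x Hx. destruct (constructive_indefinite_description _ _) as (v & Hv). simpl.
    symmetry. now apply (Hv G psi). }
  destruct Hpsi as (HGF & Hsur & Hle). split; [|split].
  + intros x Hx. rewrite E by auto. apply Hphi. auto.
  + intros v Hv. destruct (coord_ex Hphi v Hv) as (y & Hy & Hyi).
    destruct (Hsur y Hy) as (x & Hx & <-). exists x. split; auto. now rewrite E.
  + intros x y Hx Hy. rewrite !E by auto. rewrite Hle by auto. apply (coord_le Hphi); auto.
Qed.

End Retraction.

(** The centre is forgotten. What remains is enough for [h] to preserve order and rank, although it
    need not be injective. *)
Definition retraction (h : L -> nat -> S2) : Prop :=
  forall D, is_chain le D -> exists G, Frames G /\ subset D G /\ coord G h.

Lemma retraction_le h x y : retraction h -> le x y -> s2nle n (h x) (h y).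
Proof.
intros Hh Hxy. destruct (Hh _ (chain_pair x y Hxy)) as (G & HG & Hs & Hco).
apply (coord_le Hco); auto.
Qed.

Lemma retraction_rank h x : retraction h -> rank le x = nnz n (h x).
Proof.
intros Hh. destruct (Hh _ (chain_singleton x)) as (G & HG & Hs & Hco).
apply (rank_coord G); auto.
Qed.

End PolarSpace.

(** * Formal combinations and barycentres *)

Section Means.
Context {L : Type}.
Implicit Types (x y : L -> R).

Definition finsupp x : Prop := exists s : list L, forall p, x p <> 0 -> In p s.

Definition mean x (g : L -> R) : R := sumL (supp x) (fun p => x p * g p).

Lemma supp_spec x : finsupp x -> NoDup (supp x) /\ forall p, x p <> 0 <-> In p (supp x).
Proof.
intros (s & Hs). unfold supp. apply epsilon_spec.
destruct (classical_filter (fun p => x p <> 0) s) as (s' & Hn & Hs').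
exists s'. split; auto. intros p. rewrite Hs'. split; [auto|tauto].
Qed.

Lemma mean_list x g (s : list L) : NoDup s -> (forall p, x p <> 0 -> In p s) ->
  mean x g = sumL s (fun p => x p * g p).
Proof.
intros Hn Hs. destruct (supp_spec x) as [H1 H2]; [now exists s|].
apply sumL_support; auto. intros p Hp.
assert (x p <> 0) by (intros E; rewrite E in Hp; lra).
rewrite <- H2. split; auto.
Qed.

Lemma finsupp_list2 x y : finsupp x -> finsupp y ->
  exists s, NoDup s /\ (forall p, x p <> 0 -> In p s) /\ (forall p, y p <> 0 -> In p s).
Proof.
intros (s & Hs) (t & Ht). exists (nodup eqdec (s ++ t)). split; [apply NoDup_nodup|].
split; intros p Hp; apply nodup_In, in_or_app; auto.
Qed.

Lemma mean_le x g g' : finsupp x -> (forall p, 0 <= x p) ->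
  (forall p, x p <> 0 -> g p <= g' p) -> mean x g <= mean x g'.
Proof.
intros Hf Hx H. apply sumL_le. intros p Hp. apply (supp_spec x Hf) in Hp.
apply Rmult_le_compat_l; auto.
Qed.

Lemma mean_ext x g g' : finsupp x -> (forall p, x p <> 0 -> g p = g' p) -> mean x g = mean x g'.
Proof.
intros Hf H. apply sumL_ext. intros p Hp. apply (supp_spec x Hf) in Hp. now rewrite H.
Qed.

Lemma mean_plus x g g' : mean x (fun p => g p + g' p) = mean x g + mean x g'.
Proof. unfold mean. rewrite <- sumL_plus. apply sumL_ext. intros; ring. Qed.

Lemma mean_scal x c g : mean x (fun p => c * g p) = c * mean x g.
Proof. unfold mean. rewrite <- sumL_scal. apply sumL_ext. intros; ring. Qed.

Lemma mean_indic x p : finsupp x -> mean x (indic p) = x p.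
Proof.
intros Hf. destruct (Req_EM_T (x p) 0) as [E|E].
- rewrite E. apply sumL_zero. intros q _. destruct (eqdec p q) as [<-|Hd].
  + rewrite E. ring.
  + rewrite indic_diff; auto. ring.
- destruct (supp_spec x Hf) as [H1 H2]. unfold mean.
  rewrite (sumL_ext _ _ (fun q => indic p q * x q)) by (intros; ring).
  apply sumL_indic; auto. now apply H2.
Qed.

Lemma indic_finsupp p : finsupp (indic p).
Proof. exists [p]. intros q Hq. apply indic_neq0 in Hq. simpl; auto. Qed.

Lemma mean_of_indic p g : mean (indic p) g = g p.
Proof.
rewrite (mean_list _ _ [p]).
- simpl. rewrite indic_same. lra.
- repeat constructor. simpl; auto.
- intros q Hq. apply indic_neq0 in Hq. simpl; auto.
Qed.

Lemma comb_finsupp a b x y : finsupp x -> finsupp y -> finsupp (fun p => a * x p + b * y p).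
Proof.
intros Hx Hy. destruct (finsupp_list2 x y Hx Hy) as (s & _ & H1 & H2). exists s.
intros p Hp. destruct (Req_EM_T (x p) 0) as [E|]; auto.
destruct (Req_EM_T (y p) 0) as [E'|]; auto. exfalso. apply Hp. rewrite E, E'. ring.
Qed.

Lemma mean_comb a b x y g : finsupp x -> finsupp y ->
  mean (fun p => a * x p + b * y p) g = a * mean x g + b * mean y g.
Proof.
intros Hx Hy. destruct (finsupp_list2 x y Hx Hy) as (s & Hn & H1 & H2).
rewrite (mean_list x g s), (mean_list y g s) by auto. rewrite (mean_list _ g s); auto.
- rewrite <- !sumL_scal, <- sumL_plus. apply sumL_ext. intros; ring.
- intros p Hp. destruct (Req_EM_T (x p) 0) as [E|]; auto.
  destruct (Req_EM_T (y p) 0) as [E'|]; auto. exfalso. apply Hp. rewrite E, E'. ring.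
Qed.

(** The affine extension of [h] to formal combinations. For the coordinates of a frame it identifies
    the part of the complex over that frame with the cube. *)
Definition bary (h : L -> nat -> S2) x : nat -> R := fun i => mean x (fun p => sv (h p i)).

End Means.

Section Points.
Context {L : Type} {le : L -> L -> Prop}.
Implicit Types (x y : L -> R).

Lemma point_finsupp x : is_point le x -> finsupp x.
Proof. intros (_ & s & _ & Hs & _). exists s. apply Hs. Qed.

Lemma point_nonneg x : is_point le x -> forall p, 0 <= x p.
Proof. now intros (H & _). Qed.

Lemma point_total x : is_point le x -> mean x (fun _ => 1) = 1.
Proof.
intros (_ & s & Hn & Hs & _ & Ht). rewrite (mean_list _ _ s); auto.
- rewrite (sumL_ext _ _ x); auto. intros; ring.
- apply Hs.
Qed.

Lemma point_chain x : is_point le x -> is_chain le (fun p => x p <> 0).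
Proof. intros (_ & s & _ & Hs & Hc & _) a b Ha Hb. apply Hc; now apply Hs. Qed.

Lemma point_intro x : (forall p, 0 <= x p) -> finsupp x -> is_chain le (fun p => x p <> 0) ->
  mean x (fun _ => 1) = 1 -> is_point le x.
Proof.
intros H0 Hf Hc Ht. destruct (supp_spec x Hf) as [Hn Hs]. split; auto.
exists (supp x). repeat split; try apply Hs; auto.
- intros a b Ha Hb. apply Hc; now apply Hs.
- rewrite <- Ht. apply sumL_ext. intros; ring.
Qed.

End Points.

(** * Points of a frame are determined by their barycentre *)

Section PointUniqueness.
Context {L : Type} {le : L -> L -> Prop} {meet : L -> L -> L} {n : nat}
  {Frames : (L -> Prop) -> Prop} (HL : is_polar_space le meet n Frames).
Local Notation coord := (@coord L le n).

Context {F : L -> Prop} {phi : L -> nat -> S2} (Hphi : coord F phi).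

(* The mass of [x] above [p] is [min |bary x i|] over the coordinates [i] of [p],
   so it only depends on the barycentre. *)
Lemma point_unique_aux (x y : L -> R) p : is_point le x -> is_point le y ->
  (forall q, x q <> 0 -> F q) -> (forall q, y q <> 0 -> F q) ->
  (forall i, (i < n)%nat -> bary phi x i = bary phi y i) ->
  y p < x p -> (forall q, lt le p q -> F q -> x q = y q) -> False.
Proof.
intros Hx Hy HFx HFy Hb Hp Hup.
assert (Fx := point_finsupp x Hx). assert (Fy := point_finsupp y Hy).
assert (Hxp : x p <> 0) by (assert (H := point_nonneg y Hy p); lra).
assert (HFp := HFx p Hxp).
set (w := fun q => if excluded_middle_informative (le p q) then 1 else 0).
set (u := fun q => if excluded_middle_informative (lt le p q) then 1 else 0).
assert (Hwu : forall q, w q = indic p q + u q).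
{ intros q. unfold w, u, indic. destruct (eqdec p q) as [<-|Hd].
  - destruct (excluded_middle_informative (le p p)) as [|Hn]; [|destruct Hn; apply (le_refl HL)].
    destruct (excluded_middle_informative _) as [[_ []]|]; auto; lra.
  - destruct (excluded_middle_informative (le p q)) as [Hle|Hle];
      destruct (excluded_middle_informative (lt le p q)) as [Hlt|Hlt]; try lra.
    + destruct Hlt. now split.
    + now destruct Hlt. }
assert (Hw : mean y w < mean x w).
{ rewrite (mean_ext x w _ Fx (fun q _ => Hwu q)), (mean_ext y w _ Fy (fun q _ => Hwu q)).
  rewrite !mean_plus, !mean_indic by auto.
  replace (mean x u) with (mean y u); [lra|].
  destruct (finsupp_list2 x y Fx Fy) as (s & Hn & H1 & H2).
  rewrite (mean_list y u s), (mean_list x u s) by auto. apply sumL_ext. intros q _. unfold u.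
  destruct (excluded_middle_informative (lt le p q)) as [Hlt|]; [|ring].
  destruct (classic (F q)) as [HFq|HFq]; [now rewrite Hup|].
  assert (x q = 0) by (apply NNPP; auto). assert (y q = 0) by (apply NNPP; auto). lra. }
assert (Hw0 : forall q, 0 <= w q <= 1) by (intros q; unfold w; destruct (excluded_middle_informative _); lra).
(* If some element of the support of [y] is not above [p], one of largest rank, [q], differs from
   [p] at a coordinate [i] where [p] is nonzero. By the chain condition, elements of the support
   agreeing with [p] at [i] are above [p]. So, up to the sign of [p] at [i], [bary phi y i] is at
   most the mass of [y] above [p], while [bary phi x i] is at least that of [x]. If there is no such
   element, the mass of [y] above [p] is already 1. *)
destruct (classic (exists q, In q (supp y) /\ ~ le p q)) as [Hex|Hex].
- destruct (list_argmin (supp y) (fun q => ~ le p q) (fun q => - INR (nnz n (phi q))) Hex)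
    as (q & Hq & Hpq & Hmax). apply (supp_spec y Fy) in Hq. assert (HFq := HFy q Hq).
  assert (Hi : exists i, (i < n)%nat /\ phi p i <> S2z /\ phi q i <> phi p i).
  { apply NNPP. intros Hn. apply Hpq, (coord_le Hphi); auto. intros i Hi.
    destruct (S2_dec (phi p i) S2z); [now right|]. left. symmetry. apply NNPP. intros Hne. apply Hn. now exists i. }
  destruct Hi as (i & Hi & Hpz & Hqp).
  assert (Hyi : forall r, y r <> 0 -> phi r i = phi p i -> le p r).
  { intros r Hr E. apply NNPP. intros Hpr. assert (HFr := HFy r Hr).
    assert (Hrq : le r q).
    { destruct (point_chain y Hy r q Hr Hq) as [|Hqr]; auto.
      destruct (eqdec q r) as [->|Hd]; [apply (le_refl HL)|].
      assert (Hlt := coord_lt_nnz HL Hphi q r HFq HFr (conj Hqr Hd)). apply lt_INR in Hlt.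
      specialize (Hmax r (proj1 (proj2 (supp_spec y Fy) r) Hr) Hpr). lra. }
    apply (coord_le Hphi) in Hrq; auto. destruct (Hrq i Hi); congruence. }
  assert (Ex : mean x w <= sv (phi p i) * bary phi x i).
  { unfold bary. rewrite <- mean_scal. apply mean_le; auto.
    - intros r. now apply (point_nonneg x Hx).
    - intros r Hr. unfold w. destruct (excluded_middle_informative (le p r)) as [Hpr|Hpr].
      + apply (coord_le Hphi) in Hpr; auto. destruct (Hpr i Hi) as [<-|]; [|congruence].
        destruct (phi p i); simpl; lra || congruence.
      + destruct (point_chain x Hx p r Hxp Hr) as [|Hrp]; [contradiction|].
        apply (coord_le Hphi) in Hrp; auto. destruct (Hrp i Hi) as [->| ->]; [|simpl; lra].
        destruct (phi p i); simpl; lra. }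
  assert (Ey : sv (phi p i) * bary phi y i <= mean y w).
  { unfold bary. rewrite <- mean_scal. apply mean_le; auto.
    - intros r. now apply (point_nonneg y Hy).
    - intros r Hr. destruct (S2_dec (phi r i) (phi p i)) as [E|E].
      + assert (Hpr := Hyi r Hr E). unfold w.
        destruct (excluded_middle_informative (le p r)); [|contradiction]. rewrite E.
        destruct (phi p i); simpl; lra.
      + apply Rle_trans with 0; [|apply Hw0].
        destruct (phi p i), (phi r i); simpl; lra || congruence. }
  rewrite Hb in Ex by auto. lra.
- assert (mean x w <= mean x (fun _ => 1)).
  { apply mean_le; auto; intros; [now apply (point_nonneg x Hx)|apply Hw0]. }
  assert (mean y w = mean y (fun _ => 1)).
  { apply mean_ext; auto. intros q Hq. unfold w.
    destruct (excluded_middle_informative (le p q)) as [|Hn]; auto.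
    destruct Hex. exists q. split; auto. now apply (supp_spec y Fy). }
  rewrite !(point_total (le := le)) in * by auto. lra.
Qed.

(** Downward induction on the rank: at an element [p] of largest rank where the points differ, they
    agree strictly above [p], so their masses above [p] differ. *)
Lemma point_unique (x y : L -> R) : is_point le x -> is_point le y ->
  (forall q, x q <> 0 -> F q) -> (forall q, y q <> 0 -> F q) ->
  (forall i, (i < n)%nat -> bary phi x i = bary phi y i) -> x = y.
Proof.
intros Hx Hy HFx HFy Hb. apply functional_extensionality. intros p0. apply NNPP. intros Hp0.
destruct (finsupp_list2 x y (point_finsupp x Hx) (point_finsupp y Hy)) as (s & Hn & H1 & H2).
assert (Hin : forall p, x p <> y p -> In p s /\ F p).
{ intros p Hp. destruct (Req_EM_T (x p) 0) as [E|E]; [|auto].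
  destruct (Req_EM_T (y p) 0) as [E'|E']; [congruence|auto]. }
destruct (list_argmin s (fun p => x p <> y p) (fun q => - INR (nnz n (phi q))))
  as (p & Hps & Hp & Hmax).
{ exists p0. split; auto. now apply Hin. }
assert (Hup : forall q, lt le p q -> F q -> x q = y q).
{ intros q Hlt HFq. apply NNPP. intros Hq. specialize (Hmax q (proj1 (Hin q Hq)) Hq).
  apply (coord_lt_nnz HL Hphi) in Hlt; auto; [|now apply Hin]. apply lt_INR in Hlt. lra. }
destruct (Rtotal_order (x p) (y p)) as [Hlt|[E|Hgt]]; [|contradiction|].
- apply (point_unique_aux y x p); auto.
  + intros i Hi. symmetry. now apply Hb.
  + intros q Hq HFq. symmetry. now apply Hup.
- now apply (point_unique_aux x y p).
Qed.

End PointUniqueness.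

(** * The metric of the complex *)

Section Metric.
Context {L : Type} {le : L -> L -> Prop} {meet : L -> L -> L} {n : nat}
  {Frames : (L -> Prop) -> Prop} (HL : is_polar_space le meet n Frames).
Local Notation retraction := (@retraction L le n Frames).

Lemma incr_from_facts a s : incr_from le a s ->
  NoDup (a :: s) /\ (forall b, In b s -> lt le a b) /\
  (forall b, In b (a :: s) -> le b (last s a)) /\
  (forall b c, In b (a :: s) -> In c (a :: s) -> le b c \/ le c b).
Proof.
revert a. induction s as [|b s IH]; intros a H.
- repeat split; try (simpl; tauto).
  + repeat constructor. simpl; auto.
  + intros b [<-|[]]. apply (le_refl HL).
  + intros b c [<-|[]] [<-|[]]. left. apply (le_refl HL).
- destruct H as [Hab H]. destruct (IH b H) as (Hnd & Hlt & Hlast & Hch).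
  assert (Hall : forall c, In c (b :: s) -> lt le a c).
  { intros c [<-|Hc]; auto. apply (lt_trans HL a b); auto. }
  assert (El : last (b :: s) a = last s b).
  { clear. revert a b. induction s as [|c s IH]; intros a b; [reflexivity|].
    change (last (c :: s) a = last (c :: s) b). now rewrite !IH. }
  repeat split; auto.
  + constructor; auto. intros Ha. now destruct (Hall a Ha).
  + now apply Hall.
  + now apply Hall.
  + intros c. rewrite El. intros [<-|Hc]; auto. apply (le_trans HL _ b); [apply Hab|].
    apply Hlast. simpl; auto.
  + intros c d [<-|Hc] [<-|Hd]; auto.
    * left. apply (le_refl HL).
    * left. now apply Hall.
    * right. now apply Hall.
Qed.

Lemma simplex_nodup sg : is_simplex le sg -> NoDup sg.
Proof. destruct sg as [|a s]; [intros []|]. intros H. now apply incr_from_facts in H. Qed.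

(** The sign vector of [q] agrees with that of [p] wherever the latter is nonzero. *)
Lemma retraction_dot h p q : retraction h -> le p q ->
  sumL (seq 0 n) (fun i => sv (h p i) * sv (h q i)) = INR (rank le p).
Proof.
intros Hh Hpq. rewrite (retraction_rank HL h p Hh), nnz_INR. apply sumL_ext. intros i Hi.
apply in_seq in Hi. destruct (retraction_le HL h p q Hh Hpq i ltac:(lia)) as [->| ->]; simpl; ring.
Qed.

(* Both sides are the quadratic form with Gram matrix [min (rank p) (rank q)],
   evaluated at [x - y], whose total mass is zero. *)
Lemma dsig_bary h sg x y : retraction h -> is_simplex le sg ->
  in_simplex le sg x -> in_simplex le sg y -> dsig le sg x y = edist n (bary h x) (bary h y).
Proof.
intros Hh Hsg [Hx Hxs] [Hy Hys]. assert (Hnd := simplex_nodup sg Hsg).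
destruct sg as [|a s]; [destruct Hsg|]. destruct (incr_from_facts a s Hsg) as (_ & Hlt & Hlast & Hch).
set (sg := a :: s) in *. set (u := fun p => x p - y p).
assert (Hu : sumL sg u = 0).
{ unfold u. rewrite sumL_minus. assert (H := point_total x Hx). assert (H' := point_total y Hy).
  rewrite (mean_list _ _ sg) in H by auto. rewrite (mean_list _ _ sg) in H' by auto.
  rewrite (sumL_ext _ x (fun p => x p * 1)), (sumL_ext _ y (fun p => y p * 1)) by (intros; ring). lra. }
set (r := fun p => (rank le p - rank le a)%nat). set (N := r (last s a)).
assert (Hra : forall p, In p sg -> (rank le a <= rank le p)%nat).
{ intros p [<-|Hp]; auto. apply (rank_mono HL). now apply Hlt. }
assert (HrN : forall p, In p sg -> (r p <= N)%nat).
{ intros p Hp. unfold N, r. assert (H := rank_mono HL p _ (Hlast p Hp)). lia. }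
change (dsig le sg x y) with
  (sqrt (sumL (seq 1 N) (fun j => (phi_coord le sg x j - phi_coord le sg y j) ^ 2))).
unfold edist. f_equal.
transitivity (sumL sg (fun p => sumL sg (fun q => u p * u q * INR (Nat.min (r p) (r q))))).
- transitivity (sumL (seq 1 N) (fun j => (sumL sg (fun p => u p * (if Nat.leb j (r p) then 1 else 0))) ^ 2)).
  + apply sumL_ext. intros j Hj. apply in_seq in Hj. f_equal. unfold sg. simpl.
    replace (r a) with 0%nat by (unfold r; lia). destruct (Nat.leb_spec j 0); [lia|].
    rewrite Rmult_0_r, Rplus_0_l, <- sumL_minus. apply sumL_ext. intros p _. unfold u.
    fold (r p). destruct (Nat.leb j (r p)); ring.
  + erewrite sumL_ext by (intros; apply sumL_sqr). cbv beta.
    rewrite sumL_swap. apply sumL_ext. intros p Hp. rewrite sumL_swap. apply sumL_ext.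
    intros q Hq. rewrite <- (sumL_ones_below N) by (specialize (HrN p Hp); lia).
    rewrite <- sumL_scal. apply sumL_ext. intros j _.
    destruct (Nat.leb_spec j (r p)); destruct (Nat.leb_spec j (r q));
      destruct (Nat.leb_spec j (Nat.min (r p) (r q))); try lia; ring.
- symmetry. unfold edist2.
  transitivity (sumL (seq 0 n) (fun i => (sumL sg (fun p => u p * sv (h p i))) ^ 2)).
  { apply sumL_ext. intros i _. f_equal. unfold bary.
    rewrite !(mean_list _ _ sg), <- sumL_minus by auto. apply sumL_ext. intros; unfold u; ring. }
  erewrite sumL_ext by (intros; apply sumL_sqr). cbv beta. rewrite sumL_swap.
  (* Measuring ranks from [a] instead of from the bottom changes the form by [rank a] times the
     square of the total mass of [u], which is zero. *)
  transitivity (sumL sg (fun p => sumL sg (fun q => u p * u q * INR (Nat.min (r p) (r q))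
    + INR (rank le a) * u p * u q))).
  { apply sumL_ext. intros p Hp. rewrite sumL_swap. apply sumL_ext. intros q Hq.
    transitivity (u p * u q * sumL (seq 0 n) (fun i => sv (h p i) * sv (h q i))).
    { rewrite <- sumL_scal. apply sumL_ext. intros; ring. }
    assert (E : sumL (seq 0 n) (fun i => sv (h p i) * sv (h q i)) = INR (Nat.min (rank le p) (rank le q))).
    { destruct (Hch p q Hp Hq) as [Hpq|Hqp].
      - rewrite Nat.min_l by (now apply (rank_mono HL)). now apply retraction_dot.
      - rewrite Nat.min_r by (now apply (rank_mono HL)).
        rewrite (sumL_ext _ _ (fun i => sv (h q i) * sv (h p i))) by (intros; ring).
        now apply retraction_dot. }
    rewrite E. replace (Nat.min (rank le p) (rank le q)) with (Nat.min (r p) (r q) + rank le a)%nat.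
    - rewrite plus_INR. ring.
    - assert (H1 := Hra p Hp). assert (H2 := Hra q Hq). unfold r. lia. }
  apply sumL_ext. intros p _. rewrite sumL_plus, (sumL_scal _ (INR (rank le a) * u p)), Hu. ring.
Qed.

(** A path comes with one partition, and each of its pieces keeps its length under [bary h]. The
    resulting polygon in Euclidean space is at least as long as the segment between its ends. *)
Lemma path_length_ge h g x y len : retraction h -> is_path le g x y ->
  path_length le g = Finite len -> edist n (bary h x) (bary h y) <= len.
Proof.
intros Hh (<- & <- & _ & m & t & sg & Hok & _) Hlen.
destruct (Lub_Rbar_correct (fun l => exists m tt sg, partition_ok le g m tt sg /\
    l = sumL (seq 0 m) (fun i => dsig le (sg i) (g (tt i)) (g (tt (S i)))))) as [Hub _].
fold (path_length le g) in Hub. rewrite Hlen in Hub.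
assert (H := Hub _ (ex_intro _ m (ex_intro _ t (ex_intro _ sg (conj Hok eq_refl))))).
simpl in H. destruct Hok as (Hm & H0 & H1 & Hok).
eapply Rle_trans; [|exact H]. rewrite <- H0, <- H1.
eapply Rle_trans; [apply (edist_path_le n (fun i => bary h (g (t i))))|].
right. apply sumL_ext. intros i Hi. apply in_seq in Hi.
destruct (Hok i ltac:(lia)) as (Ht & Hs & Hin). symmetry.
apply dsig_bary; auto; apply Hin; lra.
Qed.

Lemma Kdist_ge h x y : retraction h ->
  Rbar_le (Finite (edist n (bary h x) (bary h y))) (Kdist le x y).
Proof.
intros Hh. unfold Kdist. apply Glb_Rbar_correct. intros l (g & Hg & Hlen).
exact (path_length_ge h g x y l Hh Hg Hlen).
Qed.

End Metric.

(** * Geodesics *)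

(** An affine function changes sign at most once on an interval, so finitely many cuts give every
    function of [fs] a constant sign on each piece. As an induction principle this leaves the gluing
    of pieces to [Q]. *)
Lemma affine_partition_ind (fs : list (R -> R)) (Q : R -> R -> Prop) :
  (forall f, In f fs -> exists a b, forall s, f s = a * s + b) ->
  (forall a b c, a < b -> b < c -> Q a b -> Q b c -> Q a c) ->
  (forall a b, 0 <= a -> a < b -> b <= 1 ->
    (forall f, In f fs -> (forall s, a <= s <= b -> 0 <= f s) \/ (forall s, a <= s <= b -> f s <= 0)) ->
    Q a b) ->
  forall a b, 0 <= a -> a < b -> b <= 1 -> Q a b.
Proof.
induction fs as [|f fs IH]; intros Haff Hcat Hbase.
- intros a b Ha Hab Hb. apply Hbase; auto. intros f [].
- apply IH; auto; [intros g Hg; apply Haff; simpl; auto|].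
  intros a b Ha Hab Hb Hfs. destruct (Haff f (or_introl eq_refl)) as (al & be & Hf).
  assert (Hsub : forall a' b', a <= a' -> a' < b' -> b' <= b ->
    (forall s, a' <= s <= b' -> 0 <= f s) \/ (forall s, a' <= s <= b' -> f s <= 0) -> Q a' b').
  { intros a' b' H1 H2 H3 Hs. apply Hbase; try lra. intros g [<-|Hg]; auto.
    destruct (Hfs g Hg) as [H|H]; [left|right]; intros s Hs'; apply H; lra. }
  assert (Hpos : forall a' b', a' < b' -> 0 <= f a' -> 0 <= f b' -> forall s, a' <= s <= b' -> 0 <= f s)
    by (intros a' b'; rewrite !Hf; intros; rewrite Hf; nra).
  assert (Hneg : forall a' b', a' < b' -> f a' <= 0 -> f b' <= 0 -> forall s, a' <= s <= b' -> f s <= 0)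
    by (intros a' b'; rewrite !Hf; intros; rewrite Hf; nra).
  assert (Hroot : f a <> f b -> f (a + (b - a) * (f a / (f a - f b))) = 0).
  { rewrite !Hf. intros Hd. assert (al * (a - b) <> 0) by lra. field_simplify_eq; [ring|lra]. }
  assert (Hin : f a * f b < 0 -> 0 < f a / (f a - f b) < 1).
  { intros Hlt. destruct (Rlt_or_le (f a) 0).
    - assert (0 < f b) by nra. replace (f a / (f a - f b)) with (- f a / (f b - f a)) by (field; lra).
      split; [apply Rdiv_lt_0_compat; lra|]. apply Rlt_div_l; lra.
    - assert (f b < 0) by nra. assert (0 < f a) by nra.
      split; [apply Rdiv_lt_0_compat; lra|]. apply Rlt_div_l; lra. }
  destruct (Rlt_or_le (f a * f b) 0) as [Hlt|Hge].
  + specialize (Hin Hlt). assert (Hd : f a <> f b) by (intros E; rewrite E in Hlt; nra).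
    specialize (Hroot Hd). set (th := f a / (f a - f b)) in *. set (r := a + (b - a) * th) in *.
    assert (Hr : a < r < b) by (unfold r; nra).
    apply (Hcat a r b); try lra; apply Hsub; try lra.
    * destruct (Rle_or_lt 0 (f a)); [left; apply Hpos|right; apply Hneg]; lra.
    * destruct (Rle_or_lt 0 (f b)); [left; apply Hpos|right; apply Hneg]; lra.
  + apply Hsub; try lra.
    destruct (Rlt_or_le 0 (f a)); [left; apply Hpos; nra|].
    destruct (Rlt_or_le (f a) 0); [right; apply Hneg; nra|].
    destruct (Rle_or_lt 0 (f b)); [left; apply Hpos|right; apply Hneg]; lra.
Qed.

Section Geodesics.
Context {L : Type} {le : L -> L -> Prop} {meet : L -> L -> L} {n : nat}
  {Frames : (L -> Prop) -> Prop} (HL : is_polar_space le meet n Frames).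
Local Notation coord := (@coord L le n).
Local Notation flag := (@flag L n).
Local Notation retraction := (@retraction L le n Frames).

(** The set lies in one closed chamber of the arrangement of walls [v i = 0] and [v i = v j],
    [v i = - v j]; inside the cube this means in one orthoscheme. *)
Definition coherent (A : (nat -> R) -> Prop) : Prop :=
  (forall i, (i < n)%nat -> (forall v, A v -> 0 <= v i) \/ (forall v, A v -> v i <= 0)) /\
  (forall i j, (i < n)%nat -> (j < n)%nat ->
    (forall v, A v -> Rabs (v j) <= Rabs (v i)) \/ (forall v, A v -> Rabs (v i) <= Rabs (v j))).

Lemma coherent_singleton v0 : coherent (fun v => v = v0).
Proof.
split.
- intros i _. destruct (Rle_or_lt 0 (v0 i)); [left|right]; intros v ->; lra.
- intros i j _ _. destruct (Rle_or_lt (Rabs (v0 j)) (Rabs (v0 i))); [left|right]; intros v ->; lra.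
Qed.

Lemma mean_sum_indic {A} (s : list A) (lam : A -> R) (c : A -> L) (x : L -> R) (g : L -> R) :
  (forall p, x p = sumL s (fun k => lam k * indic (c k) p)) ->
  (forall p, x p <> 0 -> In p (map c s)) /\ mean x g = sumL s (fun k => lam k * g (c k)).
Proof.
intros Hx. assert (Hs : forall p, x p <> 0 -> In p (map c s)).
{ intros p Hp. apply NNPP. intros Hn. apply Hp. rewrite Hx. apply sumL_zero.
  intros k Hk. rewrite indic_diff; [ring|]. intros E. apply Hn. rewrite <- E. now apply in_map. }
split; auto. rewrite (mean_list x g (nodup eqdec (map c s))).
- rewrite (sumL_ext _ _ (fun p => sumL s (fun k => lam k * (indic (c k) p * g p)))).
  + rewrite sumL_swap. apply sumL_ext. intros k Hk. rewrite sumL_scal. f_equal.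
    apply sumL_indic; [apply NoDup_nodup|]. apply nodup_In. now apply in_map.
  + intros p _. rewrite Hx, Rmult_comm, <- sumL_scal. apply sumL_ext. intros; ring.
- apply NoDup_nodup.
- intros p Hp. apply nodup_In. auto.
Qed.

(** * The triangulated cube of a frame *)

Section Frame.
Context {F : L -> Prop} {phi : L -> nat -> S2} (HF : Frames F) (Hphi : coord F phi).

Definition supported (x : L -> R) : Prop := is_point le x /\ forall p, x p <> 0 -> F p.

Lemma flag_ex l eps : NoDup l -> (forall i, In i l <-> (i < n)%nat) ->
  (forall i, eps i <> S2z) -> exists c, flag F phi l eps c.
Proof.
intros Hl Hin He.
assert (H : forall k, exists x, F x /\
  forall i, phi x i = if in_dec Nat.eq_dec i (firstn k l) then eps i else S2z).
{ intros k. apply (coord_ex Hphi). intros i Hi. destruct (in_dec _ _ _) as [Hi'|]; auto.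
  exfalso. assert (H : In i l).
  { rewrite <- (firstn_skipn k l). apply in_or_app. now left. }
  apply Hin in H. lia. }
exists (fun k => proj1_sig (constructive_indefinite_description _ (H k))).
constructor; auto.
- intros k. destruct (constructive_indefinite_description _ _) as (x & Hx & Hxi). auto.
- intros k i. destruct (constructive_indefinite_description _ _) as (x & Hx & Hxi). simpl. auto.
Qed.

Lemma flag_simplex l eps c : flag F phi l eps c -> is_simplex le (map c (seq 0 (S n))).
Proof.
intros Hc. simpl. assert (H : forall m a, (a + m <= n)%nat -> incr_from le (c a) (map c (seq (S a) m))).
2: now apply H.
induction m as [|m IH]; intros a Hm; simpl; auto. split; [|apply IH; lia].
split.
- apply (flag_le Hphi Hc). lia.
- intros E. assert (Hlen := flag_length _ _ _ _ _ Hc).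
  assert (H := flag_coord _ _ _ _ _ Hc a (nth a l 0%nat)).
  rewrite E, (flag_coord _ _ _ _ _ Hc) in H.
  destruct (in_dec Nat.eq_dec (nth a l 0%nat) (firstn a l)) as [Hi|_].
  + revert Hi. apply nth_notin_firstn; [apply Hc|lia].
  + destruct (in_dec _ _ _) as [_|Hn].
    * now apply (flag_eps _ _ _ _ _ Hc) in H.
    * apply Hn, (In_firstn_S l a 0%nat); auto. lia.
Qed.

(** The triangulation of the cube made explicit: order the coordinates by decreasing absolute value
    and take the signs of the points. Both choices serve all of [A] at once, so a single simplex
    contains all the points obtained. *)
Lemma coherent_flag A : coherent A -> (forall v i, A v -> (i < n)%nat -> Rabs (v i) <= 1) ->
  exists l eps c, flag F phi l eps c /\ forall v, A v -> exists x, is_point le x /\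
    (forall p, x p <> 0 -> In p (map c (seq 0 (S n)))) /\
    forall i, (i < n)%nat -> bary phi x i = v i.
Proof.
intros [Hsg Hord] Hbd.
destruct (total_sort (fun i j => forall v, A v -> Rabs (v j) <= Rabs (v i)) (seq 0 n))
  as (l & Hperm & Hsort).
{ intros i j k Hij Hjk v Hv. apply Rle_trans with (Rabs (v j)); auto. }
{ intros i j Hi Hj. apply in_seq in Hi, Hj. destruct (Hord i j); auto; lia. }
set (eps := fun i => if excluded_middle_informative (forall v : nat -> R, A v -> 0 <= v i) then S2p else S2m).
assert (Hl : NoDup l) by (apply (Permutation_NoDup Hperm), seq_NoDup).
assert (Hin : forall i, In i l <-> (i < n)%nat).
{ intros i. assert (In i l <-> In i (seq 0 n)).
  { split; apply Permutation_in; auto. now symmetry. }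
  rewrite H, in_seq. lia. }
destruct (flag_ex l eps Hl Hin) as (c & Hc).
{ intros i. unfold eps. destruct (excluded_middle_informative _); discriminate. }
exists l, eps, c. split; auto. intros v Hv.
assert (Hlen := flag_length _ _ _ _ _ Hc).
assert (Heps : forall i, (i < n)%nat -> sv (eps i) * Rabs (v i) = v i).
{ intros i Hi. unfold eps. destruct (excluded_middle_informative _) as [H|H]; simpl.
  - rewrite Rabs_pos_eq; auto. ring.
  - destruct (Hsg i Hi) as [H'|H']; [contradiction|]. rewrite Rabs_left1; auto. ring. }
(* The decreasing sequence of absolute values, preceded by 1 and followed by 0. The vertex [c k]
   gets the drop [w k - w (S k)]; the drops sum to 1, and those at the vertices containing a given
   coordinate sum to its absolute value. *)
set (w := fun k => match k with O => 1 | S k => if Nat.ltb k n then Rabs (v (nth k l 0%nat)) else 0 end).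
assert (Hlt : forall k, (k < n)%nat -> (nth k l 0 < n)%nat) by (intros k Hk; apply Hin, nth_In; lia).
assert (Hdec : forall k, w (S k) <= w k).
{ intros [|k]; unfold w.
  - destruct (Nat.ltb_spec 0 n); [|lra]. auto.
  - destruct (Nat.ltb_spec (S k) n); destruct (Nat.ltb_spec k n); try lra; try lia.
    + apply (ForallOrdPairs_nth _ l 0%nat k (S k)) in Hsort; [|lia]. now apply Hsort.
    + apply Rabs_pos. }
set (x := fun p => sumL (seq 0 (S n)) (fun k => (w k - w (S k)) * indic (c k) p)).
assert (Hmean := fun g => mean_sum_indic (seq 0 (S n)) (fun k => w k - w (S k)) c x g (fun p => eq_refl)).
destruct (Hmean (fun _ => 1)) as [Hs _].
exists x. split; [|split; auto].
- apply point_intro.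
  + intros p. apply sumL_nonneg. intros k _. apply Rmult_le_pos; [|apply indic_nonneg].
    specialize (Hdec k). lra.
  + now exists (map c (seq 0 (S n))).
  + intros p q Hp Hq. apply Hs, in_map_iff in Hp, Hq.
    destruct Hp as (i & <- & _). destruct Hq as (j & <- & _).
    destruct (Nat.le_ge_cases i j); [left|right]; now apply (flag_le Hphi Hc).
  + rewrite (proj2 (Hmean _)).
    rewrite (sumL_ext _ _ (fun k => w k - w (S k))), sumL_telescope by (intros; ring).
    simpl. destruct (Nat.ltb_spec n n); [lia|]. lra.
- intros i Hi. unfold bary. rewrite (proj2 (Hmean _)).
  destruct (In_nth l i 0%nat (proj2 (Hin i) Hi)) as (k & Hk & Hki). rewrite Hlen in Hk.
  replace (S n) with (S k + (n - k))%nat by lia. rewrite seq_app, sumL_app, sumL_zero.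
  + rewrite (sumL_ext _ _ (fun j => sv (eps i) * (w j - w (S j)))).
    * rewrite sumL_scal, sumL_telescope, Rplus_0_l, <- (Heps i Hi). f_equal.
      replace (0 + S k + (n - k))%nat with (S n) by lia. simpl.
      destruct (Nat.ltb_spec n n); [lia|]. destruct (Nat.ltb_spec k n); [|lia]. rewrite Hki. ring.
    * intros j Hj. apply in_seq in Hj. rewrite (flag_coord _ _ _ _ _ Hc).
      destruct (in_dec _ _ _) as [_|Hn]; [ring|]. exfalso. apply Hn. rewrite <- Hki.
      replace (nth k l 0%nat) with (nth k (firstn j l) 0%nat).
      -- apply nth_In. rewrite length_firstn. lia.
      -- rewrite nth_firstn. destruct (Nat.ltb_spec k j); [auto|lia].
  + intros j Hj. apply in_seq in Hj. rewrite (flag_coord _ _ _ _ _ Hc).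
    destruct (in_dec _ _ _) as [Hj'|_]; [|simpl; ring]. exfalso.
    apply (nth_notin_firstn l k 0%nat); auto; [lia|]. rewrite Hki.
    replace (firstn j l) with (firstn j (firstn k l)) in Hj' by (rewrite firstn_firstn; f_equal; lia).
    rewrite <- (firstn_skipn j (firstn k l)). apply in_or_app. now left.
Qed.

Lemma supported_unique x y : supported x -> supported y ->
  (forall i, (i < n)%nat -> bary phi x i = bary phi y i) -> x = y.
Proof. intros [Hx HFx] [Hy HFy]. now apply (point_unique HL Hphi). Qed.

Lemma cube_point v : (forall i, (i < n)%nat -> Rabs (v i) <= 1) ->
  exists x l eps c, supported x /\ (forall i, (i < n)%nat -> bary phi x i = v i) /\
    flag F phi l eps c /\ forall p, x p <> 0 -> exists k, p = c k.
Proof.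
intros Hv. destruct (coherent_flag _ (coherent_singleton v)) as (l & eps & c & Hc & Hx).
{ intros v' i ->. auto. }
destruct (Hx v eq_refl) as (x & Hp & Hs & Hb). exists x, l, eps, c.
assert (Hk : forall p, x p <> 0 -> exists k, p = c k).
{ intros p Hp0. apply Hs, in_map_iff in Hp0. destruct Hp0 as (k & <- & _). eauto. }
split; [|auto]. split; auto. intros p Hp0. destruct (Hk p Hp0) as (k & ->). apply Hc.
Qed.

Lemma bary_bound x i : is_point le x -> Rabs (bary phi x i) <= 1.
Proof.
intros Hx. assert (Hf := point_finsupp x Hx). assert (H0 := point_nonneg x Hx).
assert (Ht := point_total x Hx). apply Rabs_le. split.
- rewrite <- Ht. replace (- mean x (fun _ => 1)) with (mean x (fun _ => -1 * 1)) by (rewrite mean_scal; ring).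
  apply mean_le; auto. intros p _. destruct (phi p i); simpl; lra.
- rewrite <- Ht. apply mean_le; auto. intros p _. destruct (phi p i); simpl; lra.
Qed.

Lemma lerp_bound v w t i : 0 <= t <= 1 -> Rabs (v i) <= 1 -> Rabs (w i) <= 1 -> Rabs (lerp t v w i) <= 1.
Proof.
intros Ht Hv Hw. apply Rabs_le_between in Hv, Hw. apply Rabs_le_between. unfold lerp. nra.
Qed.

(** No chain is refined by hand: the point is rebuilt from its barycentre inside a flag, and
    uniqueness identifies the two. *)
Lemma flag_of_supported x : supported x -> exists l eps c, flag F phi l eps c /\
  forall p, x p <> 0 -> exists k, p = c k.
Proof.
intros Hx. destruct (cube_point (bary phi x)) as (x' & l & eps & c & Hx' & Hb & Hc & Hk).
{ intros i _. apply bary_bound, Hx. }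
replace x' with x in Hk by (apply supported_unique; auto; intros; symmetry; auto).
now exists l, eps, c.
Qed.

Lemma bary_agree h x : supported x -> (forall p, F p -> h p = phi p) -> bary h x = bary phi x.
Proof.
intros [Hx HFx] Hh. apply functional_extensionality. intros i. unfold bary.
apply mean_ext; [now apply (point_finsupp (le := le))|]. intros p Hp. rewrite Hh; auto.
Qed.

(** The last clause is what centring at [x] buys: the frame found for a chain [D] also contains the
    support of [x], so on it [h] separates [x] from points carried by [D]. *)
Lemma retraction_centred x : supported x -> exists h, retraction h /\ (forall p, F p -> h p = phi p) /\
  forall D, is_chain le D -> exists G, Frames G /\ (forall p, x p <> 0 -> G p) /\ subset D G /\ coord G h.
Proof.
intros Hx. destruct (flag_of_supported x Hx) as (l & eps & c & Hc & Hk).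
destruct (retraction_ex HL HF Hphi Hc) as (h & Hh & Hr). exists h. split; [|split; auto].
- intros D HD. destruct (Hr D HD) as (G & HG & _ & HDG & Hco). now exists G.
- intros D HD. destruct (Hr D HD) as (G & HG & Hcg & HDG & Hco). exists G. repeat split; try apply Hco; auto.
  intros p Hp. destruct (Hk p Hp) as (k & ->). auto.
Qed.

Lemma straight_path x y : supported x -> supported y ->
  exists g, g 0 = x /\ g 1 = y /\
    (forall s, 0 <= s <= 1 -> supported (g s) /\
      forall i, (i < n)%nat -> bary phi (g s) i = lerp s (bary phi x) (bary phi y) i) /\
    exists m tt sg, partition_ok le g m tt sg.
Proof.
intros Hx Hy. set (v := fun s => lerp s (bary phi x) (bary phi y)).
assert (Hv : forall s i, 0 <= s <= 1 -> Rabs (v s i) <= 1).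
{ intros s i Hs. apply lerp_bound; auto; apply bary_bound; [apply Hx|apply Hy]. }
set (P := fun s z => supported z /\ forall i, (i < n)%nat -> bary phi z i = v s i).
set (g := fun s => epsilon (inhabits x) (P s)).
assert (Hg : forall s, 0 <= s <= 1 -> P s (g s)).
{ intros s Hs. apply epsilon_spec.
  destruct (cube_point (v s)) as (z & _ & _ & _ & Hz & Hb & _); [auto|]. now exists z. }
exists g. split; [|split; [|split]]; auto.
- destruct (Hg 0) as [H1 H2]; [lra|]. apply supported_unique; auto. intros i Hi.
  rewrite H2 by auto. unfold v, lerp. ring.
- destruct (Hg 1) as [H1 H2]; [lra|]. apply supported_unique; auto. intros i Hi.
  rewrite H2 by auto. unfold v, lerp. ring.
(* The walls of the triangulation, restricted to the segment; the sum with [i = j] gives the wall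
   [v i = 0]. Between crossings the segment stays in one simplex. *)
- set (fs := flat_map (fun i => flat_map (fun j =>
     [(fun s => v s i - v s j); (fun s => v s i + v s j)]) (seq 0 n)) (seq 0 n)).
  set (Q := fun a b => exists m (tt : nat -> R) sg, (1 <= m)%nat /\ tt 0%nat = a /\ tt m = b /\
    forall i, (i < m)%nat -> tt i < tt (S i) /\ is_simplex le (sg i) /\
      forall s, tt i <= s <= tt (S i) -> in_simplex le (sg i) (g s)).
  apply (affine_partition_ind fs Q); try lra.
  + intros f Hf. apply in_flat_map in Hf. destruct Hf as (i & _ & Hf).
    apply in_flat_map in Hf. destruct Hf as (j & _ & Hf). unfold v, lerp in Hf.
    set (xi := bary phi x i) in Hf. set (xj := bary phi x j) in Hf.
    set (yi := bary phi y i) in Hf. set (yj := bary phi y j) in Hf.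
    destruct Hf as [<-|[<-|[]]].
    * exists ((yi - xi) - (yj - xj)), (xi - xj). intros; ring.
    * exists ((yi - xi) + (yj - xj)), (xi + xj). intros; ring.
  + intros a b c Hab Hbc (m1 & t1 & s1 & Hm1 & H10 & H11 & H1) (m2 & t2 & s2 & Hm2 & H20 & H21 & H2).
    exists (m1 + m2)%nat, (fun i => if Nat.leb i m1 then t1 i else t2 (i - m1)%nat),
      (fun i => if Nat.ltb i m1 then s1 i else s2 (i - m1)%nat).
    split; [lia|]. split; [|split].
    * simpl. auto.
    * destruct (Nat.leb_spec (m1 + m2) m1); [lia|]. now replace (m1 + m2 - m1)%nat with m2 by lia.
    * intros i Hi. destruct (Nat.ltb_spec i m1).
      -- destruct (Nat.leb_spec i m1); [|lia]. destruct (Nat.leb_spec (S i) m1); [|lia]. auto.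
      -- replace (if Nat.leb i m1 then t1 i else t2 (i - m1)%nat) with (t2 (i - m1)%nat).
         ++ destruct (Nat.leb_spec (S i) m1); [lia|].
            replace (S i - m1)%nat with (S (i - m1)) by lia. apply H2. lia.
         ++ destruct (Nat.leb_spec i m1); auto. replace i with m1 by lia.
            rewrite Nat.sub_diag. congruence.
  + intros a b Ha Hab Hb Hsgn.
    assert (Hpm : forall i j, (i < n)%nat -> (j < n)%nat ->
      ((forall s, a <= s <= b -> 0 <= v s i - v s j) \/ (forall s, a <= s <= b -> v s i - v s j <= 0)) /\
      ((forall s, a <= s <= b -> 0 <= v s i + v s j) \/ (forall s, a <= s <= b -> v s i + v s j <= 0))).
    { intros i j Hi Hj. split; [apply (Hsgn (fun s => v s i - v s j))|apply (Hsgn (fun s => v s i + v s j))];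
        apply in_flat_map; exists i;
        (split; [apply in_seq; lia|]); apply in_flat_map; exists j;
        (split; [apply in_seq; lia|]); simpl; auto. }
    destruct (coherent_flag (fun u => exists s, a <= s <= b /\ u = v s)) as (l & eps & c & Hc & Hpt).
    * split.
      -- intros i Hi. destruct (Hpm i i Hi Hi) as [_ [H|H]]; [left|right];
           intros u (s & Hs & ->); specialize (H s Hs); lra.
      (* Absolute values are compared through squares, and [v i ^ 2 - v j ^ 2] is the product of the
         two functions whose signs are known. *)
      -- intros i j Hi Hj. destruct (Hpm i j Hi Hj) as [[H1|H1] [H2|H2]]; [left|right|right|left];
           intros u (s & Hs & ->); specialize (H1 s Hs); specialize (H2 s Hs); apply Rsqr_le_abs_0;
           unfold Rsqr; nra.
    * intros u i (s & Hs & ->) _. apply Hv. lra.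
    * exists 1%nat, (fun i => match i with O => a | _ => b end), (fun _ => map c (seq 0 (S n))).
      split; [auto|]. split; [auto|]. split; [auto|].
      intros i Hi. replace i with 0%nat by lia. split; [auto|].
      split; [now apply (flag_simplex l eps)|]. intros s Hs.
      destruct (Hpt (v s)) as (z & Hz & Hzs & Hzb); [now exists s|].
      destruct (Hg s) as [H1 H2]; [lra|].
      replace (g s) with z; [now split|]. apply supported_unique; auto.
      -- split; auto. intros p Hp. apply Hzs, in_map_iff in Hp. destruct Hp as (k & <- & _). apply Hc.
      -- intros i' Hi'. rewrite H2, Hzb; auto.
Qed.

(** The straight path realises the Euclidean distance, since every partition of it has that same
    sum. Retracting shows that no path through other frames is shorter. *)
Lemma Kdist_frame x y : supported x -> supported y ->
  Kdist le x y = Finite (edist n (bary phi x) (bary phi y)).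
Proof.
intros Hx Hy. destruct (retraction_centred x Hx) as (h & Hh & Hagree & _).
destruct (straight_path x y Hx Hy) as (g & Hg0 & Hg1 & Hg & m & t & sg & Hok).
assert (Hd : forall sg s s', 0 <= s <= 1 -> 0 <= s' <= 1 -> is_simplex le sg ->
  in_simplex le sg (g s) -> in_simplex le sg (g s') ->
  dsig le sg (g s) (g s') = Rabs (s - s') * edist n (bary phi x) (bary phi y)).
{ intros sg' s s' Hs Hs' Hsg H1 H2. destruct (Hg s Hs) as [K1 K2]. destruct (Hg s' Hs') as [K1' K2'].
  rewrite (dsig_bary HL h); auto.
  rewrite (bary_agree h (g s)), (bary_agree h (g s')) by auto. rewrite <- edist_lerp.
  apply edist_ext; auto. }
assert (Hmono : forall m t sg, partition_ok le g m t sg -> forall i, (i <= m)%nat -> 0 <= t i <= 1).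
{ intros m' t' sg' (_ & H0 & H1 & H).
  assert (Hle : forall i k, (i + k <= m')%nat -> t' i <= t' (i + k)%nat).
  { intros i k. induction k as [|k IH]; intros Hk.
    - rewrite Nat.add_0_r. lra.
    - rewrite Nat.add_succ_r. destruct (H (i + k)%nat) as [Hlt _]; [lia|].
      specialize (IH ltac:(lia)). lra. }
  intros i Hi. rewrite <- H0, <- H1. split; [apply (Hle 0%nat i); lia|].
  replace m' with (i + (m' - i))%nat by lia. apply Hle. lia. }
assert (Hlen : path_length le g = Finite (edist n (bary phi x) (bary phi y))).
{ assert (Hsum : forall m t sg, partition_ok le g m t sg ->
    sumL (seq 0 m) (fun i => dsig le (sg i) (g (t i)) (g (t (S i)))) = edist n (bary phi x) (bary phi y)).
  { intros m' t' sg' Hok'. assert (Hm := Hmono _ _ _ Hok'). destruct Hok' as (H' & H0 & H1 & H).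
    rewrite (sumL_ext _ _ (fun i => - edist n (bary phi x) (bary phi y) * (t' i - t' (S i)))).
    - rewrite sumL_scal, sumL_telescope. simpl. rewrite H0, H1. ring.
    - intros i Hi. apply in_seq in Hi. destruct (H i) as (Hlt & Hsg & Hin); [lia|].
      rewrite Hd; auto; try (apply Hm; lia); try (apply Hin; lra).
      rewrite Rabs_left by lra. ring. }
  unfold path_length. apply is_lub_Rbar_unique. split.
  - intros l (m' & t' & sg' & Hok' & ->). rewrite (Hsum _ _ _ Hok'). apply Rbar_le_refl.
  - intros b Hb. apply Hb. exists m, t, sg. split; auto. now rewrite (Hsum _ _ _ Hok). }
apply Rbar_le_antisym.
- unfold Kdist. apply Glb_Rbar_correct. exists g. split; auto.
  split; [auto|]. split; [auto|]. split; [intros s Hs; now apply Hg|]. exists m, t, sg. split; auto.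
  intros i Hi s Hs e He. assert (Hm := Hmono _ _ _ Hok). destruct Hok as (H' & H0 & H1 & H).
  destruct (H i Hi) as (Hlt & Hsg & Hin).
  assert (H2 := Hm i ltac:(lia)). assert (H3 := Hm (S i) ltac:(lia)).
  set (D := edist n (bary phi x) (bary phi y)). assert (HD : 0 <= D) by apply edist_nonneg.
  (* The path is Lipschitz with constant [D]; adding 1 covers [D = 0]. *)
  exists (e / (D + 1)). split; [apply Rdiv_lt_0_compat; lra|]. intros s' Hs' Habs.
  rewrite Hd; auto; try lra. fold D. apply Rlt_div_r in Habs; [|lra].
  assert (0 <= Rabs (s' - s)) by apply Rabs_pos. nra.
- rewrite <- (bary_agree h x), <- (bary_agree h y) by auto. now apply (Kdist_ge HL).
Qed.

Lemma geodesic_through x y : supported x -> supported y ->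
  exists g, is_geodesic le g /\ g 0 = x /\ g 1 = y /\
    forall s, 0 <= s <= 1 -> supported (g s) /\
      forall i, (i < n)%nat -> bary phi (g s) i = lerp s (bary phi x) (bary phi y) i.
Proof.
intros Hx Hy. destruct (straight_path x y Hx Hy) as (g & Hg0 & Hg1 & Hg & _).
exists g. split; [|auto]. split; [intros s Hs; now apply Hg|].
intros s t Hs Ht. destruct (Hg s Hs) as [H1 H2]. destruct (Hg t Ht) as [H3 H4].
rewrite Hg0, Hg1, !Kdist_frame by auto. simpl. f_equal. rewrite <- edist_lerp. now apply edist_ext.
Qed.

(* The retraction centred at the point [m] of the frame with the right barycentre sends
   [g t] to [m]; as it is injective on a frame containing both, [g t = m]. *)
Lemma geodesic_in_frame g t : is_geodesic le g -> supported (g 0) -> supported (g 1) -> 0 <= t <= 1 ->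
  supported (g t) /\
  forall i, (i < n)%nat -> bary phi (g t) i = lerp t (bary phi (g 0)) (bary phi (g 1)) i.
Proof.
intros [Hpt Hg] H0 H1 Ht. assert (Hz := Hpt t Ht). set (D := edist n (bary phi (g 0)) (bary phi (g 1))).
destruct (cube_point (lerp t (bary phi (g 0)) (bary phi (g 1)))) as (m & _ & _ & _ & Hm & Hmb & _).
{ intros i _. apply lerp_bound; auto; apply bary_bound; [apply H0|apply H1]. }
destruct (retraction_centred m Hm) as (h & Hh & Hagree & Hcen).
assert (Hb0 : edist n (bary phi (g 0)) (bary h (g t)) <= t * D).
{ assert (H := Kdist_ge HL h (g 0) (g t) Hh). rewrite (Hg 0 t) in H by lra.
  rewrite Kdist_frame, bary_agree in H by auto. simpl in H. fold D in H.
  rewrite Rabs_left1 in H by lra. lra. }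
assert (Hb1 : edist n (bary h (g t)) (bary phi (g 1)) <= (1 - t) * D).
{ assert (H := Kdist_ge HL h (g t) (g 1) Hh). rewrite (Hg t 1) in H by lra.
  rewrite Kdist_frame, (bary_agree h (g 1)) in H by auto. simpl in H. fold D in H.
  rewrite Rabs_left1 in H by lra. lra. }
assert (Hb := edist_between n _ _ _ t Ht Hb0 Hb1).
destruct (Hcen _ (point_chain _ Hz)) as (G & HG & HGm & HGz & Hco).
assert (E : g t = m).
{ apply (point_unique HL Hco); auto; [apply Hm|]. intros i Hi.
  rewrite (bary_agree h m), Hmb, Hb by auto. reflexivity. }
rewrite E. auto.
Qed.

End Frame.
End Geodesics.

(** * Metric intervals and the set E(p,q) *)

Lemma in_hull_le (P : R * R -> Prop) a b c :
  (forall z, P z -> a * fst z + b * snd z <= c) ->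
  forall z, in_hull P z -> a * fst z + b * snd z <= c.
Proof.
intros H z (l & Hl & Ht & ->).
set (S := fold_right _ _ _).
assert (E : a * fst S + b * snd S = sumL l (fun k => fst k * (a * fst (snd k) + b * snd (snd k)))).
{ unfold S. clear. induction l as [|k l IH]; simpl; [ring|]. rewrite <- IH. simpl. ring. }
rewrite E. replace c with (sumL l (fun k => c * fst k)) by (rewrite sumL_scal, Ht; ring).
apply sumL_le. intros [w y] Hk. destruct (Hl w y Hk) as [Hw Hy]. specialize (H y Hy). simpl. nra.
Qed.

Lemma in_hull_segment (P : R * R -> Prop) y z t : P y -> P z -> 0 <= t <= 1 ->
  in_hull P (padd (pscale (1 - t) y) (pscale t z)).
Proof.
intros Hy Hz Ht. exists [(1 - t, y); (t, z)]. split; [|split].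
- intros c p [E|[E|[]]]; injection E as <- <-; split; auto; lra.
- simpl. ring.
- unfold padd, pscale. simpl. f_equal; ring.
Qed.

Lemma in_hull_self (P : R * R -> Prop) z : P z -> in_hull P z.
Proof.
intros Hz. replace z with (padd (pscale (1 - 0) z) (pscale 0 z)).
- apply in_hull_segment; auto. lra.
- destruct z. unfold padd, pscale. simpl. f_equal; ring.
Qed.

(** The angles in [cone_coef] are picked by [epsilon], so the value must be computed from an
    arbitrary admissible pair. The explicit pair only shows that one exists. *)
Lemma cone_coef_spec (C : R * R -> Prop) a0 b0 : cone_angles C (a0, b0) ->
  exists a b, cone_angles C (a, b) /\
    cone_coef C = sin a / (sin a + cos a) - sin b / (sin b + cos b).
Proof.
intros H. unfold cone_coef.
assert (Hs := epsilon_spec (inhabits (0, 0)) (cone_angles C) (ex_intro _ _ H)).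
destruct (epsilon (inhabits (0, 0)) (cone_angles C)) as [a b]. exists a, b. auto.
Qed.

(** * Coefficients of the two half quadrants and of the quadrant *)

Lemma sin_cos_nonneg a : 0 <= a <= PI / 2 -> 0 <= sin a /\ 0 <= cos a /\ sin a ^ 2 + cos a ^ 2 = 1.
Proof.
intros Ha. assert (HP := PI_RGT_0). split; [apply sin_ge_0; lra|]. split; [apply cos_ge_0; lra|].
assert (H := sin2_cos2 a). unfold Rsqr in H. lra.
Qed.

Lemma cone_coef_lower (C : R * R -> Prop) :
  (forall x y, C (x, y) <-> 0 <= y /\ y <= x) -> cone_coef C = / 2.
Proof.
intros HC. assert (HP := PI_RGT_0). destruct (cone_coef_spec C (PI / 4) 0) as (a & b & Hab & ->).
{ unfold cone_angles. simpl. repeat split; try lra.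
  - apply HC in H. lra.
  - apply HC in H. lra.
  - apply HC in H. rewrite cos_PI4, sin_PI4.
    apply Rmult_le_compat_r; [|lra]. apply Rlt_le, Rdiv_lt_0_compat; [lra|apply Rlt_sqrt2_0].
  - apply HC in H. rewrite cos_0, sin_0. lra.
  - intros (Hx & Hy & H1 & H2). apply HC. rewrite cos_PI4, sin_PI4 in H1. split; auto.
    apply Rmult_le_reg_r in H1; auto. apply Rdiv_lt_0_compat; [lra|apply Rlt_sqrt2_0]. }
destruct Hab as (Hb & Hba & Ha & H). simpl in *.
destruct (sin_cos_nonneg a) as (Sa & Ca & Ea); [lra|].
destruct (sin_cos_nonneg b) as (Sb & Cb & Eb); [lra|].
(* The boundary rays pin the angles: [(1, 0)] forces [sin b = 0], [(1, 1)] gives [cos a <= sin a],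
   and the ray [(cos a, sin a)], which lies in the cone, gives the converse. *)
assert (H10 : C (1, 0)) by (apply HC; lra). apply H in H10.
assert (H11 : C (1, 1)) by (apply HC; lra). apply H in H11.
assert (Esb : sin b = 0) by lra.
assert (Hra : C (cos a, sin a)).
{ apply H. rewrite Esb. repeat split; auto; nra. }
apply HC in Hra. assert (Esa : sin a = cos a) by lra. rewrite Esb, Esa. field. rewrite Esa in Ea. nra.
Qed.

Lemma cone_coef_upper (C : R * R -> Prop) :
  (forall x y, C (x, y) <-> 0 <= x /\ x <= y) -> cone_coef C = / 2.
Proof.
intros HC. assert (HP := PI_RGT_0). destruct (cone_coef_spec C (PI / 2) (PI / 4)) as (a & b & Hab & ->).
{ unfold cone_angles. simpl. rewrite cos_PI2, sin_PI2, cos_PI4, sin_PI4.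
  assert (Hs : 0 < 1 / sqrt 2) by (apply Rdiv_lt_0_compat; [lra|apply Rlt_sqrt2_0]).
  repeat split; try lra.
  - apply HC in H. lra.
  - apply HC in H. lra.
  - apply HC in H. lra.
  - apply HC in H. apply Rle_ge, Rmult_le_compat_r; lra.
  - intros (Hx & Hy & H1 & H2). apply HC. split; auto.
    apply Rge_le, Rmult_le_reg_r in H2; auto. }
destruct Hab as (Hb & Hba & Ha & H). simpl in *.
destruct (sin_cos_nonneg a) as (Sa & Ca & Ea); [lra|].
destruct (sin_cos_nonneg b) as (Sb & Cb & Eb); [lra|].
assert (H01 : C (0, 1)) by (apply HC; lra). apply H in H01.
assert (H11 : C (1, 1)) by (apply HC; lra). apply H in H11.
assert (Eca : cos a = 0) by lra.
assert (Hrb : C (cos b, sin b)).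
{ apply H. rewrite Eca. repeat split; auto; nra. }
apply HC in Hrb. assert (Esb : sin b = cos b) by lra. rewrite Esb, Eca. field.
rewrite Eca in Ea. rewrite Esb in Eb. split; nra.
Qed.

Lemma cone_coef_quadrant (C : R * R -> Prop) :
  (forall x y, C (x, y) <-> 0 <= x /\ 0 <= y) -> cone_coef C = 1.
Proof.
intros HC. assert (HP := PI_RGT_0). destruct (cone_coef_spec C (PI / 2) 0) as (a & b & Hab & ->).
{ unfold cone_angles. simpl. rewrite cos_PI2, sin_PI2, cos_0, sin_0.
  repeat split; try lra; try (apply HC in H; lra).
  intros (Hx & Hy & _). apply HC. lra. }
destruct Hab as (Hb & Hba & Ha & H). simpl in *.
destruct (sin_cos_nonneg a) as (Sa & Ca & Ea); [lra|].
destruct (sin_cos_nonneg b) as (Sb & Cb & Eb); [lra|].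
assert (H01 : C (0, 1)) by (apply HC; lra). apply H in H01.
assert (H10 : C (1, 0)) by (apply HC; lra). apply H in H10.
assert (Eca : cos a = 0) by lra. assert (Esb : sin b = 0) by lra. rewrite Esb, Eca. field.
rewrite Eca in Ea. rewrite Esb in Eb. split; nra.
Qed.

(** The graph distance of [S_2^n]: going from -1 to 1 passes through 0 and takes two edges. *)
Definition l1dist (n : nat) (v w : nat -> S2) : R :=
  sumL (seq 0 n) (fun i => Rabs (sv (v i) - sv (w i))).

Lemma l1dist_triangle n u v w : l1dist n u w <= l1dist n u v + l1dist n v w.
Proof.
unfold l1dist. rewrite <- sumL_plus. apply sumL_le. intros i _.
replace (sv (u i) - sv (w i)) with ((sv (u i) - sv (v i)) + (sv (v i) - sv (w i))) by ring.
apply Rabs_triang.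
Qed.

Lemma l1dist_sym n v w : l1dist n v w = l1dist n w v.
Proof. apply sumL_ext. intros. apply Rabs_minus_sym. Qed.

Definition over (a b : S2) : S2 := if S2_dec a S2z then b else a.

Definition conflict (a b : S2) : R :=
  if S2_dec a S2z then 0 else if S2_dec b S2z then 0 else if S2_dec a b then 0 else 1.

(** * Distance in the covering graph *)

Section Interval.
Context {L : Type} {le : L -> L -> Prop} {meet : L -> L -> L} {n : nat}
  {Frames : (L -> Prop) -> Prop} (HL : is_polar_space le meet n Frames).
Local Notation coord := (@coord L le n).
Local Notation retraction := (@retraction L le n Frames).

(** The length of a walk from [p] down to [meet p q] and up to [q] by covering steps. It turns out
    to be the distance in the covering graph. *)
Definition rdist (p q : L) : R :=
  INR (rank le p) + INR (rank le q) - 2 * INR (rank le (meet p q)).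

Lemma meet_comm p q : meet p q = meet q p.
Proof.
destruct (meet_glb HL p q) as (H1 & H2 & H3). destruct (meet_glb HL q p) as (H4 & H5 & H6).
apply (le_antisym HL); auto.
Qed.

Lemma rdist_sym p q : rdist p q = rdist q p.
Proof. unfold rdist. rewrite meet_comm. ring. Qed.

Lemma indic_point p : is_point le (indic p).
Proof.
apply point_intro.
- intros q. apply indic_nonneg.
- apply indic_finsupp.
- intros a b Ha Hb. apply indic_neq0 in Ha, Hb. subst. left. apply (le_refl HL).
- now rewrite mean_of_indic.
Qed.

Lemma indic_supported (F : L -> Prop) p : F p -> supported (le := le) (F := F) (indic p).
Proof. intros Hp. split; [apply indic_point|]. intros q Hq. apply indic_neq0 in Hq. now subst. Qed.

Lemma l1dist_frame F phi p q : Frames F -> coord F phi -> F p -> F q ->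
  l1dist n (phi p) (phi q) = rdist p q.
Proof.
intros HF Hphi Hp Hq. unfold rdist.
rewrite (rank_coord HL F phi p), (rank_coord HL F phi q), (rank_coord HL F phi (meet p q)), !nnz_INR
  by (auto; now apply (frames_meet HL)).
unfold l1dist. rewrite <- sumL_scal, <- sumL_plus, <- sumL_minus. apply sumL_ext.
intros i Hi. apply in_seq in Hi. rewrite (meet_coord HL F) by (auto; lia).
destruct (phi p i), (phi q i); simpl; unfold Rabs; destruct (Rcase_abs _); lra.
Qed.

(** A covering pair is a chain, so [h] is a coordinate system on a frame through it. There, copying
    one differing coordinate of the upper element into the lower one already yields the upper one,
    as nothing lies strictly between. *)
Lemma retraction_adj h x y : retraction h -> adj le x y -> l1dist n (h x) (h y) = 1.
Proof.
intros Hh. assert (Hc : forall x y, covers le x y -> l1dist n (h x) (h y) = 1).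
2: intros [H|H]; [|rewrite l1dist_sym]; auto.
clear x y. intros x y [[Hxy Hd] Hn]. destruct (Hh _ (chain_pair HL x y Hxy)) as (G & HG & Hs & Hco).
assert (Hx : G x) by (apply Hs; auto). assert (Hy : G y) by (apply Hs; auto).
destruct (coord_diff HL Hco x y Hx Hy Hd) as (i & Hi & Hxyi).
destruct (coord_update Hco x i (h y i) Hx Hi) as (z & Hz & Hzi).
assert (Hle := proj1 (coord_le Hco x y Hx Hy) Hxy).
assert (Hxi : h x i = S2z) by (destruct (Hle i Hi); congruence).
assert (E : z = y).
{ apply NNPP. intros Hzy. apply Hn. exists z. split; split; auto.
  - apply (coord_le Hco); auto. intros j Hj. rewrite Hzi.
    destruct (Nat.eqb_spec j i) as [->|]; [now right|now left].
  - intros ->. specialize (Hzi i). rewrite Nat.eqb_refl in Hzi. congruence.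
  - apply (coord_le Hco); auto. intros j Hj. rewrite Hzi.
    destruct (Nat.eqb_spec j i) as [->|]; [now left|auto]. }
subst z. transitivity (sumL (seq 0 n) (fun j => indic i j * 1)).
- apply sumL_ext. intros j _. unfold indic. destruct (eqdec i j) as [<-|Hij].
  + rewrite Hxi in *. destruct (h y i); simpl; try congruence;
      unfold Rabs; destruct (Rcase_abs _); lra.
  + rewrite (Hzi j). destruct (Nat.eqb_spec j i); [congruence|].
    rewrite Rminus_diag, Rabs_R0. ring.
- apply (sumL_indic (seq 0 n) i (fun _ => 1)); [apply seq_NoDup|apply in_seq; lia].
Qed.

Lemma walk_l1dist h w : retraction h -> forall p d, is_walk le p w ->
  l1dist n (h p) (h (last (p :: w) d)) <= INR (length w).
Proof.
intros Hh. induction w as [|y w IH]; intros p d Hw.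
- simpl. unfold l1dist. rewrite sumL_zero; [lra|]. intros. rewrite Rminus_diag. apply Rabs_R0.
- destruct Hw as [Ha Hw]. specialize (IH y d Hw). apply (retraction_adj h) in Ha; auto.
  change (last (p :: y :: w) d) with (last (y :: w) d).
  change (length (y :: w)) with (S (length w)). rewrite S_INR.
  assert (H := l1dist_triangle n (h p) (h y) (h (last (y :: w) d))). lra.
Qed.

Section Frame.
Context {F : L -> Prop} {phi : L -> nat -> S2} (HF : Frames F) (Hphi : coord F phi).

Lemma coord_covers x y i : F x -> F y -> (i < n)%nat -> phi x i <> S2z ->
  (forall j, phi y j = if Nat.eqb j i then S2z else phi x j) -> covers le y x.
Proof.
intros Hx Hy Hi Hxi Hyi. assert (Hn := nnz_drop x i y Hi Hxi Hyi).
rewrite <- (rank_coord HL F phi x), <- (rank_coord HL F phi y) in Hn by auto.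
split; [split|].
- apply (coord_le Hphi); auto. intros j Hj. rewrite Hyi. destruct (Nat.eqb j i); [now right|now left].
- intros ->. lia.
- intros (z & H1 & H2). apply (rank_lt HL) in H1, H2. lia.
Qed.

Lemma frame_walk p q : F p -> F q ->
  exists w, walk_pq le p q w /\ INR (length w) <= l1dist n (phi p) (phi q).
Proof.
intros Hp Hq. destruct (INR_unbounded (l1dist n (phi p) (phi q))) as (k & Hk).
apply Rlt_le in Hk. revert p Hp Hk. induction k as [|k IH]; intros p Hp Hk.
all: destruct (classic (p = q)) as [->|Hd];
  [exists []; repeat split; simpl; apply sumL_nonneg; intros; apply Rabs_pos|].
all: destruct (coord_diff HL Hphi p q Hp Hq Hd) as (i & Hi & Hpq).
- exfalso. assert (Hz := sumL_nonneg_zero (seq 0 n) _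
    (fun j _ => Rabs_pos (sv (phi p j) - sv (phi q j))) Hk i ltac:(apply in_seq; lia)).
  simpl in Hz. apply Rabs_eq_0 in Hz. destruct (phi p i), (phi q i); simpl in Hz; lra || congruence.
(* One step towards [q] at a coordinate where they differ: a nonzero entry is first erased, a zero
   entry is filled in from [q]. *)
- set (a := if S2_dec (phi p i) S2z then phi q i else S2z).
  destruct (coord_update Hphi p i a Hp Hi) as (r & Hr & Hri).
  assert (Hadj : adj le p r).
  { unfold a in Hri. destruct (S2_dec (phi p i) S2z) as [E|E].
    - left. apply (coord_covers r p i); auto.
      + rewrite Hri, Nat.eqb_refl. congruence.
      + intros j. rewrite Hri. destruct (Nat.eqb_spec j i); congruence.
    - right. apply (coord_covers p r i); auto. }
  assert (Hdist : l1dist n (phi p) (phi q) = 1 + l1dist n (phi r) (phi q)).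
  { rewrite <- (sumL_indic (seq 0 n) i (fun _ => 1)) by (apply seq_NoDup || apply in_seq; lia).
    unfold l1dist. rewrite <- sumL_plus. apply sumL_ext. intros j _. rewrite Hri. unfold indic.
    destruct (eqdec i j) as [<-|Hij].
    - rewrite Nat.eqb_refl. unfold a. destruct (phi p i), (phi q i); simpl; try congruence;
        unfold Rabs; repeat destruct (Rcase_abs _); lra.
    - destruct (Nat.eqb_spec j i); [congruence|]. ring. }
  rewrite S_INR in Hk. destruct (IH r Hr) as (w & [Hw1 Hw2] & Hw3); [lra|].
  exists (r :: w). split; [split|].
  + now split.
  + rewrite <- Hw2. clear. revert r. induction w as [|y w IH]; intros r; [reflexivity|].
    change (last (y :: w) p = last (y :: w) r). clear. revert y.
    induction w as [|z w IH]; intros y; [reflexivity|]. apply IH.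
  + change (length (r :: w)) with (S (length w)). rewrite S_INR. lra.
Qed.

End Frame.

Lemma last_default (p : L) w d d' : last (p :: w) d = last (p :: w) d'.
Proof. revert p. induction w as [|y w IH]; intros p; [reflexivity|]. apply IH. Qed.

Lemma frames_retraction p q : exists F phi h, Frames F /\ coord F phi /\ F p /\ F q /\
  retraction h /\ forall x, F x -> h x = phi x.
Proof.
destruct (frames_pair HL p q) as (F & HF & Hp & Hq). destruct (frames_coord HL F HF) as (phi & Hphi).
destruct (retraction_centred HL HF Hphi (indic p) (indic_supported F p Hp)) as (h & Hh & Hag & _).
exists F, phi, h. auto 7.
Qed.

Lemma walk_rdist p q w : walk_pq le p q w -> rdist p q <= INR (length w).
Proof.
intros [H1 H2]. destruct (frames_retraction p q) as (F & phi & h & HF & Hphi & Hp & Hq & Hh & Hag).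
rewrite <- (l1dist_frame F phi), <- !Hag by auto. rewrite <- H2. now apply walk_l1dist.
Qed.

Lemma min_walk p q : exists w, walk_pq le p q w /\ INR (length w) = rdist p q.
Proof.
destruct (frames_retraction p q) as (F & phi & h & HF & Hphi & Hp & Hq & Hh & Hag).
destruct (frame_walk HF Hphi p q Hp Hq) as (w & Hw & Hlen). exists w. split; auto.
rewrite (l1dist_frame F phi) in Hlen by auto. apply walk_rdist in Hw. lra.
Qed.

Lemma retraction_rdist h x y : retraction h -> l1dist n (h x) (h y) <= rdist x y.
Proof.
intros Hh. destruct (min_walk x y) as (w & [H1 H2] & H3). rewrite <- H3.
assert (H := walk_l1dist h w Hh x x H1). now rewrite H2 in H.
Qed.

Lemma rdist_triangle p u q : rdist p q <= rdist p u + rdist u q.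
Proof.
destruct (frames_retraction p q) as (F & phi & h & HF & Hphi & Hp & Hq & Hh & Hag).
rewrite <- (l1dist_frame F phi), <- !Hag by auto.
assert (H1 := retraction_rdist h p u Hh). assert (H2 := retraction_rdist h u q Hh).
assert (H3 := l1dist_triangle n (h p) (h u) (h q)). lra.
Qed.

Lemma walk_app p w1 w2 : is_walk le p (w1 ++ w2) <->
  is_walk le p w1 /\ is_walk le (last (p :: w1) p) w2.
Proof.
revert p. induction w1 as [|y w1 IH]; intros p; simpl app.
- simpl. tauto.
- change (is_walk le p (y :: w1 ++ w2)) with (adj le p y /\ is_walk le y (w1 ++ w2)).
  change (is_walk le p (y :: w1)) with (adj le p y /\ is_walk le y w1).
  change (last (p :: y :: w1) p) with (last (y :: w1) p). rewrite IH.
  rewrite (last_default y w1 p y). tauto.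
Qed.

Lemma last_app_walk (p : L) w1 w2 : last (p :: w1 ++ w2) p = last (last (p :: w1) p :: w2) p.
Proof.
assert (H : forall d p, last (p :: w1 ++ w2) d = last (last (p :: w1) d :: w2) d).
{ induction w1 as [|y w1 IH]; intros d r; [reflexivity|]. apply IH. }
apply H.
Qed.

(** Walks concatenate and shortest ones have length [rdist], so lying on a shortest walk is equality
    in the triangle inequality, a condition on ranks only. *)
Lemma Ipq_iff p q u : Ipq le p q u <-> rdist p u + rdist u q = rdist p q.
Proof.
split.
- intros (w & [Hw Hmin] & Hu).
  assert (Hs : exists w1 w2, w = w1 ++ w2 /\ last (p :: w1) p = u).
  { destruct Hu as [<-|Hu]; [now exists [], w|].
    destruct (in_split _ _ Hu) as (w1 & w2 & ->). exists (w1 ++ [u]), w2. split.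
    - now rewrite <- app_assoc.
    - rewrite app_comm_cons. apply last_last. }
  destruct Hs as (w1 & w2 & -> & Hl). destruct Hw as [Hw Hlast].
  apply walk_app in Hw. destruct Hw as [Hw1 Hw2]. rewrite Hl in Hw2.
  rewrite last_app_walk, Hl in Hlast.
  assert (H1 : walk_pq le p u w1) by now split.
  assert (H2 : walk_pq le u q w2) by (split; auto; rewrite (last_default _ _ u p); auto).
  apply walk_rdist in H1, H2. destruct (min_walk p q) as (w & Hw & Hlen).
  apply Hmin, le_INR in Hw. rewrite length_app, plus_INR in Hw.
  assert (H := rdist_triangle p u q). lra.
- intros H. destruct (min_walk p u) as (w1 & [H1 H2] & H3).
  destruct (min_walk u q) as (w2 & [H4 H5] & H6).
  exists (w1 ++ w2). split; [split; [split|]|].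
  + apply walk_app. now rewrite H2.
  + rewrite last_app_walk, H2, <- H5. apply last_default.
  + intros w Hw. apply walk_rdist in Hw. apply INR_le. rewrite length_app, plus_INR. lra.
  + rewrite app_comm_cons. apply in_or_app. left. rewrite <- H2.
    assert (E : forall (r : L) w d, In (last (r :: w) d) (r :: w)).
    { clear. intros r w d. revert r. induction w as [|y w IH]; intros r; [simpl; auto|].
      right. apply IH. }
    apply E.
Qed.

(** ** The two maximal extreme points *)

Section Pair.
Context {F : L -> Prop} {phi : L -> nat -> S2} (HF : Frames F) (Hphi : coord F phi).
Context {p q u1 u2 : L} (Hp : F p) (Hq : F q) (Hu1 : F u1) (Hu2 : F u2).
Context (Hu1c : forall i, (i < n)%nat -> phi u1 i = over (phi p i) (phi q i)).
Context (Hu2c : forall i, (i < n)%nat -> phi u2 i = over (phi q i) (phi p i)).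

Definition conflicts : R := sumL (seq 0 n) (fun i => conflict (phi p i) (phi q i)).

Let A : R := INR (rank le p) - INR (rank le (meet p q)).
Let B : R := INR (rank le q) - INR (rank le (meet p q)).

Lemma conflicts_nonneg : 0 <= conflicts.
Proof.
apply sumL_nonneg. intros i _. unfold conflict.
destruct (S2_dec _ _); [lra|]. destruct (S2_dec _ _); [lra|]. destruct (S2_dec _ _); lra.
Qed.

(** The retraction fixes [p] and [q] and does not increase [rdist]. For [u] between them all
    inequalities become equalities, even at each coordinate, so the ranks of [meet u p] and
    [meet u q] can be read off [h u] although [u] may lie outside [F]. *)
Lemma interval_retraction h u : retraction h -> (forall x, F x -> h x = phi x) -> Ipq le p q u ->
  (forall i, (i < n)%nat ->
     Rabs (sv (phi p i) - sv (h u i)) + Rabs (sv (h u i) - sv (phi q i)) = Rabs (sv (phi p i) - sv (phi q i))) /\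
  INR (rank le (meet u p)) = sumL (seq 0 n) (fun i => sv (S2meet (h u i) (phi p i)) ^ 2) /\
  INR (rank le (meet u q)) = sumL (seq 0 n) (fun i => sv (S2meet (h u i) (phi q i)) ^ 2).
Proof.
intros Hh Hag Hu. apply Ipq_iff in Hu.
assert (H1 := retraction_rdist h p u Hh). assert (H2 := retraction_rdist h u q Hh).
assert (H3 := l1dist_triangle n (h p) (h u) (h q)).
rewrite <- (l1dist_frame F phi p q) in Hu by auto.
rewrite (Hag p Hp) in H1, H3. rewrite (Hag q Hq) in H2, H3.
assert (E1 : rdist u p = l1dist n (h u) (phi p)).
{ rewrite rdist_sym, l1dist_sym. lra. }
assert (E2 : rdist u q = l1dist n (h u) (phi q)) by lra.
assert (Hm : forall r, F r -> rdist u r = l1dist n (h u) (phi r) ->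
  INR (rank le (meet u r)) = sumL (seq 0 n) (fun i => sv (S2meet (h u i) (phi r i)) ^ 2)).
{ intros r Hr E. unfold rdist in E.
  rewrite (retraction_rank HL h u Hh), (rank_coord HL F phi r), !nnz_INR in E by auto.
  assert (E' : 2 * sumL (seq 0 n) (fun i => sv (S2meet (h u i) (phi r i)) ^ 2)
    = sumL (seq 0 n) (fun i => sv (h u i) ^ 2) + sumL (seq 0 n) (fun i => sv (phi r i) ^ 2)
      - l1dist n (h u) (phi r)).
  { unfold l1dist. rewrite <- sumL_scal, <- sumL_plus, <- sumL_minus. apply sumL_ext. intros i _.
    destruct (h u i), (phi r i); simpl; unfold Rabs; destruct (Rcase_abs _); lra. }
  lra. }
split; [|split; now apply Hm]. intros i Hi.
assert (Hz := sumL_nonneg_zero (seq 0 n) (fun i => Rabs (sv (phi p i) - sv (h u i))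
  + Rabs (sv (h u i) - sv (phi q i)) - Rabs (sv (phi p i) - sv (phi q i)))).
cut (Rabs (sv (phi p i) - sv (h u i)) + Rabs (sv (h u i) - sv (phi q i)) - Rabs (sv (phi p i) - sv (phi q i)) = 0); [lra|].
apply (Hz (fun j _ => ltac:(assert (H := Rabs_triang (sv (phi p j) - sv (h u j)) (sv (h u j) - sv (phi q j)));
  replace (sv (phi p j) - sv (h u j) + (sv (h u j) - sv (phi q j))) with (sv (phi p j) - sv (phi q j)) in H by ring;
  lra))); [|apply in_seq; lia].
rewrite sumL_minus, sumL_plus. fold (l1dist n (phi p) (h u)) (l1dist n (h u) (phi q)) (l1dist n (phi p) (phi q)).
rewrite (l1dist_sym n (phi p) (h u)), <- E1, <- E2, rdist_sym. lra.
Qed.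

Lemma AB_sums : A = sumL (seq 0 n) (fun i => sv (phi p i) ^ 2 - sv (S2meet (phi p i) (phi q i)) ^ 2) /\
  B = sumL (seq 0 n) (fun i => sv (phi q i) ^ 2 - sv (S2meet (phi p i) (phi q i)) ^ 2).
Proof.
unfold A, B.
rewrite (rank_coord HL F phi p), (rank_coord HL F phi q), (rank_coord HL F phi (meet p q)), !nnz_INR
  by (auto; now apply (frames_meet HL)).
rewrite <- !sumL_minus.
split; apply sumL_ext; intros i Hi; apply in_seq in Hi; rewrite (meet_coord HL F) by (auto; lia); reflexivity.
Qed.

(** After retraction all three bounds are coordinatewise. Where [p] and [q] conflict, [u] agrees
    with at most one of them, which costs 1 in the sum of the two components. *)
Lemma rvec_bounds u : Ipq le p q u ->
  fst (rvec le meet p q u) <= A /\ snd (rvec le meet p q u) <= B /\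
  fst (rvec le meet p q u) + snd (rvec le meet p q u) <= A + B - conflicts.
Proof.
intros Hu. destruct (retraction_centred HL HF Hphi (indic p) (indic_supported F p Hp)) as (h & Hh & Hag & _).
destruct (interval_retraction h u Hh Hag Hu) as (Hbt & E1 & E2).
unfold rvec. simpl. unfold A, B, conflicts. rewrite E1, E2.
rewrite (rank_coord HL F phi p), (rank_coord HL F phi q), !nnz_INR by auto.
assert (S1 : sumL (seq 0 n) (fun i => sv (S2meet (h u i) (phi p i)) ^ 2) <= sumL (seq 0 n) (fun i => sv (phi p i) ^ 2)).
{ apply sumL_le. intros i _. destruct (h u i), (phi p i); simpl; lra. }
assert (S2 : sumL (seq 0 n) (fun i => sv (S2meet (h u i) (phi q i)) ^ 2) <= sumL (seq 0 n) (fun i => sv (phi q i) ^ 2)).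
{ apply sumL_le. intros i _. destruct (h u i), (phi q i); simpl; lra. }
assert (S3 : sumL (seq 0 n) (fun i => sv (S2meet (h u i) (phi p i)) ^ 2)
  + sumL (seq 0 n) (fun i => sv (S2meet (h u i) (phi q i)) ^ 2)
  <= sumL (seq 0 n) (fun i => sv (phi p i) ^ 2) + sumL (seq 0 n) (fun i => sv (phi q i) ^ 2)
    - sumL (seq 0 n) (fun i => conflict (phi p i) (phi q i))).
{ rewrite <- !sumL_plus, <- sumL_minus. apply sumL_le. intros i _. unfold conflict.
  destruct (h u i), (phi p i), (phi q i); simpl; lra. }
repeat split; lra.
Qed.

Lemma over_interval u v : F v -> 
  (u = p \/ u = q) -> (forall i, (i < n)%nat -> phi v i = over (phi u i) (over (phi p i) (phi q i))) ->
  Ipq le p q v.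
Proof.
intros Hv Hu Hvi. apply Ipq_iff. rewrite <- !(l1dist_frame F phi) by auto.
unfold l1dist. rewrite <- sumL_plus. apply sumL_ext. intros i Hi. apply in_seq in Hi.
rewrite Hvi by lia. destruct Hu as [->| ->];
  destruct (phi p i), (phi q i); simpl; unfold Rabs; repeat destruct (Rcase_abs _); lra.
Qed.

Lemma u1_interval : Ipq le p q u1.
Proof.
apply (over_interval p); auto. intros i Hi. rewrite Hu1c by auto.
destruct (phi p i), (phi q i); reflexivity.
Qed.

Lemma u2_interval : Ipq le p q u2.
Proof.
apply (over_interval q); auto. intros i Hi. rewrite Hu2c by auto.
destruct (phi p i), (phi q i); reflexivity.
Qed.

Lemma rvec_u1 : rvec le meet p q u1 = (A, B - conflicts).
Proof.
destruct AB_sums as [EA EB]. unfold rvec, conflicts. rewrite EA, EB.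
rewrite (rank_coord HL F phi (meet u1 p)), (rank_coord HL F phi (meet u1 q)),
  (rank_coord HL F phi (meet p q)), !nnz_INR by (auto; now apply (frames_meet HL)).
rewrite <- !sumL_minus. f_equal; apply sumL_ext; intros i Hi; apply in_seq in Hi;
  rewrite !(meet_coord HL F), Hu1c by (auto; lia); unfold conflict;
  destruct (phi p i), (phi q i); simpl; lra.
Qed.

Lemma rvec_u2 : rvec le meet p q u2 = (A - conflicts, B).
Proof.
destruct AB_sums as [EA EB]. unfold rvec, conflicts. rewrite EA, EB.
rewrite (rank_coord HL F phi (meet u2 p)), (rank_coord HL F phi (meet u2 q)),
  (rank_coord HL F phi (meet p q)), !nnz_INR by (auto; now apply (frames_meet HL)).
rewrite <- !sumL_minus. f_equal; apply sumL_ext; intros i Hi; apply in_seq in Hi;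
  rewrite !(meet_coord HL F), Hu2c by (auto; lia); unfold conflict;
  destruct (phi p i), (phi q i); simpl; lra.
Qed.

(* Retracting with centre at the candidate vertex [v] identifies [u] with [v]. *)
Lemma rvec_determines u v : Ipq le p q u -> F v ->
  (v = u1 \/ v = u2) -> rvec le meet p q u = rvec le meet p q v -> u = v.
Proof.
intros Hu Hv Hvu Er.
destruct (retraction_centred HL HF Hphi (indic v) (indic_supported F v Hv)) as (h & Hh & Hag & Hcen).
destruct (Hcen _ (chain_singleton HL u)) as (G & HG & HGv & HGu & Hco).
assert (Gv : G v) by (apply HGv; rewrite indic_same; lra). assert (Gu : G u) by now apply HGu.
destruct (interval_retraction h u Hh Hag Hu) as (Hbt & E1 & E2).
assert (Iv : Ipq le p q v) by (destruct Hvu as [->| ->]; [apply u1_interval|apply u2_interval]).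
destruct (interval_retraction h v Hh Hag Iv) as (_ & E3 & E4).
unfold rvec in Er. injection Er as Er1 Er2. rewrite Hag in E3, E4 by auto.
assert (D1 : sumL (seq 0 n) (fun i => sv (S2meet (h u i) (phi p i)) ^ 2)
  = sumL (seq 0 n) (fun i => sv (S2meet (phi v i) (phi p i)) ^ 2)) by lra.
assert (D2 : sumL (seq 0 n) (fun i => sv (S2meet (h u i) (phi q i)) ^ 2)
  = sumL (seq 0 n) (fun i => sv (S2meet (phi v i) (phi q i)) ^ 2)) by lra.
assert (Hov : forall i, (i < n)%nat -> phi v i = over (phi p i) (phi q i) \/ phi v i = over (phi q i) (phi p i)).
{ intros i Hi. destruct Hvu as [->| ->]; auto. }
set (k := fun i => (sv (S2meet (phi v i) (phi p i)) ^ 2 + sv (S2meet (phi v i) (phi q i)) ^ 2)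
  - (sv (S2meet (h u i) (phi p i)) ^ 2 + sv (S2meet (h u i) (phi q i)) ^ 2)).
assert (Hk : forall i, In i (seq 0 n) -> k i = 0).
{ apply sumL_nonneg_zero.
  - intros i Hi. apply in_seq in Hi. unfold k.
    destruct (Hov i ltac:(lia)) as [->| ->]; destruct (h u i), (phi p i), (phi q i); simpl; lra.
  - unfold k. rewrite sumL_minus, !sumL_plus. lra. }
set (k1 := fun i => sv (S2meet (phi v i) (phi p i)) ^ 2 - sv (S2meet (h u i) (phi p i)) ^ 2).
set (k2 := fun i => sv (S2meet (phi v i) (phi q i)) ^ 2 - sv (S2meet (h u i) (phi q i)) ^ 2).
apply (coord_inj HL Hco); auto. intros i Hi. rewrite (Hag v) by auto.
assert (Hki := Hk i ltac:(apply in_seq; lia)). unfold k in Hki. specialize (Hbt i Hi).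
destruct Hvu as [->| ->].
- assert (Hk1 : forall i, In i (seq 0 n) -> k1 i = 0).
  { apply sumL_nonneg_zero.
    - intros j Hj. apply in_seq in Hj. unfold k1. rewrite Hu1c by lia.
      destruct (h u j), (phi p j), (phi q j); simpl; lra.
    - unfold k1. rewrite sumL_minus. lra. }
  specialize (Hk1 i ltac:(apply in_seq; lia)). unfold k1 in Hk1. rewrite Hu1c in * by auto.
  destruct (h u i), (phi p i), (phi q i); simpl in *; try reflexivity; exfalso; try lra;
    revert Hbt; unfold Rabs; repeat destruct (Rcase_abs _); lra.
- assert (Hk2 : forall i, In i (seq 0 n) -> k2 i = 0).
  { apply sumL_nonneg_zero.
    - intros j Hj. apply in_seq in Hj. unfold k2. rewrite Hu2c by lia.
      destruct (h u j), (phi p j), (phi q j); simpl; lra.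
    - unfold k2. rewrite sumL_minus. lra. }
  specialize (Hk2 i ltac:(apply in_seq; lia)). unfold k2 in Hk2. rewrite Hu2c in * by auto.
  destruct (h u i), (phi p i), (phi q i); simpl in *; try reflexivity; exfalso; try lra;
    revert Hbt; unfold Rabs; repeat destruct (Rcase_abs _); lra.
Qed.

Lemma hull_bounds z : ConvI le meet p q z ->
  fst z <= A /\ snd z <= B /\ fst z + snd z <= A + B - conflicts.
Proof.
intros Hz. assert (Hg : forall a b c, (forall u, Ipq le p q u ->
    a * fst (rvec le meet p q u) + b * snd (rvec le meet p q u) <= c) -> a * fst z + b * snd z <= c).
{ intros a b c H. apply (in_hull_le _ a b c) in Hz; auto. intros y (u & Hu & ->). auto. }
assert (H1 := Hg 1 0 A). assert (H2 := Hg 0 1 B). assert (H3 := Hg 1 1 (A + B - conflicts)).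
split; [|split].
- cut (1 * fst z + 0 * snd z <= A); [lra|]. apply H1. intros u Hu. destruct (rvec_bounds u Hu). lra.
- cut (0 * fst z + 1 * snd z <= B); [lra|]. apply H2. intros u Hu. destruct (rvec_bounds u Hu). lra.
- cut (1 * fst z + 1 * snd z <= A + B - conflicts); [lra|]. apply H3. intros u Hu.
  destruct (rvec_bounds u Hu). lra.
Qed.

Lemma hull_u1 : ConvI le meet p q (A, B - conflicts).
Proof. rewrite <- rvec_u1. apply in_hull_self. exists u1. split; auto. apply u1_interval. Qed.

Lemma hull_u2 : ConvI le meet p q (A - conflicts, B).
Proof. rewrite <- rvec_u2. apply in_hull_self. exists u2. split; auto. apply u2_interval. Qed.

Lemma Epq_u1 : Epq le meet p q u1.
Proof.
split; [apply u1_interval|]. rewrite rvec_u1. split; split; try apply hull_u1.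
- intros a b t Ha Hb Ht E. apply hull_bounds in Ha, Hb. destruct a as [a1 a2], b as [b1 b2].
  unfold padd, pscale in E. simpl in *. injection E as E1 E2.
  assert (a1 = A) by nra. assert (b1 = A) by nra.
  assert (a1 + a2 = A + B - conflicts) by nra. assert (b1 + b2 = A + B - conflicts) by nra.
  f_equal; lra.
- intros [z1 z2] Hz. apply hull_bounds in Hz. simpl in *. intros H1 H2. f_equal; lra.
Qed.

Lemma Epq_u2 : Epq le meet p q u2.
Proof.
split; [apply u2_interval|]. rewrite rvec_u2. split; split; try apply hull_u2.
- intros a b t Ha Hb Ht E. apply hull_bounds in Ha, Hb. destruct a as [a1 a2], b as [b1 b2].
  unfold padd, pscale in E. simpl in *. injection E as E1 E2.
  assert (a2 = B) by nra. assert (b2 = B) by nra.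
  assert (a1 + a2 = A + B - conflicts) by nra. assert (b1 + b2 = A + B - conflicts) by nra.
  f_equal; lra.
- intros [z1 z2] Hz. apply hull_bounds in Hz. simpl in *. intros H1 H2. f_equal; lra.
Qed.

(** The three half-planes of [hull_bounds] leave as maximal part of the hull the segment between the
    vectors of [u1] and [u2]. Only its ends are extreme, and each end is the vector of a single
    element. *)
Lemma Epq_iff u : Epq le meet p q u <-> u = u1 \/ u = u2.
Proof.
split; [|intros [->| ->]; [apply Epq_u1|apply Epq_u2]].
intros (Hu & [Hz Hex] & [_ Hmax]).
assert (Hd := conflicts_nonneg). assert (Hb := hull_bounds _ Hz).
assert (H1 : rvec le meet p q u = (A, B - conflicts) -> u = u1).
{ intros E. apply rvec_determines; auto. now rewrite rvec_u1. }
assert (H2 : rvec le meet p q u = (A - conflicts, B) -> u = u2).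
{ intros E. apply rvec_determines; auto. now rewrite rvec_u2. }
destruct (rvec le meet p q u) as [x y]. simpl in *.
destruct (Rle_or_lt x (A - conflicts)) as [Hx|Hx].
{ right. apply H2. symmetry. apply Hmax; [apply hull_u2|simpl; lra..]. }
destruct (Rle_or_lt A x) as [Hx'|Hx'].
{ left. apply H1. symmetry. apply Hmax; [apply hull_u1|simpl; lra..]. }
(* Strictly between the two ends, maximality puts [(x, y)] on the segment, at parameter [t]; an
   extreme point cannot lie inside it. *)
exfalso. set (t := (A - x) / conflicts).
assert (Ht : 0 < t < 1).
{ unfold t. split; [apply Rdiv_lt_0_compat; lra|]. apply Rlt_div_l; lra. }
assert (Et : t * conflicts = A - x) by (unfold t; field; lra).
assert (E : padd (pscale (1 - t) (A, B - conflicts)) (pscale t (A - conflicts, B)) = (x, A + B - conflicts - x)).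
{ unfold padd, pscale. simpl. f_equal; [nra|]. nra. }
assert (Hs : ConvI le meet p q (x, A + B - conflicts - x)).
{ rewrite <- E. apply in_hull_segment; [| |lra].
  - exists u1. split; [apply u1_interval|now rewrite rvec_u1].
  - exists u2. split; [apply u2_interval|now rewrite rvec_u2]. }
assert (Exy : (x, A + B - conflicts - x) = (x, y)) by (apply Hmax; auto; simpl; lra).
rewrite Exy in E. symmetry in E. apply Hex in E; auto using hull_u1, hull_u2.
injection E as E _. lra.
Qed.

(** The edge between the two vertices has normal [(1, 1)], which halves the quadrant of directions.
    This is the origin of the coefficients 1/2. *)
Lemma coefE_u1 : 0 < conflicts -> coefE le meet p q u1 = / 2.
Proof.
intros Hd. apply cone_coef_lower. intros x y. unfold Cone. rewrite rvec_u1. simpl. split.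
- intros (Hx & Hy & H). split; auto. specialize (H _ hull_u2). unfold pdot in H. simpl in H. nra.
- intros [Hy Hxy]. split; [lra|]. split; [lra|]. intros z Hz. apply hull_bounds in Hz.
  unfold pdot. simpl. destruct Hz as (H1 & H2 & H3). nra.
Qed.

Lemma coefE_u2 : 0 < conflicts -> coefE le meet p q u2 = / 2.
Proof.
intros Hd. apply cone_coef_upper. intros x y. unfold Cone. rewrite rvec_u2. simpl. split.
- intros (Hx & Hy & H). split; auto. specialize (H _ hull_u1). unfold pdot in H. simpl in H. nra.
- intros [Hy Hxy]. split; [lra|]. split; [lra|]. intros z Hz. apply hull_bounds in Hz.
  unfold pdot. simpl. destruct Hz as (H1 & H2 & H3). nra.
Qed.

Lemma coefE_join : conflicts = 0 -> coefE le meet p q u1 = 1.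
Proof.
intros Hd. apply cone_coef_quadrant. intros x y. unfold Cone. rewrite rvec_u1. simpl. split.
- tauto.
- intros [Hx Hy]. split; [lra|]. split; [lra|]. intros z Hz. apply hull_bounds in Hz.
  unfold pdot. simpl. destruct Hz as (H1 & H2 & H3). nra.
Qed.

Lemma u1_eq_u2 : conflicts = 0 -> u1 = u2.
Proof.
intros Hd. apply rvec_determines; auto using u1_interval. rewrite rvec_u1, rvec_u2, Hd. f_equal; ring.
Qed.

Lemma u1_neq_u2 : 0 < conflicts -> u1 <> u2.
Proof.
intros Hd E. assert (H := rvec_u1). rewrite E, rvec_u2 in H. injection H as H _. lra.
Qed.

End Pair.
End Interval.

(** * Linear programming over the simplex *)

Lemma filter_length_lt {A} (f g : A -> bool) (l : list A) :
  (forall a, In a l -> f a = true -> g a = true) ->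
  (exists a, In a l /\ f a = false /\ g a = true) ->
  (length (filter f l) < length (filter g l))%nat.
Proof.
intros Hfg (a & Ha & Hf & Hg).
assert (Hle : forall l, (forall a, In a l -> f a = true -> g a = true) ->
  (length (filter f l) <= length (filter g l))%nat).
{ clear. induction l as [|a l IH]; intros H; simpl; [lia|].
  specialize (IH (fun b Hb => H b (or_intror Hb))). specialize (H a (or_introl eq_refl)).
  destruct (f a); [rewrite H by auto; simpl; lia|]. destruct (g a); simpl; lia. }
induction l as [|b l IH]; [destruct Ha|]. simpl.
destruct Ha as [->|Ha].
- rewrite Hf, Hg. simpl. apply le_n_S, Hle. intros c Hc. apply Hfg. now right.
- specialize (IH (fun c Hc => Hfg c (or_intror Hc)) Ha).
  specialize (Hfg b (or_introl eq_refl)).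
  destruct (f b); [rewrite Hfg by auto; simpl; lia|]. destruct (g b); simpl; lia.
Qed.

Fixpoint sublists {A} (l : list A) : list (list A) :=
  match l with [] => [[]] | a :: l => sublists l ++ map (cons a) (sublists l) end.

Lemma filter_sublists {A} (f : A -> bool) (l : list A) : In (filter f l) (sublists l).
Proof.
induction l as [|a l IH]; simpl; auto. apply in_or_app.
destruct (f a); [right; now apply in_map|now left].
Qed.

Section LinearProgram.
Context {T : Type} (D : list T) (m : nat) (b : nat -> T -> R) (v : nat -> R) (J : T -> R).

Definition feasible (x : T -> R) : Prop :=
  (forall p, 0 <= x p) /\ (forall p, x p <> 0 -> In p D) /\ sumL D x = 1 /\
  forall k, (k < m)%nat -> sumL D (fun p => x p * b k p) = v k.

Definition cost (x : T -> R) : R := sumL D (fun p => x p * J p).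

(** A vertex of the polytope: the only feasible point on the face cut out by its zero entries. *)
Definition basic (x : T -> R) : Prop := feasible x /\
  forall y, feasible y -> (forall p, x p = 0 -> y p = 0) -> forall p, y p = x p.

Definition nonzero (x : T -> R) (p : T) : bool := if Req_EM_T (x p) 0 then false else true.

Lemma nonzero_true x p : nonzero x p = true <-> x p <> 0.
Proof. unfold nonzero. destruct (Req_EM_T (x p) 0); split; congruence. Qed.

Lemma nonzero_false x p : nonzero x p = false <-> x p = 0.
Proof. unfold nonzero. destruct (Req_EM_T (x p) 0); split; congruence. Qed.

Lemma feasible_shift x d t : feasible x -> (forall p, d p <> 0 -> In p D) -> sumL D d = 0 ->
  (forall k, (k < m)%nat -> sumL D (fun p => d p * b k p) = 0) ->
  (forall p, 0 <= x p + t * d p) -> feasible (fun p => x p + t * d p).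
Proof.
intros (H0 & Hs & H1 & Hb) Hd Hd1 Hdb Hpos. split; [auto|]. split; [|split].
- intros p Hp. destruct (Req_EM_T (x p) 0) as [E|]; auto.
  apply Hd. intros E'. apply Hp. rewrite E, E'. ring.
- rewrite sumL_plus, sumL_scal, H1, Hd1. ring.
- intros k Hk. rewrite <- (Hb k Hk).
  rewrite (sumL_ext _ _ (fun p => x p * b k p + t * (d p * b k p))) by (intros; ring).
  rewrite sumL_plus, sumL_scal, Hdb by auto. ring.
Qed.

(** From a point that is not a vertex one can move within its face without raising the cost until
    another entry vanishes; the support shrinks, so this ends. *)
Lemma basic_below x : feasible x -> exists y, basic y /\ cost y <= cost x.
Proof.
remember (length (filter (nonzero x) D)) as k eqn:Hk. revert x Hk.
induction k as [k IH] using lt_wf_ind. intros x Hk Hx.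
destruct (classic (basic x)) as [Hbas|Hbas]; [exists x; split; auto; lra|].
assert (Hy : exists y, feasible y /\ (forall p, x p = 0 -> y p = 0) /\ exists p, y p <> x p).
{ apply NNPP. intros Hn. apply Hbas. split; auto. intros y Hy Hxy p. apply NNPP. eauto 7. }
destruct Hy as (y & Hy & Hxy & p0 & Hp0).
assert (Hsgn : exists d : T -> R, (forall p, x p = 0 -> d p = 0) /\ (forall p, d p <> 0 -> In p D) /\
  (exists p, d p <> 0) /\ sumL D d = 0 /\
  (forall k, (k < m)%nat -> sumL D (fun p => d p * b k p) = 0) /\ sumL D (fun p => d p * J p) <= 0).
(* Both [y - x] and its negative are directions within the face; one of them does not raise the
   cost. *)
{ assert (H : forall c, c <> 0 -> c * (cost y - cost x) <= 0 ->
    exists d : T -> R, (forall p, x p = 0 -> d p = 0) /\ (forall p, d p <> 0 -> In p D) /\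
    (exists p, d p <> 0) /\ sumL D d = 0 /\
    (forall k, (k < m)%nat -> sumL D (fun p => d p * b k p) = 0) /\ sumL D (fun p => d p * J p) <= 0).
  { destruct Hx as (_ & Hxs & Hx1 & Hxb). destruct Hy as (_ & Hys & Hy1 & Hyb).
    intros c Hc Hcost. exists (fun p => c * (y p - x p)).
    assert (Hg : forall g, sumL D (fun p => c * (y p - x p) * g p)
      = c * (sumL D (fun p => y p * g p) - sumL D (fun p => x p * g p))).
    { intros g. rewrite <- sumL_minus, <- sumL_scal. apply sumL_ext. intros; ring. }
    repeat split.
    - intros p E. rewrite (Hxy p E), E. ring.
    - intros p Hp. destruct (Req_EM_T (x p) 0) as [E|]; auto.
      exfalso. apply Hp. rewrite (Hxy p E), E. ring.
    - exists p0. intros E. apply Rmult_integral in E. destruct E; lra.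
    - rewrite sumL_scal, sumL_minus, Hx1, Hy1. ring.
    - intros j Hj. rewrite Hg, Hxb, Hyb by auto. ring.
    - now rewrite Hg. }
  destruct (Rle_or_lt (cost y - cost x) 0); [apply (H 1)|apply (H (-1))]; lra. }
destruct Hsgn as (d & Hxd & HdD & (p1 & Hp1) & Hd0 & Hdb & HdJ).
(* The entries of [d] sum to zero without all vanishing, so some entry decreases and the move must
   stop. *)
assert (Hneg : exists p, In p D /\ d p < 0).
{ apply NNPP. intros Hn. apply Hp1.
  apply (sumL_nonneg_zero D d); [|lra|auto]. intros p Hp. apply Rnot_lt_le. eauto. }
destruct (list_argmin D (fun p => d p < 0) (fun p => x p / - d p) Hneg) as (q & Hq & Hdq & Hmin).
(* Ratio test: the longest step that keeps all entries nonnegative, reached when the entry at [q]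
   becomes zero. *)
set (t := x q / - d q) in *.
assert (Ht : 0 <= t).
{ unfold t. apply Rmult_le_pos; [apply Hx|]. apply Rlt_le, Rinv_0_lt_compat. lra. }
assert (Hz : feasible (fun p => x p + t * d p)).
{ apply feasible_shift; auto. intros p. destruct (Rlt_or_le (d p) 0) as [Hdp|Hdp].
  - assert (In p D) by (apply HdD; lra). specialize (Hmin p H Hdp).
    apply Rle_div_r in Hmin; lra.
  - assert (0 <= x p) by apply Hx. nra. }
destruct (IH (length (filter (nonzero (fun p => x p + t * d p)) D))) with (x := fun p => x p + t * d p)
  as (z & Hzb & Hzc); auto.
- rewrite Hk. apply filter_length_lt.
  + intros p _. rewrite !nonzero_true. intros H E. apply H. rewrite E, (Hxd p E). ring.
  + exists q. split; auto. rewrite nonzero_true, nonzero_false. split; [unfold t; field; lra|].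
    intros E. apply Hxd in E. lra.
- exists z. split; auto. eapply Rle_trans; [exact Hzc|]. unfold cost.
  rewrite (sumL_ext _ _ (fun p => x p * J p + t * (d p * J p))) by (intros; ring).
  rewrite sumL_plus, sumL_scal. nra.
Qed.

(* A basic solution is determined by its support, so there are finitely many of them. *)
Lemma LP_minimizer : (exists x, feasible x) ->
  exists x, feasible x /\ forall y, feasible y -> cost x <= cost y.
Proof.
intros (x0 & Hx0).
set (P := fun S x => basic x /\ forall p, x p <> 0 <-> In p S).
assert (Hin : forall x, basic x -> P (filter (nonzero x) D) x).
{ intros x Hx. split; auto. intros p. rewrite filter_In, nonzero_true. split; [|tauto].
  intros Hp. split; auto. now apply Hx. }
destruct (list_argmin (sublists D) (fun S => exists x, P S x)
  (fun S => cost (epsilon (inhabits x0) (P S)))) as (S & HS & HPS & Hmin).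
{ destruct (basic_below x0 Hx0) as (x & Hx & _). exists (filter (nonzero x) D).
  split; [apply filter_sublists|]. exists x. now apply Hin. }
destruct (epsilon_spec (inhabits x0) (P S) HPS) as [[Hf _] _].
exists (epsilon (inhabits x0) (P S)). split; auto. intros y Hy.
destruct (basic_below y Hy) as (z & Hz & Hzy). eapply Rle_trans; [|exact Hzy].
assert (HPz := Hin z Hz). set (S' := filter (nonzero z) D) in *.
specialize (Hmin S' (filter_sublists _ _) (ex_intro _ z HPz)).
destruct (epsilon_spec (inhabits x0) (P S') (ex_intro _ z HPz)) as [[Hf' _] Hs'].
assert (E : cost (epsilon (inhabits x0) (P S')) = cost z); [|lra].
apply sumL_ext. intros p _. f_equal. apply Hz; auto. intros q Hq.
apply NNPP. intros Hn. apply Hs' in Hn. apply (proj2 HPz) in Hn. contradiction.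
Qed.

End LinearProgram.

(** * Extended values *)

(** The default 0 at [pinf] is harmless: values are read only where finite or under a zero
    coefficient. *)
Definition val (a : ER) : R := match a with fin x => x | pinf => 0 end.

Lemma val_fin a : a <> pinf -> a = fin (val a).
Proof. destruct a; [reflexivity|congruence]. Qed.

Lemma escale_fin c a : escale c a <> pinf -> escale c a = fin (c * val a).
Proof.
destruct a; simpl; auto. destruct (Req_EM_T c 0) as [->|]; [|congruence]. intros _. f_equal. ring.
Qed.

Lemma eadd_fin a b : eadd a b <> pinf -> a <> pinf /\ b <> pinf.
Proof. destruct a, b; simpl; split; congruence. Qed.

Lemma escale_neq_pinf c a : c <> 0 -> escale c a <> pinf -> a <> pinf.
Proof. intros Hc. destruct a; simpl; [congruence|]. now destruct (Req_EM_T c 0). Qed.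

Lemma esumL_perm {A} (l l' : list A) (g : A -> ER) : Permutation l l' -> esumL l g = esumL l' g.
Proof.
induction 1; simpl; auto; try congruence.
destruct (g x), (g y), (esumL l g); simpl; auto. f_equal. ring.
Qed.

Lemma lovasz_fin {L} (f : L -> ER) x : finsupp x -> (forall p, x p <> 0 -> f p <> pinf) ->
  lovasz f x = fin (mean x (fun p => val (f p))).
Proof.
intros Hx Hf. unfold lovasz, mean. assert (Hs : forall p, In p (supp x) -> f p <> pinf).
{ intros p Hp. now apply Hf, supp_spec. }
induction (supp x) as [|p l IH]; simpl; [reflexivity|].
rewrite IH by (intros; apply Hs; simpl; auto).
destruct (f p) eqn:E; [reflexivity|]. now destruct (Hs p (or_introl eq_refl)).
Qed.

Lemma lovasz_neq_pinf {L} (f : L -> ER) x : finsupp x -> lovasz f x <> pinf ->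
  forall p, x p <> 0 -> f p <> pinf.
Proof.
intros Hx Hl p Hp. assert (Hin := proj1 (proj2 (supp_spec x Hx) p) Hp).
unfold lovasz in Hl. induction (supp x) as [|q l IH]; [destruct Hin|].
simpl in Hl. apply eadd_fin in Hl. destruct Hl as [H1 H2]. destruct Hin as [->|Hin]; auto.
now apply escale_neq_pinf in H1.
Qed.

(** * Submodularity on frames *)

Section Main.
Context {L : Type} {le : L -> L -> Prop} {meet : L -> L -> L} {n : nat}
  {Frames : (L -> Prop) -> Prop} (HL : is_polar_space le meet n Frames).
Local Notation coord := (@coord L le n).
Context (f : L -> ER).

Record uncrossing (F : L -> Prop) (phi : L -> nat -> S2) (p q u1 u2 : L) : Prop := {
  unc_p : F p; unc_q : F q; unc_u1 : F u1; unc_u2 : F u2;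
  unc_c1 : forall i, (i < n)%nat -> phi u1 i = over (phi p i) (phi q i);
  unc_c2 : forall i, (i < n)%nat -> phi u2 i = over (phi q i) (phi p i)
}.

Lemma uncrossing_ex F phi p q : coord F phi -> F p -> F q ->
  exists u1 u2, uncrossing F phi p q u1 u2.
Proof.
intros Hphi Hp Hq.
assert (H : forall a b, F a -> F b -> exists u, F u /\ forall i, phi u i = over (phi a i) (phi b i)).
{ intros a b Ha Hb. apply (coord_ex Hphi). intros i Hi.
  now rewrite (coord_out Hphi a), (coord_out Hphi b). }
destruct (H p q Hp Hq) as (u1 & Hu1 & E1). destruct (H q p Hq Hp) as (u2 & Hu2 & E2).
exists u1, u2. constructor; auto.
Qed.

(** Submodularity with the infinities resolved: finite values at [p] and [q] force finite values at
    all three other elements. *)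
Definition halves_bound (p q u1 u2 : L) : Prop := forall a b, f p = fin a -> f q = fin b ->
  exists c d1 d2, f (meet p q) = fin c /\ f u1 = fin d1 /\ f u2 = fin d2 /\
    c + / 2 * d1 + / 2 * d2 <= a + b.

Lemma halves_bound_iff p q u1 u2 : halves_bound p q u1 u2 <->
  ele (eadd (f (meet p q)) (eadd (escale (/ 2) (f u1)) (escale (/ 2) (f u2)))) (eadd (f p) (f q)).
Proof.
unfold halves_bound. split.
- intros H. destruct (f p) as [a|], (f q) as [b|]; try (now destruct (eadd (f (meet p q)) _)).
  destruct (H a b eq_refl eq_refl) as (c & d1 & d2 & -> & -> & -> & Hle). simpl. lra.
- intros H a b Ea Eb. rewrite Ea, Eb in H. simpl in H.
  destruct (f (meet p q)) as [c|], (f u1) as [d1|], (f u2) as [d2|]; simpl in H;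
    try (destruct (Req_EM_T (/ 2) 0); [lra|]; simpl in H); try contradiction.
  exists c, d1, d2. repeat split; auto. lra.
Qed.

(** Without conflicts the set has the single element [u1 = u2] with coefficient 1; counting it as
    two halves merges this case with the generic one. *)
Lemma esumL_Epq F phi p q u1 u2 l : Frames F -> coord F phi -> uncrossing F phi p q u1 u2 ->
  NoDup l -> (forall u, In u l <-> Epq le meet p q u) ->
  esumL l (fun u => if Req_EM_T (coefE le meet p q u) 0 then fin 0
                    else escale (coefE le meet p q u) (f u))
  = eadd (escale (/ 2) (f u1)) (escale (/ 2) (f u2)).
Proof.
intros HF Hphi [Hp Hq Hu1 Hu2 E1 E2] Hl Hin.
assert (HE := fun u => Epq_iff HL HF Hphi Hp Hq Hu1 Hu2 E1 E2 u).
destruct (Rle_lt_or_eq_dec 0 _ (conflicts_nonneg (n := n) (phi := phi) (p := p) (q := q))) as [Hd|Hd].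
- assert (Hne := u1_neq_u2 HL HF Hphi Hp Hq Hu1 Hu2 E1 E2 Hd).
  assert (Hperm : Permutation l [u1; u2]).
  { apply NoDup_Permutation; auto.
    - repeat constructor; simpl; intuition.
    - intros u. rewrite Hin, HE. simpl. intuition. }
  rewrite (esumL_perm _ _ _ Hperm). simpl.
  rewrite (coefE_u1 HL HF Hphi Hp Hq Hu1 Hu2 E1 E2 Hd), (coefE_u2 HL HF Hphi Hp Hq Hu1 Hu2 E1 E2 Hd).
  destruct (Req_EM_T (/ 2) 0) as [E|_]; [lra|].
  f_equal. destruct (f u2); simpl; [f_equal; ring|]. destruct (Req_EM_T (/ 2) 0); [lra|reflexivity].
- symmetry in Hd. assert (Heq := u1_eq_u2 HL HF Hphi Hp Hq Hu1 Hu2 E1 E2 Hd).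
  assert (Hperm : Permutation l [u1]).
  { apply NoDup_Permutation; auto.
    - repeat constructor; simpl; intuition.
    - intros u. rewrite Hin, HE, <- Heq. simpl. intuition. }
  rewrite (esumL_perm _ _ _ Hperm). simpl.
  rewrite (coefE_join HL HF Hphi Hp Hq Hu1 E1 Hd), <- Heq.
  destruct (Req_EM_T 1 0) as [E|_]; [lra|].
  destruct (f u1); simpl; [f_equal; field|].
  destruct (Req_EM_T 1 0); [lra|]. destruct (Req_EM_T (/ 2) 0); [lra|reflexivity].
Qed.

Lemma submodular_iff : submodular le meet f <->
  forall F phi p q u1 u2, Frames F -> coord F phi -> uncrossing F phi p q u1 u2 ->
    halves_bound p q u1 u2.
Proof.
split.
- intros Hs F phi p q u1 u2 HF Hphi Hu. apply halves_bound_iff.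
  destruct Hu as [Hp Hq Hu1 Hu2 E1 E2].
  assert (HE := fun u => Epq_iff HL HF Hphi Hp Hq Hu1 Hu2 E1 E2 u).
  set (l := nodup eqdec [u1; u2]).
  assert (Hl : NoDup l) by apply NoDup_nodup.
  assert (Hin : forall u, In u l <-> Epq le meet p q u).
  { intros u. unfold l. rewrite HE, nodup_In. simpl. intuition. }
  rewrite <- (esumL_Epq F phi p q u1 u2 l); auto. constructor; auto.
- intros H p q l Hl Hin. destruct (frames_pair HL p q) as (F & HF & Hp & Hq).
  destruct (frames_coord HL F HF) as (phi & Hphi).
  destruct (uncrossing_ex F phi p q Hphi Hp Hq) as (u1 & u2 & Hu).
  rewrite (esumL_Epq F phi p q u1 u2 l); auto. apply halves_bound_iff. now apply (H F phi).
Qed.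

(** * From convexity to submodularity *)

(** Chosen so that [sv a + sv b = sv (S2meet a b) + sv (soft a b)]: the midpoint of the vertices [p]
    and [q] is then also the midpoint of [meet p q] and [w], which are comparable. There the Lovasz
    extension is the mean of the values at these two. *)
Definition soft (a b : S2) : S2 :=
  if S2_dec a S2z then b else if S2_dec b S2z then a else if S2_dec a b then a else S2z.

Lemma convex_midpoint F phi p q w : Kconvex le (lovasz f) -> Frames F -> coord F phi ->
  F p -> F q -> F w -> (forall i, (i < n)%nat -> phi w i = soft (phi p i) (phi q i)) ->
  forall a b, f p = fin a -> f q = fin b ->
  exists c d, f (meet p q) = fin c /\ f w = fin d /\ c + d <= a + b.
Proof.
intros HK HF Hphi Hp Hq Hw Ew a b Ea Eb.
destruct (geodesic_through HL HF Hphi (indic p) (indic q) (indic_supported HL F p Hp) (indic_supported HL F q Hq))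
  as (g & Hg & Hg0 & Hg1 & Hgs).
destruct (Hgs (1 / 2)) as [Hm Hmb]; [lra|].
set (o := meet p q) in *. assert (Ho : F o) by now apply (frames_meet HL).
set (x := fun r => / 2 * indic o r + / 2 * indic w r).
assert (Fx : finsupp x) by (apply comb_finsupp; apply indic_finsupp).
assert (Hmean : forall h, mean x h = / 2 * h o + / 2 * h w).
{ intros h. unfold x. rewrite mean_comb, !mean_of_indic by apply indic_finsupp. reflexivity. }
assert (Hsx : forall r, x r <> 0 -> r = o \/ r = w).
{ intros r Hr. destruct (eqdec o r) as [|H1]; auto. destruct (eqdec w r) as [|H2]; auto.
  exfalso. apply Hr. unfold x. rewrite !indic_diff by auto. ring. }
assert (How : le o w).
{ apply (coord_le Hphi); auto. intros i Hi. unfold o. rewrite (meet_coord HL F), Ew by auto.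
  destruct (phi p i), (phi q i); simpl; auto using s2le_refl; now right. }
assert (Hx : supported (le := le) (F := F) x).
{ split.
  - apply point_intro; auto.
    + intros r. unfold x. assert (H1 := indic_nonneg o r). assert (H2 := indic_nonneg w r). lra.
    + intros r s Hr Hs. apply Hsx in Hr, Hs.
      assert (Hrefl := le_refl HL).
      destruct Hr as [->| ->], Hs as [->| ->]; auto.
    + rewrite Hmean. lra.
  - intros r Hr. destruct (Hsx r Hr) as [->| ->]; auto. }
assert (E : g (1 / 2) = x).
{ apply (supported_unique HL Hphi); auto. intros i Hi. rewrite Hmb by auto. unfold lerp, bary.
  rewrite Hmean, !mean_of_indic, Ew by auto. unfold o. rewrite (meet_coord HL F) by auto.
  destruct (phi p i), (phi q i); simpl; lra. }
assert (Hc := HK g Hg (1 / 2) ltac:(lra)). rewrite E, Hg0, Hg1 in Hc.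
rewrite (lovasz_fin f (indic p)), (lovasz_fin f (indic q)) in Hc.
2,4: apply indic_finsupp. 2,3: intros r Hr; apply indic_neq0 in Hr; congruence.
rewrite !mean_of_indic, Ea, Eb in Hc. simpl in Hc.
assert (Hlx : lovasz f x <> pinf) by (intros H; rewrite H in Hc; destruct Hc).
assert (Hfin := lovasz_neq_pinf f x Fx Hlx).
assert (Hxo : x o <> 0).
{ unfold x. rewrite indic_same. assert (H := indic_nonneg w o). lra. }
assert (Hxw : x w <> 0).
{ unfold x. rewrite indic_same. assert (H := indic_nonneg o w). lra. }
rewrite (lovasz_fin f x Fx Hfin), Hmean in Hc. simpl in Hc.
exists (val (f o)), (val (f w)). split; [|split]; try (apply val_fin; auto). lra.
Qed.

Lemma convex_submodular : Kconvex le (lovasz f) -> submodular le meet f.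
Proof.
intros HK. apply submodular_iff. intros F phi p q u1 u2 HF Hphi [Hp Hq Hu1 Hu2 E1 E2] a b Ea Eb.
assert (HM := fun p q w Hp Hq Hw Ew => convex_midpoint F phi p q w HK HF Hphi Hp Hq Hw Ew).
assert (Hw : exists w, F w /\ forall i, phi w i = soft (phi p i) (phi q i)).
{ apply (coord_ex Hphi). intros i Hi. now rewrite (coord_out Hphi p), (coord_out Hphi q). }
destruct Hw as (w & Hw & Ew).
assert (HFm := fun x y => frames_meet HL F x y HF).
assert (Hco := fun x y Hx Hy => meet_coord HL F phi x y HF Hphi Hx Hy).
destruct (HM p q w) with (a := a) (b := b) as (c & d & Ec & Ed & H1); auto.
destruct (HM p w u1) with (a := a) (b := d) as (e1 & d1 & Ee1 & Ed1 & H2); auto.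
{ intros i Hi. rewrite E1, Ew by auto. destruct (phi p i), (phi q i); reflexivity. }
destruct (HM q w u2) with (a := b) (b := d) as (e2 & d2 & Ee2 & Ed2 & H3); auto.
{ intros i Hi. rewrite E2, Ew by auto. destruct (phi p i), (phi q i); reflexivity. }
destruct (HM (meet p w) (meet q w) w) with (a := e1) (b := e2) as (c' & d' & Ec' & Ed' & H4); auto.
{ intros i Hi. rewrite !Hco, Ew by auto. destruct (phi p i), (phi q i); reflexivity. }
destruct (HM u1 u2 w) with (a := d1) (b := d2) as (g & d'' & Eg & Ed'' & H5); auto.
{ intros i Hi. rewrite E1, E2, Ew by auto. destruct (phi p i), (phi q i); reflexivity. }
assert (Eo : meet (meet p w) (meet q w) = meet p q).
{ apply (coord_inj HL Hphi); auto. intros i Hi. rewrite !Hco, Ew by auto.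
  destruct (phi p i), (phi q i); reflexivity. }
assert (Ew' : meet u1 u2 = w).
{ apply (coord_inj HL Hphi); auto. intros i Hi. rewrite Hco, E1, E2, Ew by auto.
  destruct (phi p i), (phi q i); reflexivity. }
rewrite Eo in Ec'. rewrite Ew' in Eg.
assert (c' = c) by congruence. assert (d' = d) by congruence. assert (d'' = d) by congruence.
assert (g = d) by congruence. subst.
(* In the sum of the instances for [(p, q)], [(p, w)], [(q, w)] and [(meet p w, meet q w)] the
   values at [w], [meet p w] and [meet q w] cancel, which leaves twice the claim. *)
exists c, d1, d2. repeat split; auto. lra.
Qed.

(** * From submodularity to convexity *)

(* Strictly increasing and strictly concave in the rank on [[0, n]], which makes every
   uncrossing of incomparable elements strictly profitable. *)
Definition potential (p : L) : R :=
  (2 * INR n + 1) * INR (rank le p) - INR (rank le p) ^ 2.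

(** Let [c] count agreements, [d] conflicts, and [a], [b] the coordinates used by only one of [p],
    [q]. The ranks are [a+c+d], [b+c+d], [c], and [a+b+c+d] for both [u1] and [u2], so the gain is
    [d * (2n + 1 - 2c - d) + 2ab]. The first factor pair is nonnegative because [c + d <= n], and
    incomparability means [d > 0] or [a, b > 0]. *)
Lemma potential_uncross F phi p q u1 u2 : Frames F -> coord F phi -> uncrossing F phi p q u1 u2 ->
  ~ le p q -> ~ le q p ->
  potential (meet p q) + / 2 * potential u1 + / 2 * potential u2 < potential p + potential q.
Proof.
intros HF Hphi [Hp Hq Hu1 Hu2 E1 E2] Hpq Hqp.
assert (Hm : F (meet p q)) by now apply (frames_meet HL).
set (only := fun a b => if S2_dec b S2z then sv a ^ 2 else 0).
set (a := sumL (seq 0 n) (fun i => only (phi p i) (phi q i))).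
set (b := sumL (seq 0 n) (fun i => only (phi q i) (phi p i))).
set (c := sumL (seq 0 n) (fun i => sv (S2meet (phi p i) (phi q i)) ^ 2)).
set (d := sumL (seq 0 n) (fun i => conflict (phi p i) (phi q i))).
assert (Rp : INR (rank le p) = a + c + d).
{ rewrite (rank_coord HL F phi), nnz_INR by auto. unfold a, c, d. rewrite <- !sumL_plus.
  apply sumL_ext. intros i _. unfold only, conflict. destruct (phi p i), (phi q i); simpl; lra. }
assert (Rq : INR (rank le q) = b + c + d).
{ rewrite (rank_coord HL F phi), nnz_INR by auto. unfold b, c, d. rewrite <- !sumL_plus.
  apply sumL_ext. intros i _. unfold only, conflict. destruct (phi p i), (phi q i); simpl; lra. }
assert (Rm : INR (rank le (meet p q)) = c).
{ rewrite (rank_coord HL F phi), nnz_INR by auto. apply sumL_ext. intros i Hi. apply in_seq in Hi.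
  now rewrite (meet_coord HL F) by (auto; lia). }
assert (R1 : INR (rank le u1) = a + b + c + d).
{ rewrite (rank_coord HL F phi), nnz_INR by auto. unfold a, b, c, d. rewrite <- !sumL_plus.
  apply sumL_ext. intros i Hi. apply in_seq in Hi. rewrite E1 by lia.
  unfold only, conflict. destruct (phi p i), (phi q i); simpl; lra. }
assert (R2 : INR (rank le u2) = a + b + c + d).
{ rewrite (rank_coord HL F phi), nnz_INR by auto. unfold a, b, c, d. rewrite <- !sumL_plus.
  apply sumL_ext. intros i Hi. apply in_seq in Hi. rewrite E2 by lia.
  unfold only, conflict. destruct (phi p i), (phi q i); simpl; lra. }
assert (Ha : 0 <= a).
{ apply sumL_nonneg. intros i _. unfold only. destruct (phi p i), (phi q i); simpl; lra. }
assert (Hb : 0 <= b).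
{ apply sumL_nonneg. intros i _. unfold only. destruct (phi p i), (phi q i); simpl; lra. }
assert (Hd : 0 <= d) by apply conflicts_nonneg.
assert (Hn : 2 * c + d <= 2 * INR n).
{ assert (H : forall k, sumL (seq 0 k) (fun _ : nat => 2) = 2 * INR k).
  { intros k. induction k as [|k IH]; [simpl; lra|]. rewrite seq_S, sumL_app, IH, S_INR. simpl. lra. }
  rewrite <- H. unfold c, d. rewrite <- sumL_scal, <- sumL_plus. apply sumL_le. intros i _.
  unfold conflict. destruct (phi p i), (phi q i); simpl; lra. }
assert (Hpos : d > 0 \/ (a > 0 /\ b > 0)).
{ destruct (Rle_lt_or_eq_dec 0 d Hd) as [|Ed]; [left; lra|right].
  assert (Hd0 := sumL_nonneg_zero (seq 0 n) (fun i => conflict (phi p i) (phi q i))).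
  assert (Hc0 : forall i, (i < n)%nat -> conflict (phi p i) (phi q i) = 0).
  { intros i Hi. apply Hd0; [|fold d; lra|apply in_seq; lia].
    intros j _. unfold conflict. destruct (phi p j), (phi q j); simpl; lra. }
  split.
  - destruct (Rle_lt_or_eq_dec 0 a Ha) as [|Ea]; [lra|]. exfalso. apply Hpq, (coord_le Hphi); auto.
    intros i Hi. specialize (Hc0 i Hi).
    assert (H0 := sumL_nonneg_zero (seq 0 n) (fun i => only (phi p i) (phi q i))).
    assert (Ei : only (phi p i) (phi q i) = 0).
    { apply H0; [|fold a; lra|apply in_seq; lia].
      intros j _. unfold only. destruct (phi p j), (phi q j); simpl; lra. }
    unfold conflict, only, s2le in *. destruct (phi p i), (phi q i); simpl in *; auto; lra.
  - destruct (Rle_lt_or_eq_dec 0 b Hb) as [|Eb]; [lra|]. exfalso. apply Hqp, (coord_le Hphi); auto.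
    intros i Hi. specialize (Hc0 i Hi).
    assert (H0 := sumL_nonneg_zero (seq 0 n) (fun i => only (phi q i) (phi p i))).
    assert (Ei : only (phi q i) (phi p i) = 0).
    { apply H0; [|fold b; lra|apply in_seq; lia].
      intros j _. unfold only. destruct (phi p j), (phi q j); simpl; lra. }
    unfold conflict, only, s2le in *. destruct (phi p i), (phi q i); simpl in *; auto; lra. }
unfold potential. rewrite Rp, Rq, Rm, R1, R2. apply Rlt_0_minus.
match goal with |- 0 < ?g => replace g with (d * (2 * INR n + 1 - 2 * c - d) + 2 * (a * b)) by field end.
destruct Hpos as [Hpos|[Hpa Hpb]].
- assert (0 < d * (2 * INR n + 1 - 2 * c - d)) by (apply Rmult_lt_0_compat; lra).
  assert (0 <= a * b) by (apply Rmult_le_pos; lra). lra.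
- assert (0 <= d * (2 * INR n + 1 - 2 * c - d)) by (apply Rmult_le_pos; lra).
  assert (0 < a * b) by (apply Rmult_lt_0_compat; lra). lra.
Qed.

Lemma frame_finite F phi : coord F phi -> exists l, forall p, F p -> In p l.
Proof.
intros Hphi. destruct (allvecs_ex n) as (vs & Hvs).
assert (H : forall w, exists p, F p /\ (s2vec n w -> forall i, phi p i = w i)).
{ intros w. destruct (classic (s2vec n w)) as [Hw|Hw].
  - destruct (coord_ex Hphi w Hw) as (p & Hp & Hpi). now exists p.
  - destruct (coord_ex Hphi (fun _ => S2z)) as (p & Hp & _); [now intros i _|]. now exists p. }
exists (map (fun w => proj1_sig (constructive_indefinite_description _ (H w))) vs).
intros p Hp. destruct (Hvs (phi p)) as (w & Hw & Hwv & Hwe); [now apply Hphi|].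
apply in_map_iff. exists w. split; auto.
destruct (constructive_indefinite_description _ _) as (q & Hq & Hqi). simpl.
apply (coord_inj HL Hphi); auto. intros i Hi. rewrite Hqi, Hwe; auto.
Qed.

(* A cheapest measure with barycentre [v] is supported on a chain: otherwise replacing
   equal masses at incomparable [p], [q] by [meet p q] and half of each of [u1], [u2]
   keeps the barycentre and lowers the cost. *)
Lemma chain_minimizer F phi x0 eps : Frames F -> coord F phi ->
  (forall p q u1 u2, uncrossing F phi p q u1 u2 -> halves_bound p q u1 u2) ->
  (forall p, 0 <= x0 p) -> finsupp x0 -> mean x0 (fun _ => 1) = 1 ->
  (forall p, x0 p <> 0 -> F p /\ f p <> pinf) -> 0 < eps ->
  exists x, supported (le := le) (F := F) x /\ (forall p, x p <> 0 -> f p <> pinf) /\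
    (forall i, (i < n)%nat -> bary phi x i = bary phi x0 i) /\
    mean x (fun p => val (f p) + eps * potential p) <= mean x0 (fun p => val (f p) + eps * potential p).
Proof.
intros HF Hphi Hsub Hx0 Fx0 Hx01 HxF Heps.
set (J := fun p => val (f p) + eps * potential p).
destruct (frame_finite F phi Hphi) as (FL & HFL).
(* The program only sees elements of finite value. Uncrossing stays inside [D], because
   [halves_bound] also provides finiteness. *)
destruct (classical_filter (fun p => F p /\ f p <> pinf) FL) as (D & HD & HinD).
assert (HDin : forall p, F p -> f p <> pinf -> In p D) by (intros; apply HinD; auto).
assert (Hmean0 : forall g, mean x0 g = sumL D (fun p => x0 p * g p)).
{ intros g. apply mean_list; auto. intros p Hp. apply HDin; now apply HxF. }
set (b := fun i p => sv (phi p i)). set (v := bary phi x0).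
destruct (LP_minimizer D n b v J) as (x & Hx & Hmin).
{ exists x0. split; [auto|]. split; [intros p Hp; apply HDin; now apply HxF|]. split.
  - rewrite <- Hx01, Hmean0. apply sumL_ext. intros; ring.
  - intros k _. unfold v, bary. now rewrite Hmean0. }
assert (Hx' := Hx). destruct Hx' as (Hx1 & HxD & Hx2 & Hxb).
assert (Fx : finsupp x) by now exists D.
assert (Hmeanx : forall g, mean x g = sumL D (fun p => x p * g p)) by (intros g; now apply mean_list).
exists x. split; [split|split; [|split]].
- apply point_intro; auto.
  + intros p q Hp Hq. apply NNPP. intros Hn.
    assert (Dp := HxD p Hp). assert (Dq := HxD q Hq). apply HinD in Dp, Dq.
    destruct Dp as (_ & Fp & fp). destruct Dq as (_ & Fq & fq).
    destruct (uncrossing_ex F phi p q Hphi Fp Fq) as (u1 & u2 & Hu).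
    destruct (Hsub p q u1 u2 Hu _ _ (val_fin _ fp) (val_fin _ fq)) as (c & d1 & d2 & Ec & Ed1 & Ed2 & Hle).
    assert (Hphi' := potential_uncross F phi p q u1 u2 HF Hphi Hu ltac:(tauto) ltac:(tauto)).
    assert (Hpq : p <> q) by (intros ->; apply Hn; left; apply (le_refl HL)).
    destruct Hu as [_ _ Hu1 Hu2 E1 E2]. set (o := meet p q) in *.
    assert (Fo : F o) by now apply (frames_meet HL).
    assert (Do : In o D) by (apply HDin; congruence).
    assert (D1 : In u1 D) by (apply HDin; congruence).
    assert (D2 : In u2 D) by (apply HDin; congruence).
    set (dir := fun r => indic o r + / 2 * indic u1 r + / 2 * indic u2 r - indic p r - indic q r).
    assert (Hdir : forall g, sumL D (fun r => dir r * g r) = g o + / 2 * g u1 + / 2 * g u2 - g p - g q).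
    { intros g.
      rewrite <- (sumL_indic D o g), <- (sumL_indic D u1 g), <- (sumL_indic D u2 g),
        <- (sumL_indic D p g), <- (sumL_indic D q g) by auto.
      rewrite <- !sumL_scal, <- !sumL_plus, <- !sumL_minus. apply sumL_ext. intros; unfold dir; ring. }
    set (t := Rmin (x p) (x q)).
    assert (Hxp := Hx1 p). assert (Hxq := Hx1 q).
    assert (Ht : 0 < t) by (unfold t; apply Rmin_glb_lt; lra).
    assert (Htp : t <= x p) by apply Rmin_l. assert (Htq : t <= x q) by apply Rmin_r.
    assert (Hf : feasible D n b v (fun r => x r + t * dir r)).
    { apply feasible_shift; auto.
      - intros r Hr. apply NNPP. intros HrD. apply Hr. unfold dir.
        assert (Hne : forall a, In a D -> indic a r = 0).
        { intros a Ha. apply indic_diff. intros ->. contradiction. }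
        rewrite !Hne by auto. ring.
      - rewrite (sumL_ext _ _ (fun r => dir r * 1)) by (intros; ring).
        rewrite (Hdir (fun _ => 1)). field.
      - intros k Hk. rewrite Hdir. unfold b. rewrite E1, E2 by auto. unfold o.
        rewrite (meet_coord HL F) by auto. destruct (phi p k), (phi q k); simpl; lra.
      - intros r. assert (Hr := Hx1 r). unfold dir.
        assert (0 <= t * (indic o r + / 2 * indic u1 r + / 2 * indic u2 r)).
        { assert (H1 := indic_nonneg o r). assert (H2 := indic_nonneg u1 r). assert (H3 := indic_nonneg u2 r).
          apply Rmult_le_pos; lra. }
        destruct (eqdec p r) as [<-|Hpr]; [|destruct (eqdec q r) as [<-|Hqr]].
        + rewrite (indic_same p), (indic_diff q p) by auto. lra.
        + rewrite (indic_same q), (indic_diff p q) by auto. lra.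
        + rewrite (indic_diff p r), (indic_diff q r) by auto. lra. }
    specialize (Hmin _ Hf). unfold cost in Hmin.
    rewrite (sumL_ext D (fun r => (x r + t * dir r) * J r) (fun r => x r * J r + t * (dir r * J r))) in Hmin
      by (intros; ring).
    rewrite sumL_plus, sumL_scal, Hdir in Hmin.
    assert (HJ : J o + / 2 * J u1 + / 2 * J u2 - J p - J q < 0).
    { unfold J. rewrite Ec, Ed1, Ed2. simpl val at 1 2 3.
      assert (eps * (potential o + / 2 * potential u1 + / 2 * potential u2) < eps * (potential p + potential q))
        by (apply Rmult_lt_compat_l; auto).
      lra. }
    nra.
  + rewrite Hmeanx. transitivity (sumL D x); auto. apply sumL_ext. intros; ring.
- intros p Hp. now apply HinD, HxD.
- intros p Hp. now apply HinD, HxD.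
- intros i Hi. unfold bary. rewrite Hmeanx. now apply Hxb.
- rewrite Hmeanx, Hmean0. apply Hmin.
  split; [auto|]. split; [intros p Hp; apply HDin; now apply HxF|]. split.
  + rewrite <- Hx01, Hmean0. apply sumL_ext. intros; ring.
  + intros k _. unfold v, bary. now rewrite Hmean0.
Qed.

Lemma submodular_convex : submodular le meet f -> Kconvex le (lovasz f).
Proof.
intros Hs g Hg t Ht. rewrite submodular_iff in Hs.
set (x := g 0). set (y := g 1).
assert (Px : is_point le x) by (apply Hg; lra). assert (Py : is_point le y) by (apply Hg; lra).
assert (Fx := point_finsupp x Px). assert (Fy := point_finsupp y Py).
destruct (frames_chains HL _ _ (point_chain x Px) (point_chain y Py)) as (F & HF & HFx & HFy).
destruct (frames_coord HL F HF) as (phi & Hphi).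
assert (Sx : supported (le := le) (F := F) x) by now split.
assert (Sy : supported (le := le) (F := F) y) by now split.
destruct (geodesic_in_frame HL HF Hphi g t Hg Sx Sy Ht) as [Sm Hmb].
set (m := g t) in *. fold x y in Hmb.
destruct (classic (eadd (escale (1 - t) (lovasz f x)) (escale t (lovasz f y)) = pinf)) as [E|E].
{ rewrite E. now destruct (lovasz f m). }
set (x0 := fun p => (1 - t) * x p + t * y p).
assert (F0 : finsupp x0) by now apply comb_finsupp.
assert (Hmean0 : forall h, mean x0 h = (1 - t) * mean x h + t * mean y h).
{ intros h. now apply mean_comb. }
assert (Hx := point_nonneg x Px). assert (Hy := point_nonneg y Py).
destruct (eadd_fin _ _ E) as [E1 E2].
assert (Hxy : forall p, x0 p <> 0 -> F p /\ f p <> pinf).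
{ intros p Hp. destruct (Req_EM_T ((1 - t) * x p) 0) as [Ex|Ex].
  - assert (Ey : t * y p <> 0) by (intros Ey; apply Hp; unfold x0; rewrite Ex, Ey; ring).
    assert (Hyp : y p <> 0) by (intros H; apply Ey; rewrite H; ring).
    assert (Ht0 : t <> 0) by (intros H; apply Ey; rewrite H; ring).
    split; [now apply HFy|]. apply (lovasz_neq_pinf f y); auto. now apply (escale_neq_pinf t).
  - assert (Hxp : x p <> 0) by (intros H; apply Ex; rewrite H; ring).
    assert (Ht0 : 1 - t <> 0) by (intros H; apply Ex; rewrite H; ring).
    split; [now apply HFx|]. apply (lovasz_neq_pinf f x); auto. now apply (escale_neq_pinf (1 - t)). }
(* Includes [c = 0], that is [t = 0] or [t = 1], where an infinite value at one end is multiplied by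
   zero. *)
assert (Hval : forall c z, finsupp z -> escale c (lovasz f z) <> pinf ->
  escale c (lovasz f z) = fin (c * mean z (fun p => val (f p)))).
{ intros c z Fz Hz. rewrite (escale_fin _ _ Hz). f_equal.
  destruct (Req_EM_T c 0) as [->|Hc]; [ring|]. apply escale_neq_pinf in Hz; auto.
  rewrite lovasz_fin; auto. now apply lovasz_neq_pinf. }
rewrite (Hval (1 - t) x), (Hval t y) by auto.
(* Whatever [eps], the minimizer is a point of the frame with the barycentre of [m], hence [m]
   itself; so the inequalities for different [eps] concern the same point. *)
assert (Hmin : forall eps, 0 < eps -> (forall p, m p <> 0 -> f p <> pinf) /\
  mean m (fun p => val (f p)) + eps * mean m potential
  <= mean x0 (fun p => val (f p)) + eps * mean x0 potential).
{ intros eps He. destruct (chain_minimizer F phi x0 eps HF Hphi) as (z & Hz & Hfz & Hzb & Hle); auto.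
  - intros p q u1 u2 Hu. now apply (Hs F phi).
  - intros p. specialize (Hx p). specialize (Hy p). unfold x0.
    apply Rplus_le_le_0_compat; apply Rmult_le_pos; lra.
  - rewrite Hmean0, !(point_total (le := le)) by auto. ring.
  - assert (Ezm : z = m).
    { apply (supported_unique HL Hphi); auto. intros i Hi. rewrite Hmb, Hzb by auto.
      unfold bary at 1. rewrite Hmean0. reflexivity. }
    subst z. split; auto. rewrite !mean_plus, !mean_scal in Hle. exact Hle. }
destruct (Hmin 1) as [Hfin _]; [lra|].
rewrite (lovasz_fin f m); auto; [|apply (point_finsupp (le := le)), Sm]. simpl. rewrite <- Hmean0.
set (u := mean m (fun p => val (f p))) in *. set (w := mean x0 (fun p => val (f p))) in *.
set (k := mean x0 potential - mean m potential).
assert (Hk : forall eps, 0 < eps -> u - w <= eps * k).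
{ intros eps He. destruct (Hmin eps He) as [_ H]. unfold k. lra. }
apply Rnot_lt_le. intros Hlt. assert (H1 := Hk 1 ltac:(lra)).
(* [H1] and [u > w] give [k > 0]; this choice of [eps] would yield [u - w <= (u - w) / 2]. *)
assert (H2 := Hk ((u - w) / (2 * k)) ltac:(apply Rdiv_lt_0_compat; lra)).
replace ((u - w) / (2 * k) * k) with ((u - w) / 2) in H2 by (field; lra). lra.
Qed.

End Main.

Theorem theorem3p11 (L : Type) (le : L -> L -> Prop) (meet : L -> L -> L)
    (n : nat) (Frames : (L -> Prop) -> Prop)
    (HL : is_polar_space le meet n Frames) (f : L -> ER) :
  submodular le meet f <-> Kconvex le (lovasz f).
Proof.
split; [apply (submodular_convex HL)|apply (convex_submodular HL)].
Qed.
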